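(* Let $d\ge 1$, $0<\alpha<2$ and $\alpha<d$. Let $\psi$ be a Bernstein function with $\psi(0)=0$, $\psi(1)=1$ and $\psi(\lambda)=\lambda^{\alpha/2}/l(1/\lambda)$, where $l$ is slowly varying at infinity. Assume that the renewal sequence $C(n)$ associated with $\psi$ satisfies $$C(n)\sim\frac{1}{\Gamma(\alpha/2)}\,n^{\alpha/2-1}\,l(n),\qquad n\to\infty.$$ Then the Green function $G_\psi$ of the $\psi$-subordinated simple random walk $S_\psi$ on $\mathbb{Z}^d$ satisfies $$G_\psi(x)\sim\frac{C_{d,\alpha}}{\|x\|^{d}\,\psi(1/\|x\|^2)},\qquad x\in\mathbb{Z}^d,\ \|x\|\to\infty,$$ where $$C_{d,\alpha}=\Big(\frac d2\Big)^{\alpha/2}\frac{\pi^{-d/2}}{\Gamma(\alpha/2)}\,\Gamma\Big(\frac{d-\alpha}{2}\Big).$$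
   Context: $\|\cdot\|$ is the Euclidean norm; $f\sim g$ means $f/g\to1$. A Bernstein function is a non-negative $\psi\in C^\infty((0,\infty))$ with $(-1)^{n-1}\psi^{(n)}\ge0$ for all $n\ge1$; it has the representation $\psi(\theta)=a+b\theta+\int_{(0,\infty)}(1-e^{-\theta s})\,d\nu(s)$ with $a,b\ge0$ and $\int_{(0,\infty)}\min\{1,s\}\,d\nu(s)<\infty$ ($\psi(0)=\psi(0+)$). When $\psi(0)=0$, $\psi(1)=1$, set $c(\psi,1)=b+\int_{(0,\infty)}te^{-t}\,d\nu(t)$ and $c(\psi,n)=\frac1{n!}\int_{(0,\infty)}t^ne^{-t}\,d\nu(t)$ for $n>1$; this is a probability distribution on $\{1,2,\dots\}$. The renewal sequence is $C(0)=1$, $C(n)=\sum_{k=1}^n c(\psi,k)C(n-k)$ for $n\ge1$. Let $p(k,x)$ be the $k$-step transition probability from $0$ to $x$ of the simple random walk on $\mathbb{Z}^d$ (steps uniform on $\pm e_1,\dots,\pm e_d$). The $\psi$-subordinated simple random walk $S_\psi$ has step law $\sum_{n\ge1}c(\psi,n)\,p(n,\cdot)$; with $p_\psi(n,x)$ its $n$-step transition probability from $0$ to $x$, its Green function is $G_\psi(x)=\sum_{n\ge1}p_\psi(n,x)=\sum_{k\ge1}p(k,x)\,C(k)$. A positive function $l$ is slowly varying at infinity if $l(\lambda x)/l(x)\to1$ as $x\to\infty$ for every $\lambda>0$. *)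

(* Defs.v *)
From HB Require Import structures.
From mathcomp Require Import all_boot all_order all_algebra.
From mathcomp Require Import all_classical all_reals all_analysis.

Set Implicit Arguments.
Unset Strict Implicit.
Unset Printing Implicit Defensive.

Import Order.TTheory GRing.Theory Num.Theory.
Import numFieldNormedType.Exports.

Local Open Scope classical_set_scope.
Local Open Scope ring_scope.

Definition Gamma (R : realType) (s : R) : R :=
  \int[lebesgue_measure]_(t in `]0, +oo[) (t `^ (s - 1) * expR (- t)).

Definition slowly_varying (R : realType) (l : R -> R) : Prop :=
  (forall x : R, 0 < x -> 0 < l x) /\
  (forall lam : R, 0 < lam -> l (lam * x) / l x @[x --> +oo] --> (1 : R)).

(* A function on (0, +oo) is represented by a total function whose values at
   negative reals are irrelevant; the value at 0 is fixed by the convention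
   psi(0) = psi(0+). *)
Definition bernstein (R : realType) (psi : R -> R) : Prop :=
  [/\ forall x : R, 0 < x -> 0 <= psi x,
      forall (n : nat) (x : R), 0 < x -> derivable (psi^`(n))%classic x 1,
      forall (n : nat) (x : R), (1 <= n)%N -> 0 < x ->
        0 <= (-1) ^+ n.-1 * (psi^`(n))%classic x
    & psi x @[x --> 0^'+] --> psi 0].

(* Only the restriction of nu to (0, +oo) is ever used. *)
Definition levy_representation (R : realType) (psi : R -> R)
    (a b : R) (nu : {measure set (measurableTypeR R) -> \bar R}) : Prop :=
  [/\ 0 <= a, 0 <= b,
      (\int[nu]_(s in `]0%R, +oo[) (Num.min 1 s)%:E < +oo)%E
    & forall theta : R, 0 < theta ->
        ((psi theta)%:E = (a + b * theta)%:E +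
          \int[nu]_(s in `]0%R, +oo[) (1 - expR (- (theta * s)))%:E)%E].

(* The triple (a, b, nu) of psi. For a Bernstein function it exists and is
   unique (up to the values of nu outside (0, +oo)), so the choice made here is
   immaterial and the default value is never taken. *)
Definition levy_triple (R : realType) (psi : R -> R) :
    R * R * {measure set (measurableTypeR R) -> \bar R} :=
  match pselect (exists t : R * R * {measure set (measurableTypeR R) -> \bar R},
                   levy_representation psi t.1.1 t.1.2 t.2) with
  | left h => projT1 (cid h)
  | right _ => (0, 0, [the {measure set (measurableTypeR R) -> \bar R} of mzero])
  end.

Definition levy_drift (R : realType) (psi : R -> R) : R := (levy_triple psi).1.2.

Definition levy_measure (R : realType) (psi : R -> R) :
    {measure set (measurableTypeR R) -> \bar R} := (levy_triple psi).2.

(* c(psi, n); the value at n = 0 is never used. *)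
Definition bernstein_weight (R : realType) (psi : R -> R) (n : nat) : R :=
  match n with
  | 0 => 0
  | 1 => levy_drift psi +
         \int[levy_measure psi]_(t in `]0, +oo[) (t * expR (- t))
  | _ => (n`!%:R)^-1 *
         \int[levy_measure psi]_(t in `]0, +oo[) (t ^+ n * expR (- t))
  end.

Definition renewal_sequence (R : realType) (c C : nat -> R) : Prop :=
  C 0%N = 1 /\
  forall n, (1 <= n)%N -> C n = \sum_(1 <= k < n.+1) c k * C (n - k)%N.

(* n-step transition probability from 0 to x of the random walk on Z^d with
   step law q, i.e. the n-fold convolution power of q. *)
Fixpoint walk_prob (R : realType) (d : nat) (q : 'rV[int]_d -> \bar R)
    (n : nat) (x : 'rV[int]_d) : \bar R :=
  match n with
  | 0 => ((x == 0)%:R)%:E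
  | m.+1 => (\esum_(y in [set: 'rV[int]_d]) q y * walk_prob q m (x - y)%R)%E
  end.

Definition srw_step (R : realType) (d : nat) (x : 'rV[int]_d) : \bar R :=
  (if [exists i : 'I_d, (x == delta_mx 0 i) || (x == - delta_mx 0 i)]
   then (2 * d%:R)^-1 else 0)%:E.

Definition srw_prob (R : realType) (d k : nat) (x : 'rV[int]_d) : \bar R :=
  walk_prob (@srw_step R d) k x.

Definition subordinated_step (R : realType) (d : nat) (psi : R -> R)
    (x : 'rV[int]_d) : \bar R :=
  (\sum_(1 <= n <oo) (bernstein_weight psi n)%:E * srw_prob R n x)%E.

Definition subordinated_prob (R : realType) (d : nat) (psi : R -> R)
    (n : nat) (x : 'rV[int]_d) : \bar R :=
  walk_prob (@subordinated_step R d psi) n x.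

Definition green_function (R : realType) (d : nat) (psi : R -> R)
    (x : 'rV[int]_d) : \bar R :=
  (\sum_(1 <= n <oo) subordinated_prob psi n x)%E.

Definition euclidean_norm (R : realType) (d : nat) (x : 'rV[int]_d) : R :=
  Num.sqrt (\sum_(i < d) (x 0 i)%:~R ^+ 2).

(* The filter "||x|| -> +oo" on Z^d (the library norm on row vectors is the
   sup norm, and Z^d carries no such filter). *)
Definition norm_infty (R : realType) (d : nat) : set_system 'rV[int]_d :=
  filter_from [set: R] (fun M => [set x | M < euclidean_norm R x]).

Definition green_const (R : realType) (d : nat) (alpha : R) : R :=
  (d%:R / 2) `^ (alpha / 2) * (pi `^ (- (d%:R / 2)) / Gamma (alpha / 2)) *
  Gamma ((d%:R - alpha) / 2).

(* Main.v *)
Require Import Defs.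
From HB Require Import structures.
From mathcomp Require Import all_boot all_order all_algebra.
From mathcomp Require Import all_classical all_reals all_analysis.
From mathcomp Require Import measurable_realfun ring lra zify.
Import Order.TTheory GRing.Theory Num.Theory.
Import numFieldNormedType.Exports.
Local Open Scope classical_set_scope.
Local Open Scope ring_scope.

(** Write F(y) = 1/psi(1/y) = y^(alpha/2) l(y) and r = alpha/2. The function F is nondecreasing on
    (0, +oo), because psi is, and it varies regularly with index r. The hypothesis on the renewal
    sequence says that Gamma(r) C(k) is asymptotic to F(k)/k, and by subordination the Green
    function is the sum of C(k) p(k,x) over k >= 1 (green_functionE). So the question is the
    behaviour of the sum of F(k)/k p(k,x).

    The walk is replaced by the walk observed at a Poisson time, whose coordinates are independent:
    the sum over k of e^(-t) t^k/k! p(k,x) is the product over i of q(t/d, x_i), where q(s,.) is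
    the law of the one-dimensional walk at a Poisson(s) time, that is the Skellam law
    (poisson_srw). Conversely, integrating F(t) e^(-t) t^(k-1)/(k-1)! over t > 0 gives the mean of
    F under a gamma law concentrated near k, hence about F(k) (gamma_mean). Since p(k,x) = 0 when
    k is small compared with |x|, only large k matter, and Gamma(r) G(x) is asymptotic to the
    integral over t > 0 of F(t)/t times the product of the q(t/d, x_i) (green_compare).

    In that integral put t = a/u with a = d |x|^2 / 2. Then F(a/u)/F(a) tends to u^(-r), and
    a^(d/2) times the product of the q(a/(ud), x_i) tends to (d/(2 pi))^(d/2) u^(d/2) e^(-u)
    (cvg_prod_skellam). Domination comes from the bound of Potter for u <= 1, and for u >= 1 from
    the monotonicity of F and a polynomial decay of q; the condition alpha < d makes the
    dominating function integrable at 0. The limit is an Euler integral for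
    Gamma((d - alpha)/2) (cvg_integral_mixed_kernel), and the theorem is this limit after the
    change of F(a) into F(|x|^2) by regular variation.

    The Gaussian limit of the Skellam law is elementary. Two facts are used: the recurrence
    j q_j = (s/2) (q_(j-1) - q_(j+1)), and the monotonicity of q_j in j >= 0 (skellam_rec,
    skellam_noninc). They squeeze q_(j+2)/q_j between 1 - 2(j+1)/s and 1/(1 + 2(j+1)/s), and the
    product of these ratios shows that q_j/q_0 is close to exp(-j^2/(2s)) as long as j is of
    order sqrt s. As the total mass is 1, comparison of a Riemann sum with the Gaussian integral
    then forces sqrt s q_0 to tend to 1/sqrt(2 pi) (cvg_skellam0). *)

(** * Exponential generating functions *)

(** Nonnegativity is the only summability needed: the inner index is shifted to the diagonal,
    where the two summations commute. *)
Lemma nneseries_cauchy {R : realType} (a : nat -> nat -> \bar R) :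
  (forall n k, (0 <= a n k)%E) ->
  (\sum_(n <oo) \sum_(k <oo) a n k =
   \sum_(m <oo) \sum_(n < m.+1) a n (m - n)%N)%E.
Proof.
move=> a0; pose b n m := if (n <= m)%N then a n (m - n)%N else 0%E.
have b0 n m : (0 <= b n m)%E by rewrite /b; case: ifP.
have -> : (\sum_(n <oo) \sum_(k <oo) a n k = \sum_(n <oo) \sum_(m <oo) b n m)%E.
  apply: eq_eseriesr => n _.
  rewrite [RHS](nneseries_split 0 n)// add0n big_nat big1 ?add0e; last first.
    by move=> i /andP[_ ni]; rewrite /b leqNgt ni.
  rewrite -[RHS]nneseries_addn//.
  by apply: eq_eseriesr => i _; rewrite /b leq_addl addnK.
rewrite nneseries_interchange//; apply: eq_eseriesr => m _.
rewrite (nneseries_split 0 m.+1)// [X in (_ + X)%E]eseries0 ?adde0; last first.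
  by move=> i mi _; rewrite /b leqNgt mi.
by rewrite add0n big_mkord; apply: eq_bigr => i _; rewrite /b -ltnS ltn_ord.
Qed.

(** Exponential generating function. Its values are extended reals, so that nonnegative
    coefficients raise no question of convergence. *)
Definition egf {R : realType} (t : R) (a : nat -> R) : \bar R :=
  (\sum_(n <oo) (a n * (t ^+ n / n`!%:R))%:E)%E.

Definition binconv {R : realType} (u v : nat -> R) (n : nat) : R :=
  \sum_(k < n.+1) 'C(n, k)%:R * (u k * v (n - k)%N).

Lemma binconvS {R : realType} (u v : nat -> R) n :
  binconv u v n.+1 =
  binconv (fun k => u k.+1) v n + binconv u (fun k => v k.+1) n.
Proof.
rewrite /binconv big_ord_recl bin0 subn0.
under eq_bigr => i _.
  rewrite /= /bump leq0n add1n binS subSS natrD mulrDl; over.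
rewrite big_split/= addrA addrC; congr (_ + _).
rewrite big_ord_recr/= bin_small// mul0r addr0 [in RHS]big_ord_recl bin0 subn0.
congr (_ + _); apply: eq_bigr => i _.
by rewrite /= /bump leq0n add1n subnSK.
Qed.

Lemma egf_ge0 {R : realType} (t : R) a :
  0 <= t -> (forall n, 0 <= a n) -> (0 <= egf t a)%E.
Proof.
move=> t0 a0; apply: nneseries_ge0 => n _ _.
by rewrite lee_fin mulr_ge0// divr_ge0// exprn_ge0.
Qed.

(** A binomial convolution counts the ways to interleave two sequences of moves; this is why the
    generating functions of independent components multiply. Finiteness of one factor is what
    allows it to be pulled out of the outer series. *)
Lemma egf_binconv {R : realType} (t : R) u v : 0 <= t ->
  (forall n, 0 <= u n) -> (forall n, 0 <= v n) -> egf t v \is a fin_num ->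
  egf t (binconv u v) = (egf t u * egf t v)%E.
Proof.
move=> t0 u0 v0 vfin.
have T0 n : 0 <= t ^+ n / n`!%:R by rewrite divr_ge0// exprn_ge0.
pose a n k := ((u n * (t ^+ n / n`!%:R)) * (v k * (t ^+ k / k`!%:R)))%:E.
have a0 n k : (0 <= a n k)%E by rewrite lee_fin; apply: mulr_ge0; apply: mulr_ge0.
transitivity (\sum_(n <oo) \sum_(k <oo) a n k)%E.
  rewrite nneseries_cauchy//; apply: eq_eseriesr => n _.
  rewrite sumEFin; congr EFin; rewrite /binconv mulr_suml.
  apply: eq_bigr => i _; have in_ : (i <= n)%N by rewrite -ltnS.
  rewrite (_ : t ^+ n = t ^+ i * t ^+ (n - i)); last by rewrite -exprD subnKC.
  rewrite -(bin_fact in_) !natrM.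
  have fne m : m`!%:R != 0 :> R by rewrite pnatr_eq0 -lt0n fact_gt0.
  have Cne : 'C(n, i)%:R != 0 :> R by rewrite pnatr_eq0 -lt0n bin_gt0.
  by field; rewrite ?fne ?Cne.
have gu0 := egf_ge0 t u t0 u0.
rewrite -(fineK vfin) muleC -nneseriesZl; last first.
  by move=> n _; rewrite lee_fin mulr_ge0.
apply: eq_eseriesr => n _; rewrite (fineK vfin) muleC.
by rewrite -nneseriesZl// => i _; rewrite lee_fin mulr_ge0.
Qed.

Lemma egf_cst1 {R : realType} (t : R) : 0 <= t ->
  egf t (fun=> 1) = (expR t)%:E.
Proof.
move=> t0; rewrite /egf.
under eq_eseriesr do rewrite mul1r.
have c := is_cvg_series_exp_coeff t.
rewrite /expR -EFin_lim//; apply/congr_lim/funext => n /=.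
rewrite /series/= -sumEFin; apply: eq_bigr => i _.
by rewrite /exp_coeff.
Qed.

Lemma egf_expX {R : realType} (t c : R) : 0 <= t -> 0 <= c ->
  egf t (fun n => c ^+ n) = (expR (c * t))%:E.
Proof.
move=> t0 c0; rewrite -egf_cst1 ?mulr_ge0//.
by apply: eq_eseriesr => n _; rewrite mul1r exprMn mulrA.
Qed.

Lemma le_egf {R : realType} (t : R) a b : 0 <= t ->
  (forall n, 0 <= a n) -> (forall n, a n <= b n) -> (egf t a <= egf t b)%E.
Proof.
move=> t0 a0 ab; have T0 n : 0 <= t ^+ n / n`!%:R by rewrite divr_ge0// exprn_ge0.
apply: lee_nneseries => n *; rewrite lee_fin; first exact: mulr_ge0.
exact: ler_wpM2r.
Qed.

Lemma egf_fin_num {R : realType} (t : R) a : 0 <= t ->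
  (forall n, 0 <= a n <= 1) -> egf t a \is a fin_num.
Proof.
move=> t0 a01; have a0 n : 0 <= a n by case/andP: (a01 n).
rewrite ge0_fin_numE ?egf_ge0//.
apply: (@le_lt_trans _ _ (egf t (fun=> 1))); last by rewrite egf_cst1// ltry.
by apply: le_egf => // n; case/andP: (a01 n).
Qed.

(** * The walk on the integers and its Poissonization *)

Fixpoint walk1 {R : realType} (n : nat) (j : int) : R :=
  if n is m.+1 then (walk1 m (j - 1) + walk1 m (j + 1)) / 2 else (j == 0)%:R.

Lemma walk1_ge0 {R : realType} n j : 0 <= walk1 n j :> R.
Proof.
by elim: n j => [|n IH] j /=; rewrite ?ler0n// divr_ge0// addr_ge0.
Qed.

Lemma walk1_le1 {R : realType} n j : walk1 n j <= 1 :> R.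
Proof.
elim: n j => [|n IH] j /=; first by case: (j == 0).
by rewrite ler_pdivrMr// mul1r (lerD (IH _) (IH _)).
Qed.

Lemma walk1N {R : realType} n j : walk1 n (- j) = walk1 n j :> R.
Proof.
elim: n j => [|n IH] j /=; first by rewrite oppr_eq0.
by rewrite -opprD IH -(IH (- j + 1)) opprD opprK addrC.
Qed.

(** In terms of generating functions: walk1 n has the Laurent polynomial ((z + 1/z)/2)^n, to which
    the operator z d/dz is applied. *)
Lemma walk1_recurrence {R : realType} n (j : int) :
  j%:~R * walk1 n.+1 j = n.+1%:R / 2 * (walk1 n (j - 1) - walk1 n (j + 1)) :> R.
Proof.
elim: n j => [|n IH] j.
  rewrite /= subr_eq0 addr_eq0; case: (eqVneq j 1) => [->|j1].
    by rewrite /=; lra.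
  by case: (eqVneq j (-1)) => [->|jm1] /=; rewrite ?mulrN1z; lra.
have e1 := IH (j - 1); have e2 := IH (j + 1).
rewrite subrK in e1; rewrite addrK in e2.
have w1 : walk1 n.+1 (j - 1) = (walk1 n (j - 1 - 1) + walk1 n j) / 2 :> R.
  by rewrite /= subrK.
have w2 : walk1 n.+1 (j + 1) = (walk1 n j + walk1 n (j + 1 + 1)) / 2 :> R.
  by rewrite /= addrK.
have -> : walk1 n.+2 j = (walk1 n.+1 (j - 1) + walk1 n.+1 (j + 1)) / 2 :> R by [].
rewrite intrD mulrDl in e2; rewrite intrB mulrBl in e1.
have -> : n.+2%:R = n.+1%:R + 1 :> R by rewrite -natr1.
have e3 : n.+1%:R * (walk1 n.+1 (j - 1) - walk1 n.+1 (j + 1)) =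
          n.+1%:R / 2 * (walk1 n (j - 1 - 1) - walk1 n (j + 1 + 1)) :> R.
  by rewrite w1 w2; field.
by move: e1 e2 e3; lra.
Qed.

(** The Laurent coefficients of ((z + 1/z)/2 + 1/2)^n: three equal weights at each step. Unlike
    walk1 it has no parity obstruction, so it can be monotone. *)
Definition lazy_walk {R : realType} (n : nat) (j : int) : R :=
  binconv (walk1^~ j) (fun k => 2^-1 ^+ k) n.

Lemma lazy_walkS {R : realType} n j : lazy_walk n.+1 j =
  (lazy_walk n (j - 1) + lazy_walk n j + lazy_walk n (j + 1)) / 2 :> R.
Proof.
rewrite /lazy_walk binconvS /binconv -!big_split/= mulr_suml; apply: eq_bigr => i _.
by rewrite exprS; ring.
Qed.

Lemma lazy_walkN {R : realType} n j : lazy_walk n (- j) = lazy_walk n j :> R.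
Proof. by apply: eq_bigr => i _; rewrite walk1N. Qed.

(** Averaging over three consecutive sites preserves the monotonicity of an even function away
    from 0, and at 0 evenness replaces the missing inequality. *)
Lemma lazy_walk_noninc {R : realType} n (j : nat) :
  lazy_walk n j.+1 <= lazy_walk n j :> R.
Proof.
elim: n j => [|n IH] j.
  by rewrite /lazy_walk /binconv !big_ord1 bin0 expr0 !mulr1 !mul1r /= ler_nat; case: j.
rewrite !lazy_walkS; case: j => [|j].
  rewrite sub0r lazy_walkN add0r subrr.
  have -> : (1 + 1 : int) = 2 by [].
  by have := IH 1%N; lra.
have -> : (j.+2%:Z - 1) = j.+1 by lia.
have -> : (j.+2%:Z + 1) = j.+3 by lia.
have -> : (j.+1%:Z - 1) = j by lia.
have -> : (j.+1%:Z + 1) = j.+2 by lia.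
by have := IH j; have := IH j.+1; have := IH j.+2; lra.
Qed.

(** Law of the walk on the integers at an independent Poisson time of mean s. It is the law of
    the difference of two independent Poisson variables of mean s/2, and its value is e^(-s) I_j(s)
    with I_j the modified Bessel function. *)
Definition skellam {R : realType} (s : R) (j : int) : R :=
  fine (egf s (walk1^~ j)) * expR (- s).

Lemma egf_walk1 {R : realType} (s : R) j : 0 <= s ->
  egf s (walk1^~ j) = (expR s * skellam s j)%:E.
Proof.
move=> s0; rewrite /skellam mulrCA expRxMexpNx_1 mulr1 fineK//.
by apply: egf_fin_num => // n; rewrite walk1_ge0 walk1_le1.
Qed.

Lemma skellam_ge0 {R : realType} (s : R) j : 0 <= s -> 0 <= skellam s j.
Proof.
move=> s0; rewrite mulr_ge0 ?expR_ge0// fine_ge0// egf_ge0// => n.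
exact: walk1_ge0.
Qed.

Lemma skellamN {R : realType} (s : R) j : skellam s (- j) = skellam s j.
Proof.
by rewrite /skellam; congr (fine _ * _); apply: eq_eseriesr => n _; rewrite walk1N.
Qed.

Lemma skellam_abs {R : realType} (s : R) (j : int) : skellam s j = skellam s `|j|%N.
Proof.
by case: (intP j) => [//|n|n]; rewrite ?abszN ?skellamN.
Qed.

(** The generating function of lazy_walk is that of walk1 times e^(s/2), so the monotonicity of the
    lazy walk at each fixed time passes to the Skellam law, although walk1 itself oscillates with
    the parity. *)
Lemma skellam_noninc {R : realType} (s : R) (j : nat) : 0 <= s ->
  skellam s j.+1 <= skellam s j.
Proof.
move=> s0.
have h i : egf s (lazy_walk^~ i) = (expR s * skellam s i * expR (s / 2))%:E.
  have h2 : 0 <= 2^-1 :> R by rewrite invr_ge0.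
  have E : egf s (fun k => 2^-1 ^+ k) = (expR (s / 2))%:E.
    by rewrite egf_expX// mulrC.
  rewrite /lazy_walk egf_binconv ?E ?egf_walk1//.
  by move=> n; exact: walk1_ge0.
have : (egf s (lazy_walk^~ j.+1) <= egf s (lazy_walk^~ j))%E.
  apply: le_egf => // n; last exact: lazy_walk_noninc.
  apply: sumr_ge0 => i _.
  by rewrite !mulr_ge0 ?walk1_ge0// exprn_ge0// invr_ge0.
by rewrite !h lee_fin ler_pM2r ?expR_gt0// ler_pM2l ?expR_gt0.
Qed.

(** walk1_recurrence summed over time: this is the recurrence of the Bessel functions. *)
Lemma skellam_rec {R : realType} (s : R) (j : nat) : 0 <= s ->
  j.+1%:R * skellam s j.+1 = s / 2 * (skellam s j - skellam s j.+2).
Proof.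
move=> s0; have T0 n : 0 <= s ^+ n / n`!%:R by rewrite divr_ge0// exprn_ge0.
have P0 i n : 0 <= walk1 n i * (s ^+ n / n`!%:R) by rewrite mulr_ge0 ?walk1_ge0.
suff: (j.+1%:R%:E * egf s (walk1^~ j.+1%:Z) + (s / 2)%:E * egf s (walk1^~ j.+2%:Z) =
       (s / 2)%:E * egf s (walk1^~ j%:Z))%E.
  rewrite !egf_walk1// -!EFinM -EFinD => -[] e.
  by apply: (@mulfI _ (expR s)); rewrite ?expR_eq0//; move: e; lra.
rewrite /egf -!nneseriesZl; last 3 first.
- by move=> n _; rewrite lee_fin P0.
- by move=> n _; rewrite lee_fin P0.
- by move=> n _; rewrite lee_fin P0.
rewrite nneseries_recl//; last first.
  by move=> n _; rewrite -EFinM lee_fin mulr_ge0 ?P0.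
have -> : walk1 0 j.+1 = 0 :> R by [].
rewrite mul0r mule0 add0e -nneseries_addn; last first.
  by move=> n; rewrite -EFinM lee_fin mulr_ge0 ?P0.
rewrite -nneseriesD; last 2 first.
- by move=> n _ _; rewrite -EFinM lee_fin mulr_ge0 ?P0.
- by move=> n _ _; rewrite -EFinM lee_fin mulr_ge0 ?P0// divr_ge0.
apply: eq_eseriesr => n _; rewrite -!EFinM -EFinD addn1; congr EFin.
have := walk1_recurrence n j.+1 => /(_ R).
have -> : (j.+1%:Z - 1) = j by lia.
have -> : (j.+1%:Z + 1) = j.+2 by lia.
have -> : (j.+1%:Z)%:~R = j.+1%:R :> R by [].
move=> e; rewrite [X in X + _]mulrA e factS natrM exprS.
have fne : n`!%:R != 0 :> R by rewrite pnatr_eq0 -lt0n fact_gt0.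
have nne : n.+1%:R != 0 :> R by rewrite pnatr_eq0.
by field; rewrite fne addrC natr1.
Qed.

(* From here on the Skellam law is used only through the properties above. *)
#[global] Opaque skellam.

(** * Total mass of the Skellam law *)

Lemma reindex_esumT {R : realType} {T T' : choiceType} (e : T -> T') (e' : T' -> T)
    (f : T' -> \bar R) : cancel e e' -> cancel e' e ->
  (\esum_(j in [set: T']) f j = \esum_(i in [set: T]) f (e i))%E.
Proof.
move=> ee' e'e; apply: reindex_esum; split => //.
  by move=> a b _ _; exact: can_inj ee' _ _.
by move=> b _; exists (e' b).
Qed.

Lemma esum_exchange {R : realType} {T1 T2 : choiceType} (f : T1 -> T2 -> \bar R) :
  (forall i j, (0 <= f i j)%E) ->
  (\esum_(i in [set: T1]) \esum_(j in [set: T2]) f i j =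
   \esum_(j in [set: T2]) \esum_(i in [set: T1]) f i j)%E.
Proof.
move=> f0; rewrite !esum_esum//.
rewrite (_ : [set: T1] `*`` _ = [set: T1 * T2]); last by apply/seteqP; split.
rewrite (_ : [set: T2] `*`` _ = [set: T2 * T1]); last by apply/seteqP; split.
by rewrite (reindex_esumT (fun p : T2 * T1 => (p.2, p.1)) (fun p => (p.2, p.1))) // => -[].
Qed.

Lemma esumZl {R : realType} {T : choiceType} (D : set T) (c : R) (f : T -> \bar R) :
  0 <= c -> (forall i, (0 <= f i)%E) ->
  (\esum_(i in D) (c%:E * f i) = c%:E * \esum_(i in D) f i)%E.
Proof.
move=> c0 f0.
have H (b : R) (g : T -> \bar R) : 0 <= b -> (forall i, (0 <= g i)%E) ->
    (\esum_(i in D) (b%:E * g i) <= b%:E * \esum_(i in D) g i)%E.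
  move=> b0 g0; apply: ge_ereal_sup => _ [X XD <-].
  rewrite -ge0_mule_fsumr//; apply: lee_wpmul2l => //.
  by apply: ereal_sup_ubound; exists X.
move: c0; rewrite le_eqVlt => /predU1P[<-|c0].
  by rewrite mul0e esum1// => i _; rewrite mul0e.
apply/eqP; rewrite eq_le H//=; last exact: ltW.
have := H c^-1 (fun i => (c%:E * f i)%E).
rewrite invr_ge0 => /(_ (ltW c0)) h.
rewrite -lee_pdivlMl//; apply: le_trans; last first.
  by apply: h => i; rewrite mule_ge0// lee_fin ltW.
rewrite le_eqVlt; apply/orP; left; apply/eqP; apply: eq_esum => i _.
by rewrite muleA -EFinM mulVf ?mul1e// gt_eqF.
Qed.

Lemma esum_walk1 {R : realType} n :
  (\esum_(j in [set: int]) (walk1 n j : R)%:E = 1)%E.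
Proof.
elim: n => [|n IH].
  transitivity (\esum_(j in [set (0 : int)]) (1%:E : \bar R))%E; last by rewrite esum_set1.
  rewrite [RHS]esum_mkcond; apply: eq_esum => j _ /=.
  by case: (eqVneq j 0) => [->|/eqP j0]; [rewrite mem_set | rewrite memNset].
set x := esum _ _.
(* Doubling turns the mean of the two translates into a sum of two series of known mass. *)
have : (x + x = 1 + 1)%E.
  rewrite /x -esumD; [|by move=> j _; rewrite lee_fin walk1_ge0..].
  transitivity (\esum_(j in [set: int]) ((walk1 n (j - 1))%:E + (walk1 n (j + 1))%:E : \bar R))%E.
    by apply: eq_esum => j _; rewrite -!EFinD -splitr.
  rewrite esumD; [|by move=> j _; rewrite lee_fin walk1_ge0..].
  congr (_ + _)%E; rewrite -[RHS]IH.
    by rewrite [RHS](reindex_esumT (fun j => j - 1) (fun j => j + 1)) // => j;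
      rewrite ?subrK ?addrK.
  by rewrite [RHS](reindex_esumT (fun j => j + 1) (fun j => j - 1)) // => j;
    rewrite ?subrK ?addrK.
case: x => [r| |] //; rewrite -!EFinD => -[] e; congr EFin; lra.
Qed.

Lemma esum_int {R : realType} (f : int -> \bar R) : (forall j, (0 <= f j)%E) ->
  (\esum_(j in [set: int]) f j = \sum_(n <oo) f n%:Z + \sum_(n <oo) f (- n.+1%:Z)%R)%E.
Proof.
move=> f0; rewrite (esumID (range Posz))//; congr (_ + _)%E.
  rewrite setTI nneseries_esumT//; apply: reindex_esum.
  split => //; last by move=> a b _ _ [].
rewrite setTI nneseries_esumT//.
apply: (@reindex_esum _ _ _ _ _ (fun n : nat => (- n.+1%:Z)%R)).
split => //.
- by move=> n _ [m _]; lia.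
- by move=> a b _ _; lia.
- move=> j /= jN; exists (`|j|%N.-1) => //.
  case: (intP j) jN => [|n|n]; [|by move=> []; exists n.+1 |by rewrite abszN].
  by move=> []; exists 0%N.
Qed.

(** Each walk1 n has mass 1 and the Poisson weights add up to 1. Evenness folds the sum onto the
    half line, where it will be compared with an integral. *)
Lemma skellam_sum1 {R : realType} (s : R) : 0 <= s ->
  ((skellam s 0)%:E + 2%:E * \sum_(j <oo) (skellam s j.+1)%:E = 1)%E.
Proof.
move=> s0; have T0 n : 0 <= s ^+ n / n`!%:R by rewrite divr_ge0// exprn_ge0.
have S0 n : 0 <= s ^+ n / n`!%:R * expR (- s) by rewrite mulr_ge0 ?expR_ge0.
have P0 j n : 0 <= s ^+ n / n`!%:R * expR (- s) * walk1 n j.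
  by rewrite mulr_ge0 ?walk1_ge0.
transitivity (\esum_(j in [set: int]) (skellam s j)%:E)%E.
  rewrite esum_int; last by move=> j; rewrite lee_fin skellam_ge0.
  have p n : (0 <= (skellam s n)%:E)%E by rewrite lee_fin skellam_ge0.
  have -> : (\sum_(n <oo) (skellam s (- n.+1%:Z))%:E =
             \sum_(n <oo) (skellam s n.+1)%:E)%E.
    by apply: eq_eseriesr => n _; rewrite skellamN.
  rewrite [X in (_ = X + _)%E]nneseries_recl//.
  have -> : (\sum_(1 <= n <oo) (skellam s n)%:E = \sum_(n <oo) (skellam s n.+1)%:E)%E.
    by rewrite -nneseries_addn//; apply: eq_eseriesr => n _; rewrite addn1.
  by rewrite -addeA; congr (_ + _)%E; rewrite -mule2n mule_natl.
transitivity (\esum_(j in [set: int]) \esum_(n in [set: nat])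
   ((s ^+ n / n`!%:R * expR (- s))%:E * (walk1 n j)%:E))%E.
  apply: eq_esum => j _; rewrite -nneseries_esumT; last first.
    by move=> n; rewrite -EFinM lee_fin P0.
  rewrite -[skellam s j]mul1r -[in LHS](expRxMexpNx_1 (- s)) opprK -mulrA EFinM.
  rewrite -egf_walk1// /egf -nneseriesZl; last first.
    by move=> n _; rewrite lee_fin mulr_ge0 ?walk1_ge0.
  by apply: eq_eseriesr => n _; rewrite -!EFinM; congr EFin; ring.
rewrite esum_exchange; last first.
  by move=> j n; rewrite -EFinM lee_fin P0.
under eq_esum => n _.
  rewrite esumZl ?esum_walk1 ?mule1; last 2 first.
    exact: S0.
    by move=> j; rewrite lee_fin walk1_ge0.
  over.
rewrite -nneseries_esumT; last by move=> n; rewrite lee_fin S0.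
transitivity ((expR (- s))%:E * egf s (fun=> 1%R))%E.
  rewrite /egf -nneseriesZl; last by move=> n _; rewrite lee_fin mul1r.
  by apply: eq_eseriesr => n _; rewrite -EFinM mul1r mulrC.
by rewrite egf_cst1// -EFinM mulrC expRxMexpNx_1.
Qed.

(** * Gaussian shape of the Skellam law *)

(** By monotonicity a zero at the origin would kill the whole law, which has mass 1. *)
Lemma skellam0_gt0 {R : realType} (s : R) : 0 <= s -> 0 < skellam s 0.
Proof.
move=> s0; rewrite lt_neqAle skellam_ge0// andbT eq_sym; apply/eqP => q0.
have qz (j : nat) : skellam s j = 0.
  elim: j => // j IH; apply/eqP; rewrite eq_le skellam_ge0// andbT -IH.
  exact: skellam_noninc.
have := skellam_sum1 s s0; rewrite q0 add0e eseries0; last by move=> i _ _; rewrite qz.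
by rewrite mule0 => /esym/eqP; rewrite onee_eq0.
Qed.

Lemma skellam_antitone {R : realType} (s : R) (i j : nat) : 0 <= s -> (i <= j)%N ->
  skellam s j <= skellam s i.
Proof.
move=> s0 /subnK <-; elim: (j - i)%N => [|k IH]; first by rewrite add0n.
by rewrite addSn (le_trans (skellam_noninc _ _ s0)).
Qed.

(** In the recurrence, q_(j+1) is bounded below by q_(j+2). *)
Lemma skellam_step_le {R : realType} (s : R) (j : nat) : 0 <= s ->
  skellam s j.+2 * (s + 2 * j.+1%:R) <= s * skellam s j.
Proof.
move=> s0; have := skellam_rec s j s0; have := skellam_noninc s j.+1 s0.
have : 0 <= j.+1%:R :> R by [].
by move: (j.+1%:R : R) => k; nra.
Qed.

(** In the recurrence, q_(j+1) is bounded above by q_j. *)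
Lemma skellam_step_ge {R : realType} (s : R) (j : nat) : 0 <= s ->
  (s - 2 * j.+1%:R) * skellam s j <= s * skellam s j.+2.
Proof.
move=> s0; have := skellam_rec s j s0; have := skellam_noninc s j s0.
have : 0 <= j.+1%:R :> R by [].
by move: (j.+1%:R : R) => k; nra.
Qed.

(** The bound ln (1 + y) >= y - y^2. *)
Lemma expR_le_onepD {R : realType} (y : R) : 0 <= y ->
  1 <= (1 + y) * expR (- (y - y ^+ 2)).
Proof.
move=> y0; have := expR_ge1Dx (- (y - y ^+ 2)); set e := expR _ => h.
have : (1 + y) * (1 - (y - y ^+ 2)) <= (1 + y) * e by rewrite ler_wpM2l// addr_ge0.
have : 0 <= y ^+ 3 by rewrite exprn_ge0.
lra.
Qed.

(** The bound ln (1 - y) >= - y - 2 y^2. *)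
Lemma expR_le_onemB {R : realType} (y : R) : 0 <= y -> y <= 1 / 2 ->
  expR (- (y + 2 * y ^+ 2)) <= 1 - y.
Proof.
move=> y0 y1; have := expR_ge1Dx (y + 2 * y ^+ 2).
rewrite expRN; set e := expR _ => h.
have e0 : 0 < e by rewrite expR_gt0.
rewrite -[e^-1]mul1r ler_pdivrMr//.
have : (1 - y) * (1 + (y + 2 * y ^+ 2)) <= (1 - y) * e by rewrite ler_wpM2l//; lra.
have : 0 <= y ^+ 2 * (1 - 2 * y) by rewrite mulr_ge0 ?sqr_ge0//; lra.
lra.
Qed.

(** The product of the m one-step ratios, which lie between 1 - y_i and 1/(1 + y_i) with
    y_i = 2(2i + 1)/s. The y_i sum to 2 m^2/s, the Gaussian exponent at j = 2m, and E bounds the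
    sum of the quadratic errors 2 y_i^2. *)
Lemma skellam_even_bounds {R : realType} (s : R) (m : nat) : 0 < s -> 8 * m%:R <= s ->
  let E := 32 * m%:R ^+ 3 / s ^+ 2 in let q0 := skellam s 0 in
  q0 * expR (- (2 * m%:R ^+ 2 / s) - E) <= skellam s m.*2 /\
  skellam s m.*2 <= q0 * expR (- (2 * m%:R ^+ 2 / s) + E).
Proof.
move=> s0; elim: m => [|m IH] /= ms.
  by rewrite !expr0n/= !(mulr0, mul0r, oppr0, subr0, addr0, expR0, mulr1).
rewrite -[m.+1%:R]natr1 in ms *; have m0 : 0 <= m%:R :> R by [].
have [] := IH _; first by lra.
rewrite doubleS; set x := m%:R in ms m0 *; set q := skellam s m.*2 => lo hi.
have q0 : 0 <= q by rewrite skellam_ge0// ltW.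
pose y := 2 * (2 * x + 1) / s.
have ky : 2 * (m.*2).+1%:R = s * y.
  by rewrite /y -[(m.*2).+1%:R]natr1 -mul2n natrM mulrCA divff ?mulr1// gt_eqF.
have le1 : skellam s (m.*2).+2 * (1 + y) <= q.
  have := skellam_step_le s m.*2 (ltW s0); rewrite ky -/q => h; rewrite -(ler_pM2l s0); move: h.
  by move: (skellam s _) (q) => a b; lra.
have ge1 : (1 - y) * q <= skellam s (m.*2).+2.
  have := skellam_step_ge s m.*2 (ltW s0); rewrite ky -/q => h; rewrite -(ler_pM2l s0); move: h.
  by move: (skellam s _) (q) => a b; lra.
have y0 : 0 <= y by rewrite divr_ge0 ?(ltW s0)//; lra.
have y12 : y <= 1 / 2 by rewrite ler_pdivrMr//; lra.
(* The increment of E absorbs the quadratic error of the new factor. *)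
have dE : 2 * y ^+ 2 <= 32 * (x + 1) ^+ 3 / s ^+ 2 - 32 * x ^+ 3 / s ^+ 2.
  rewrite -mulrBl /y expr_div_n mulrA ler_pM2r ?invr_gt0 ?exprn_gt0//.
  by have := sqr_ge0 x; lra.
have dm : 2 * (x + 1) ^+ 2 / s = 2 * x ^+ 2 / s + y.
  by rewrite /y; field; rewrite gt_eqF.
split.
  apply: le_trans ge1; apply: le_trans (ler_wpM2r q0 (expR_le_onemB y y0 y12)).
  apply: le_trans (ler_wpM2l (expR_ge0 _) lo).
  rewrite [leRHS]mulrCA -expRD ler_pM2l ?skellam0_gt0 ?(ltW s0)// ler_expR.
  by lra.
have f0 := expR_le_onepD y y0.
set e := expR (- (y - y ^+ 2)) in f0.
have : skellam s (m.*2).+2 <= q * e.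
  apply: (@le_trans _ _ (skellam s (m.*2).+2 * ((1 + y) * e))).
    by rewrite ler_peMr// skellam_ge0// ltW.
  by rewrite mulrA ler_wpM2r ?expR_ge0.
move/le_trans; apply; apply: le_trans (ler_wpM2r (expR_ge0 _) hi) _.
rewrite -[leLHS]mulrA /e -expRD ler_pM2l ?skellam0_gt0 ?(ltW s0)// ler_expR.
by have := sqr_ge0 y; lra.
Qed.

(** An odd index lies between two even ones; the extra term of order j/s in E is the variation of
    the Gaussian exponent between them. *)
Lemma skellam_gaussian_bounds {R : realType} (s : R) (j : nat) : 0 < s ->
  4 * (j%:R + 2) <= s ->
  let E := (2 * j%:R + 2) / s + 4 * (j%:R + 2) ^+ 3 / s ^+ 2 in
  let q0 := skellam s 0 in
  q0 * expR (- (j%:R ^+ 2 / (2 * s)) - E) <= skellam s j /\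
  skellam s j <= q0 * expR (- (j%:R ^+ 2 / (2 * s)) + E).
Proof.
move=> s0 js E q0; pose m := j./2.
have j0 : 0 <= j%:R :> R by [].
have mj : 2 * m%:R <= j%:R :> R.
  by rewrite -natrM ler_nat mul2n /m; lia.
have jm : j%:R <= 2 * m%:R + 1 :> R.
  by rewrite -natrM natr1 ler_nat mul2n /m; lia.
have m0 : 0 <= m%:R :> R by [].
have q00 : 0 < q0 by rewrite skellam0_gt0// ltW.
have si : 0 < s^-1 by rewrite invr_gt0.
have si2 : 0 < (s ^+ 2)^-1 by rewrite invr_gt0 exprn_gt0.
split.
  have [|lo _] := skellam_even_bounds s m.+1 s0; first by rewrite -[m.+1%:R]natr1; lra.
  have h : skellam s m.+1.*2 <= skellam s j.
    have jm' : (j <= m.+1.*2)%N by rewrite /m; clear; lia.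
    exact: skellam_antitone (ltW s0) jm'.
  apply: le_trans h; apply: le_trans lo.
  rewrite ler_pM2l// ler_expR -[m.+1%:R]natr1 /E.
  have -> : j%:R ^+ 2 / (2 * s) = j%:R ^+ 2 / 2 / s by field; rewrite gt_eqF.
  have : 2 * (m%:R + 1) ^+ 2 / s <= (j%:R ^+ 2 / 2 + (2 * j%:R + 2)) / s.
    rewrite ler_pM2r//.
    have : (2 * m%:R) ^+ 2 <= j%:R ^+ 2 :> R by rewrite ler_pXn2r ?nnegrE//; lra.
    lra.
  have : 32 * (m%:R + 1) ^+ 3 / s ^+ 2 <= 4 * (j%:R + 2) ^+ 3 / s ^+ 2.
    rewrite ler_pM2r//.
    have -> : 32 * (m%:R + 1) ^+ 3 = 4 * (2 * m%:R + 2) ^+ 3 :> R by ring.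
    by rewrite ler_pM2l// ler_pXn2r// ?nnegrE; lra.
  lra.
have [|_ hi] := skellam_even_bounds s m s0; first by lra.
have h : skellam s j <= skellam s m.*2.
  have mj' : (m.*2 <= j)%N by rewrite /m; clear; lia.
  exact: skellam_antitone (ltW s0) mj'.
apply: le_trans h _; apply: le_trans hi _.
rewrite ler_pM2l// ler_expR /E.
have -> : j%:R ^+ 2 / (2 * s) = j%:R ^+ 2 / 2 / s by field; rewrite gt_eqF.
have : (j%:R ^+ 2 / 2 - (2 * j%:R + 2)) / s <= 2 * (m%:R) ^+ 2 / s.
  rewrite ler_pM2r//.
  have : j%:R ^+ 2 <= (2 * m%:R + 1) ^+ 2 :> R by rewrite ler_pXn2r ?nnegrE//; lra.
  lra.
have : 32 * (m%:R) ^+ 3 / s ^+ 2 <= 4 * (j%:R + 2) ^+ 3 / s ^+ 2.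
  rewrite ler_pM2r//.
  have -> : 32 * (m%:R) ^+ 3 = 4 * (2 * m%:R) ^+ 3 :> R by ring.
  by rewrite ler_pM2l// ler_pXn2r// ?nnegrE; lra.
lra.
Qed.

(** * Explicit integrals over the half line *)

(** The half line is exhausted by the closed rays from 1/(n+1), where the integrand is continuous
    up to the boundary. *)
Lemma ge0_FTC_oy {R : realType} (f P : R -> R) (l0 l : R) :
  (forall x, 0 < x -> 0 <= f x) ->
  (forall x : R, 0 < x -> {for x, continuous f}) ->
  (forall x : R, 0 < x -> is_derive x 1 P (f x)) ->
  P x @[x --> 0^'+] --> l0 -> P x @[x --> +oo] --> l ->
  (\int[lebesgue_measure]_(x in `]0%R, +oo[) (f x)%:E = (l - l0)%:E)%E.
Proof.
move=> f0 fc dP P0 Pl.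
pose D n : set R := `[(n.+1%:R)^-1, +oo[%classic.
have Dpos n x : D n x -> 0 < x.
  by rewrite /D/= in_itv/= andbT; apply: lt_le_trans; rewrite invr_gt0.
have mf : measurable_fun (`]0, +oo[%classic : set R) f.
  by apply: open_continuous_measurable_fun => // x; rewrite inE/= in_itv/= andbT => /fc.
have UD : `]0, +oo[%classic = \bigcup_n D n :> set R.
  apply/seteqP; split=> x; last by move=> [n _ /Dpos]; rewrite /= in_itv/= andbT.
  rewrite /= in_itv/= andbT => x0.
  have [n nx] := @ltr_add_invr R 0 x x0.
  by exists n => //; rewrite /D/= in_itv/= andbT; rewrite add0r in nx; exact: ltW.
have intD n : (\int[lebesgue_measure]_(x in D n) (f x)%:E = (l - P (n.+1%:R)^-1)%:E)%E.
  have n0 : 0 < n.+1%:R^-1 :> R by rewrite invr_gt0.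
  rewrite EFinB; apply: ge0_continuous_FTC2y => //.
  - by move=> x xn; apply: f0; exact: lt_le_trans xn.
  - apply/continuous_within_itvcyP; split.
      by move=> x; rewrite in_itv/= andbT => /(lt_trans n0)/fc.
    by apply: cvg_at_right_filter; exact: fc.
  - by move=> x xn; have [] := dP x (lt_trans n0 xn).
  - apply: cvg_at_right_filter; have [+ _] := dP _ n0.
    by move=> /derivable1_diffP/differentiable_continuous.
  - by move=> x; rewrite in_itv/= andbT => /(lt_trans n0) x0; rewrite derive1E; have [] := dP x x0.
have c1 : (\int[lebesgue_measure]_(x in D i) (f x)%:E)%E @[i --> \oo] -->
    (\int[lebesgue_measure]_(x in `]0%R, +oo[) (f x)%:E)%E.
  rewrite UD; apply: ge0_nondecreasing_set_cvg_integral => //.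
  - apply/nondecreasing_seqP => n; apply/subsetPset => x; rewrite /D/= !in_itv/= !andbT.
    by apply: le_trans; rewrite lef_pV2 ?posrE// ler_nat.
  - by move=> i; apply: measurable_itv.
  - move=> i; apply/measurable_EFinP; apply: measurable_funS mf => //.
    by move=> x /Dpos; rewrite /= in_itv/= andbT.
  - by move=> i x /Dpos x0; rewrite lee_fin f0.
rewrite (_ : (fun i => _) = (fun n => (l - P (n.+1%:R)^-1)%:E)) in c1; last exact: funext intD.
apply: (cvg_unique _ c1) => //.
apply: cvg_EFin; first exact: nearW.
apply: cvgB; first exact: cvg_cst.
have /cvg_at_rightP/(_ (fun n => n.+1%:R^-1)) := P0.
apply; split => //.
exact: cvg_harmonic.
Qed.

Lemma cvg_powRy {R : realType} (g : R) : 0 < g -> u `^ g @[u --> +oo] --> +oo.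
Proof.
move=> g0; apply/cvgryPge => M; near=> u.
have u0 : 0 <= u by near: u; apply: nbhs_pinfty_ge; rewrite num_real.
have : (Num.max M 0) `^ (g^-1) <= u by near: u; apply: nbhs_pinfty_ge; rewrite num_real.
move=> h; have m0 : 0 <= Num.max M 0 by rewrite le_max lexx orbT.
apply: (@le_trans _ _ (Num.max M 0)); first by rewrite le_max lexx.
rewrite -[leLHS]powRr1// -(mulVf (lt0r_neq0 g0)) powRrM.
by rewrite ge0_ler_powR ?nnegrE ?powR_ge0// ltW.
Unshelve. all: by end_near. Qed.

(** The derivative of - 1/(1 + u^g). It behaves like u^(g-1) at 0 and like u^(-g-1) at infinity, so
    it dominates functions with these rates and has an explicit integral. *)
Definition powR_bump {R : realType} (g u : R) : R :=
  g * u `^ (g - 1) / (1 + u `^ g) ^+ 2.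

Lemma continuous_powR_gt0 {R : realType} (g x : R) :
  0 < x -> {for x, continuous (fun u : R => u `^ g)}.
Proof.
move=> x0; have [+ _] := is_derive1_powR g x0.
by move=> /derivable1_diffP/differentiable_continuous.
Qed.

Lemma continuous_exprn_comp {R : realType} (f : R -> R) (x : R) n :
  {for x, continuous f} -> {for x, continuous (fun u : R => f u ^+ n)}.
Proof.
move=> fx; apply: (@continuous_comp _ _ _ f (fun y : R => y ^+ n)) => //.
exact: exprn_continuous.
Qed.

Lemma continuous_powR_bump {R : realType} (g u : R) : 0 < u ->
  {for u, continuous (powR_bump g)}.
Proof.
move=> u0; rewrite /powR_bump; apply: continuousM.
  apply: continuousM; first exact: cst_continuous.
  exact: continuous_powR_gt0.
apply: continuousV; first by rewrite expf_neq0// gt_eqF// ltr_wpDr// powR_ge0.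
apply: continuous_exprn_comp; apply: continuousD; first exact: cst_continuous.
exact: continuous_powR_gt0.
Qed.

Lemma integral_powR_bump {R : realType} (g : R) : 0 < g ->
  (\int[lebesgue_measure]_(u in `]0%R, +oo[) (powR_bump g u)%:E = 1)%E.
Proof.
move=> g0; have p0 (u : R) : 0 < 1 + u `^ g by rewrite ltr_wpDr// powR_ge0.
transitivity ((0 - (- 1 : R))%:E); last by rewrite sub0r opprK.
apply: (@ge0_FTC_oy _ _ (fun u => - (1 + u `^ g)^-1)).
- by move=> u u0; rewrite /powR_bump divr_ge0 ?exprn_ge0 ?(ltW (p0 _))// mulr_ge0 ?powR_ge0// ltW.
- by move=> u u0; exact: continuous_powR_bump.
- move=> u u0.
  have h1 : is_derive u 1 (fun u => 1 + u `^ g) (g * u `^ (g - 1)).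
    have h := is_deriveD (is_derive_cst (1 : R) u 1) (is_derive1_powR g u0).
    by apply: (is_derive_eq h); rewrite add0r.
  have h2 := is_deriveN (@is_deriveV _ (fun u : R => 1 + u `^ g) u _ 1 (lt0r_neq0 (p0 u)) h1 :
    is_derive u 1 (fun u : R => (1 + u `^ g)^-1) _).
  by apply: (is_derive_eq h2); rewrite /powR_bump /GRing.scale/= mulNr opprK mulrC.
- rewrite -[X in _ --> - X]invr1; apply: cvgN; apply: cvgV => //.
  by rewrite -[X in _ --> X]addr0; apply: cvgD; [exact: cvg_cst | exact: powR_cvg0].
- rewrite -[X in _ --> X]oppr0; apply: cvgN.
  apply/gtr0_cvgV0; first exact: nearW.
  by apply: cvg_comp (cvg_addrl 1); exact: cvg_powRy.
Qed.

(** Closed form of the upper incomplete Gamma function Gamma(k + 1, v). *)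
Fixpoint upper_gamma {R : realType} (k : nat) (v : R) : R :=
  if k is m.+1 then k%:R * upper_gamma m v + v ^+ k * expR (- v) else expR (- v).

Lemma is_derive_expRN {R : realType} (v : R) : is_derive v 1 (fun v => expR (- v)) (- expR (- v)).
Proof.
have h := is_derive1_comp (is_derive_expR (- v)) (is_deriveNid v 1).
by apply: (is_derive_eq h); rewrite mulrN1.
Qed.

Lemma is_derive_upper_gamma {R : realType} k (v : R) :
  is_derive v 1 (upper_gamma k) (- (v ^+ k * expR (- v))).
Proof.
elim: k => [|k IH] /=; first by rewrite expr0 mul1r; exact: is_derive_expRN.
have h1 := is_derive_expRN v.
have h2 : is_derive v 1 (fun v => v ^+ k.+1) (k.+1%:R * v ^+ k).
  have h := is_deriveX k.+1 (is_derive_id v 1).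
  by have -> : (fun v : R => v ^+ k.+1) = (id : R -> R) ^+ k.+1;
    [apply/funext => x; rewrite exprfctE | apply: (is_derive_eq h); rewrite /GRing.scale/= mulr1].
have h3 := is_deriveM h2 h1.
have h4 : is_derive v 1 (fun v => k.+1%:R * upper_gamma k v) _ := is_deriveZ k.+1%:R IH.
have h5 := is_deriveD h4 h3.
apply: (is_derive_eq (h5)).
rewrite /GRing.scale/=; ring.
Qed.

Lemma cvg_exprn_expRN {R : realType} k : v ^+ k * expR (- v) @[v --> +oo] --> (0 : R).
Proof.
have h : k.+1`!%:R * v^-1 @[v --> +oo] --> (0 : R).
  rewrite -[X in _ --> X](mulr0 k.+1`!%:R); apply: cvgMr.
  by apply/gtr0_cvgV0 => //; exact: nbhs_pinfty_gt.
apply: (squeeze_cvgr _ (cvg_cst 0) h).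
near=> v.
have v0 : 0 < v by near: v; apply: nbhs_pinfty_gt; rewrite num_real.
rewrite mulr_ge0 ?expR_ge0 ?exprn_ge0 ?(ltW v0)//=.
have := @expR_ge1Dxn _ v k (ltW v0).
move=> e; rewrite expRN ler_pdivrMr ?expR_gt0// mulrAC ler_pdivlMr// -exprSr.
rewrite [leRHS]mulrC -ler_pdivrMr ?ltr0n ?fact_gt0//.
by apply: le_trans e; rewrite lerDr.
Unshelve. all: by end_near. Qed.

Lemma cvg_upper_gammay {R : realType} k : upper_gamma k v @[v --> +oo] --> (0 : R).
Proof.
elim: k => [|k IH]; first exact: cvgr_expR.
rewrite -[X in _ --> X](addr0 0) -[X in _ --> X + _](mulr0 k.+1%:R).
by apply: cvgD; [exact: cvgMr | exact: cvg_exprn_expRN].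
Qed.

Lemma upper_gamma0 {R : realType} k : upper_gamma k 0 = k`!%:R :> R.
Proof.
elim: k => [|k IH] /=; first by rewrite oppr0 expR0.
by rewrite IH exprS !mul0r addr0 factS natrM.
Qed.

(** The integral defining Gamma(k + 1), after the substitution v = a/u. The measure du/u is
    invariant, and - upper_gamma, read at a/u, is a primitive. *)
Lemma integral_gamma_inv {R : realType} (a : R) k : 0 < a ->
  (\int[lebesgue_measure]_(u in `]0%R, +oo[)
    (expR (- (a / u)) * (a / u) ^+ k.+1 / u)%:E = k`!%:R%:E)%E.
Proof.
move=> a0; rewrite -[in RHS](subr0 k`!%:R).
have dV (u : R) : 0 < u -> is_derive u 1 (fun u => a / u) (- (a / u ^+ 2)).
  move=> u0; have h := is_deriveV (lt0r_neq0 u0 : id u != 0) (is_derive_id u 1).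
  have h2 : is_derive u 1 (fun u => a * (id u)^-1) _ := is_deriveZ a h.
  apply: (is_derive_eq h2); rewrite /GRing.scale/=; ring.
have cV (u : R) : 0 < u -> {for u, continuous (fun u : R => a / u)}.
  by move=> /dV[+ _] => /derivable1_diffP/differentiable_continuous.
apply: (@ge0_FTC_oy _ _ (fun u => upper_gamma k (a / u))).
- move=> u u0; rewrite divr_ge0 ?(ltW u0)// mulr_ge0 ?expR_ge0// exprn_ge0// divr_ge0// ltW//.
- move=> u u0; apply: continuousM; last by apply: continuousV; [rewrite gt_eqF | exact: cvg_id].
  apply: continuousM; last by apply: continuous_exprn_comp; exact: cV.
  apply: continuous_comp; first by apply: continuousN; exact: cV.
  exact: continuous_expR.
- move=> u u0; have := @is_derive1_comp _ (upper_gamma k) (fun u => a / u) u _ _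
    (is_derive_upper_gamma k (a / u)) (dV u u0).
  move=> h; apply: (is_derive_eq h); rewrite [(a / u) ^+ k.+1]exprS; field; rewrite gt_eqF//.
- apply: (@cvg_comp _ _ _ (fun u => a / u) (upper_gamma k) _ +oo); last exact: cvg_upper_gammay.
  apply: gt0_cvgMry => //; apply/cvgrVy => //; first exact: nbhs_right_gt.
  exact: cvg_at_right_filter cvg_id.
- rewrite -upper_gamma0.
  apply: (@cvg_comp _ _ _ (fun u => a / u) (upper_gamma k) _ (nbhs (0 : R))); last first.
    have [+ _] := is_derive_upper_gamma k (0 : R).
    by move=> /derivable1_diffP/differentiable_continuous.
  suff : a / u @[u --> +oo] --> a * 0 by rewrite mulr0.
  apply: cvgMr.
  by apply/gtr0_cvgV0 => //; exact: nbhs_pinfty_gt.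
Qed.

(** * Ratio limit and decay of the Skellam law *)

(** Each of the n double steps from j to j + 2n lowers s q by at least 2 j times the
    final value of q. *)
Lemma skellam_decay {R : realType} (s : R) (j n : nat) : 0 <= s ->
  skellam s (j + n.*2)%N * (s + 2 * n%:R * j%:R) <= s * skellam s j.
Proof.
move=> s0; elim: n => [|n IH]; first by rewrite addn0 mulr0 mul0r addr0 mulrC.
rewrite doubleS !addnS; set i := (j + n.*2)%N in IH *.
have ji : j%:R <= i.+1%:R :> R by rewrite ler_nat /i -addSn leqW// leq_addr.
have j0 : 0 <= j%:R :> R by [].
have n0 : 0 <= n%:R :> R by [].
have h1 := skellam_step_le s i s0.
have h2 := skellam_antitone s i i.+2 s0 (leqW (leqnSn i)).
have h3 := skellam_ge0 s i.+2 s0.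
have h4 := skellam_ge0 s i s0.
rewrite -[n.+1%:R]natr1.
have h5 : skellam s i.+2 * (2 * n%:R * j%:R) <= skellam s i * (2 * n%:R * j%:R).
  by rewrite ler_wpM2r// !mulr_ge0.
have h6 : skellam s i.+2 * (2 * j%:R) <= skellam s i.+2 * (2 * i.+1%:R).
  by rewrite ler_wpM2l// ler_pM2l.
by move: h1 IH h5 h6; move: (skellam s i.+2) (skellam s i) (skellam s j) => a b c; lra.
Qed.

(** For j of order sqrt s both parts of the error E in skellam_gaussian_bounds are of order
    1/sqrt s. *)
Lemma skellam_ratio {R : realType} (A s : R) (j : nat) : 0 <= A ->
  4 * (A + 2) <= Num.sqrt s -> j%:R <= A * Num.sqrt s ->
  expR (- ((2 * (A + 1) + 4 * (A + 2) ^+ 3) / Num.sqrt s)) <=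
    skellam s j / skellam s 0 * expR (j%:R ^+ 2 / (2 * s)) <=
  expR ((2 * (A + 1) + 4 * (A + 2) ^+ 3) / Num.sqrt s).
Proof.
move=> A0; set w := Num.sqrt s; set K := 2 * (A + 1) + _ => wA jw.
have w1 : 1 <= w by lra.
have w0 : 0 < w by lra.
have s0 : 0 < s by rewrite -sqrtr_gt0.
have sE : s = w ^+ 2 by rewrite sqr_sqrtr// ltW.
have j0 : 0 <= j%:R :> R by [].
have Aw : A <= A * w by rewrite ler_peMr.
have j2 : j%:R + 2 <= (A + 2) * w by lra.
have [|lo hi] := skellam_gaussian_bounds s j s0.
  rewrite sE expr2; apply: (@le_trans _ _ (4 * (A + 2) * w)); last by rewrite ler_pM2r.
  by rewrite -mulrA ler_pM2l.
have EK : (2 * j%:R + 2) / s + 4 * (j%:R + 2) ^+ 3 / s ^+ 2 <= K / w.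
  rewrite /K [leRHS]mulrDl; apply: lerD.
    have -> : 2 * (A + 1) / w = 2 * ((A + 1) * w) / s.
      by rewrite sE; field; rewrite gt_eqF.
    by rewrite ler_pM2r ?invr_gt0//; lra.
  have -> : 4 * (A + 2) ^+ 3 / w = 4 * ((A + 2) * w) ^+ 3 / s ^+ 2.
    by rewrite sE; field; rewrite gt_eqF.
  rewrite ler_pM2r ?invr_gt0 ?exprn_gt0// ler_pM2l//.
  by rewrite ler_pXn2r// ?nnegrE//; lra.
have q0 : 0 < skellam s 0 by rewrite skellam0_gt0// ltW.
rewrite mulrAC ler_pdivlMr// ler_pdivrMr//.
apply/andP; split.
  apply: (@le_trans _ _ (skellam s 0 * expR (- (j%:R ^+ 2 / (2 * s)) - K / w) *
    expR (j%:R ^+ 2 / (2 * s)))).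
    by rewrite -mulrA -expRD mulrC; rewrite (_ : _ + _ = - (K / w))//; ring.
  rewrite ler_pM2r ?expR_gt0//; apply: le_trans lo.
  by rewrite ler_pM2l// ler_expR lerD2l lerN2.
apply: (@le_trans _ _ (skellam s 0 * expR (- (j%:R ^+ 2 / (2 * s)) + K / w) *
    expR (j%:R ^+ 2 / (2 * s)))).
  rewrite ler_pM2r ?expR_gt0//; apply: (le_trans hi).
  by rewrite ler_pM2l// ler_expR lerD2l.
by rewrite -mulrA -expRD [leRHS]mulrC; rewrite (_ : _ + _ = K / w)//; ring.
Qed.

Lemma cvg_sqrty {R : realType} : Num.sqrt x @[x --> +oo] --> (+oo : set_system R).
Proof.
apply/cvgryPge => M; near=> x.
have : (Num.max M 0) ^+ 2 <= x by near: x; apply: nbhs_pinfty_ge; rewrite num_real.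
move=> h; have m0 : 0 <= Num.max M 0 by rewrite le_max lexx orbT.
apply: (@le_trans _ _ (Num.max M 0)); first by rewrite le_max lexx.
by rewrite -[leLHS]ger0_norm// -sqrtr_sqr ler_wsqrtr.
Unshelve. all: by end_near. Qed.

Lemma cvg_skellam_ratio {R : realType} (A : R) (s : nat -> R) (j : nat -> nat) :
  0 <= A -> s n @[n --> \oo] --> +oo -> (forall n, (j n)%:R <= A * Num.sqrt (s n)) ->
  skellam (s n) (j n) / skellam (s n) 0 * expR ((j n)%:R ^+ 2 / (2 * s n)) @[n --> \oo]
    --> (1 : R).
Proof.
move=> A0 soo jA; set K := 2 * (A + 1) + 4 * (A + 2) ^+ 3.
have woo : Num.sqrt (s n) @[n --> \oo] --> +oo by exact: cvg_comp cvg_sqrty.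
have K0 : K / Num.sqrt (s n) @[n --> \oo] --> 0.
  rewrite -[X in _ --> X](mulr0 K); apply: cvgMr.
  by apply/gtr0_cvgV0 => //; exact: (cvgry_gt woo).
have c1 : expR (- (K / Num.sqrt (s n))) @[n --> \oo] --> (1 : R).
  have := continuous_cvg _ (@continuous_expR R _) (cvgN K0).
  by rewrite oppr0 expR0 => c; exact: c.
have c2 : expR (K / Num.sqrt (s n)) @[n --> \oo] --> (1 : R).
  have := continuous_cvg _ (@continuous_expR R _) K0.
  by rewrite expR0 => c; exact: c.
apply: (squeeze_cvgr _ c1 c2); near=> n.
apply: skellam_ratio => //.
near: n; exact: (cvgry_ge woo).
Unshelve. all: by end_near. Qed.

(** * Value of the Skellam law at the origin *)

Lemma cvg_mulry {R : realType} {T : Type} {F : set_system T} {FF : Filter F}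
    (c : R) (f : T -> R) :
  0 < c -> f x @[x --> F] --> +oo -> c * f x @[x --> F] --> +oo.
Proof.
move=> c0 foo; apply: (@cvg_comp _ _ _ f (fun y => c * y) _ +oo) => //.
by apply: gt0_cvgMry => //; exact: cvg_id.
Qed.

Definition ceiln {R : realType} (x : R) : nat := `|Num.ceil x|%N.

Lemma ceiln_eq {R : realType} (x : R) (m : nat) :
  m%:R < x -> x <= m.+1%:R -> ceiln x = m.+1.
Proof.
move=> mx xm; rewrite /ceiln (@ceil_def _ x m.+1)//.
by rewrite xm andbT (_ : m.+1%:Z - 1 = m)//; lia.
Qed.

Lemma ceiln_ge {R : realType} (x : R) : 0 < x -> x <= (ceiln x)%:R.
Proof.
move=> x0; apply: (le_trans (ceil_ge x)).
by rewrite /ceiln pmulrn gez0_abs// ltW// ceil_gt0.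
Qed.

Lemma ceiln_lt {R : realType} (x : R) : 0 < x -> (ceiln x)%:R < x + 1.
Proof.
move=> x0; rewrite -ltrBlDr; have /andP[+ _] := ceil_itv x.
by rewrite intrB /ceiln pmulrn gez0_abs// ltW// ceil_gt0.
Qed.

(** A series is the integral of a step function; it brings the Riemann sum of the Skellam law
    within reach of dominated convergence. *)
Lemma integral_ceiln {R : realType} (c : R) (w : nat -> R) : 0 < c ->
  (forall j, 0 <= w j) ->
  measurable_fun (`]0%R, +oo[%classic : set R) (fun u => w (ceiln (u * c))) /\
  (\int[lebesgue_measure]_(u in `]0%R, +oo[) (w (ceiln (u * c)))%:E =
   \sum_(j <oo) (w j.+1 / c)%:E)%E.
Proof.
move=> c0 w0; pose D (j : nat) : set R := `]j%:R / c, j.+1%:R / c]%classic.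
have Dc j u : D j u -> ceiln (u * c) = j.+1.
  rewrite /D/= in_itv/= ltr_pdivrMr// ler_pdivlMr// => /andP[].
  exact: ceiln_eq.
have UD : `]0%R, +oo[%classic = \bigcup_j D j :> set R.
  apply/seteqP; split => u.
    rewrite /= in_itv/= andbT => u0; have uc0 : 0 < u * c by rewrite mulr_gt0.
    have := ceiln_ge _ uc0; have := ceiln_lt _ uc0.
    case E : (ceiln (u * c)) => [|m] h1 h2; first by lra.
    exists m => //; rewrite /D/= in_itv/= ltr_pdivrMr// ler_pdivlMr// h2 andbT.
    by rewrite -natr1 in h1; lra.
  move=> [j _]; rewrite /D/= !in_itv/= andbT => /andP[+ _].
  by apply: le_lt_trans; rewrite divr_ge0// ltW.
have mD j : measurable (D j) by exact: measurable_itv.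
have mf : measurable_fun (\bigcup_j D j) (fun u => w (ceiln (u * c))).
  apply/measurable_fun_bigcup => // j.
  apply: (@eq_measurable_fun _ _ _ _ _ (cst (w j.+1))) => //.
  by move=> u /set_mem /Dc ->.
rewrite UD; split => //; rewrite ge0_integral_bigcup//; last 3 first.
- exact/measurable_EFinP.
- by move=> u _; rewrite lee_fin.
- apply/trivIsetP => i j _ _ ij; rewrite -subset0 => u [/Dc + /Dc].
  by move=> -> [] /eqP; rewrite (negbTE ij).
apply: eq_eseriesr => j _.
under eq_integral => u /set_mem /Dc -> do [].
rewrite integral_cst; last exact: mD.
rewrite /D/= lebesgue_measure_itv/= lte_fin.
rewrite ltr_pM2r ?invr_gt0// ltr_nat ltnSn -EFinD -EFinM.
by rewrite -mulrBl -natr1 addrAC subrr add0r mul1r.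
Qed.

Lemma powR_bump_ge0 {R : realType} (g u : R) : 0 < g -> 0 <= powR_bump g u.
Proof.
by move=> g0; rewrite divr_ge0 ?sqr_ge0// mulr_ge0 ?powR_ge0// ltW.
Qed.

Lemma measurable_powR_bump {R : realType} (g : R) :
  measurable_fun (`]0%R, +oo[%classic : set R) (powR_bump g).
Proof.
apply: open_continuous_measurable_fun => // u.
by rewrite inE/= in_itv/= andbT => u0; exact: continuous_powR_bump.
Qed.

Lemma integrable_powR_bump {R : realType} (g k : R) : 0 < g ->
  lebesgue_measure.-integrable `]0%R, +oo[%classic (fun u => (k * powR_bump g u)%:E).
Proof.
move=> g0; have mD : measurable (`]0%R, +oo[%classic : set R) by exact: measurable_itv.
rewrite (_ : (fun u => _) = (fun u => k%:E * (powR_bump g u)%:E)%E)//.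
apply: integrableZl => //; apply/integrableP; split.
  by apply/measurable_EFinP; exact: measurable_powR_bump.
under eq_integral => u _ do rewrite gee0_abs ?lee_fin ?powR_bump_ge0//.
by rewrite integral_powR_bump// ltry.
Qed.

Lemma powR_bump1 {R : realType} (u : R) : 0 <= u -> powR_bump 1 u = (1 + u) ^- 2.
Proof. by move=> u0; rewrite /powR_bump subrr powRr0 powRr1// !mul1r. Qed.

(** Monotonicity and skellam_decay applied at j/3 give q_j/q_0 <= 1/(1 + u^2/9). Rounding j/3 to an
    integer is harmless when j >= 4; otherwise u < 1, and q_j <= q_0 suffices. *)
Lemma skellam_dom {R : realType} (s u : R) : 8 <= s -> 0 < u ->
  skellam s (ceiln (u * Num.sqrt (2 * s))) / skellam s 0 <= 18 * powR_bump 1 u.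
Proof.
move=> s8 u0; rewrite powR_bump1 ?(ltW u0)//.
set c := Num.sqrt (2 * s); set j := ceiln _.
have s0 : 0 < s by lra.
have cc : c ^+ 2 = 2 * s by rewrite sqr_sqrtr//; lra.
have c4 : 4 <= c.
  rewrite /c -[4]ger0_norm// -sqrtr_sqr ler_sqrt; lra.
have q0 := skellam0_gt0 s (ltW s0).
have W1 : skellam s j / skellam s 0 <= 1.
  by rewrite ler_pdivrMr// mul1r; apply: (skellam_antitone s 0 j (ltW s0)).
have p0 : 0 < (1 + u) ^+ 2 by rewrite exprn_gt0//; lra.
have [uc|uc] := ltP (u * c) 4.
  have u1 : u < 1.
    by rewrite -(ltr_pM2r (_ : 0 < 4))// mul1r (le_lt_trans _ uc)// ler_wpM2l// ltW.
  apply: (le_trans W1); rewrite ler_pdivlMr// mul1r.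
  have : u ^+ 2 <= 1 by rewrite expr_le1// ltW.
  by rewrite sqrrD; lra.
have uc0 : 0 < u * c by lra.
have ju := ceiln_ge _ uc0; rewrite -/j in ju.
pose n := (j %/ 3)%N.
have jn : (j <= 3 * n + 2)%N by rewrite /n; clear; lia.
have nj : (n + n.*2 <= j)%N by rewrite /n; clear; lia.
have jn' : j%:R <= 3 * n%:R + 2 :> R by rewrite -natrM -natrD ler_nat.
have nu : u * c / 6 <= n%:R by lra.
have d := skellam_decay s n n (ltW s0).
have h1 := skellam_antitone s _ _ (ltW s0) nj.
have h2 : skellam s n <= skellam s 0 by exact: (skellam_antitone s 0 n (ltW s0)).
have n2 : u ^+ 2 / 18 * s <= n%:R ^+ 2.
  have : (u * c / 6) ^+ 2 <= n%:R ^+ 2 by rewrite ler_pXn2r// ?nnegrE//; lra.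
  rewrite !exprMn cc; lra.
rewrite ler_pdivrMr// mulrAC ler_pdivlMr//.
have h3 : skellam s j * (s + 2 * n%:R * n%:R) <= s * skellam s 0.
  apply: (@le_trans _ _ (skellam s (n + n.*2)%N * (s + 2 * n%:R * n%:R))).
    by rewrite ler_wpM2r// addr_ge0 ?(ltW s0)// !mulr_ge0.
  by apply: (le_trans d); rewrite ler_pM2l.
have h4 : skellam s j * (s * (1 + u ^+ 2 / 9)) <= s * skellam s 0.
  apply: le_trans h3; rewrite ler_wpM2l ?skellam_ge0 ?(ltW s0)//.
  by move: n2; rewrite expr2; lra.
rewrite mulrCA ler_pM2l// in h4.
have h5 : (1 + u) ^+ 2 <= 18 * (1 + u ^+ 2 / 9).
  by have := sqr_ge0 (u - 1); lra.
apply: (@le_trans _ _ (skellam s j * (18 * (1 + u ^+ 2 / 9)))).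
  by rewrite ler_wpM2l// skellam_ge0// ltW.
by rewrite mulrCA ler_pM2l.
Qed.

Lemma cvg_skellam_ceiln {R : realType} (s : nat -> R) (u : R) : 0 < u ->
  (forall n, 8 <= s n) -> s n @[n --> \oo] --> +oo ->
  skellam (s n) (ceiln (u * Num.sqrt (2 * s n))) / skellam (s n) 0 @[n --> \oo]
    --> expR (- u ^+ 2).
Proof.
move=> u0 s8 soo; pose c n := Num.sqrt (2 * s n); pose j n := ceiln (u * c n).
have c0 n : 0 < c n by rewrite sqrtr_gt0; have := s8 n; lra.
have cc n : c n ^+ 2 = 2 * s n by rewrite sqr_sqrtr//; have := s8 n; lra.
have ju n : u * c n <= (j n)%:R by apply: ceiln_ge; rewrite mulr_gt0.
have uj n : (j n)%:R <= u * c n + 1 by apply/ltW/ceiln_lt; rewrite mulr_gt0.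
have coo : c n @[n --> \oo] --> +oo.
  apply: (@cvg_comp _ _ _ (fun n => 2 * s n) Num.sqrt _ +oo); last exact: cvg_sqrty.
  exact: cvg_mulry.
have civ : (c n)^-1 @[n --> \oo] --> (0 : R).
  by apply/gtr0_cvgV0 => //; exact: nearW.
have jc : (j n)%:R / c n @[n --> \oo] --> u.
  have c1 : u + (c n)^-1 @[n --> \oo] --> u.
    by rewrite -[X in _ --> X]addr0; apply: cvgD => //; exact: cvg_cst.
  apply: (squeeze_cvgr _ (cvg_cst u) c1); apply: nearW => n.
  rewrite ler_pdivlMr// ju/= ler_pdivrMr// mulrDl mulVf ?uj//.
  by rewrite gt_eqF.
have ratio : skellam (s n) (j n) / skellam (s n) 0 *
    expR ((j n)%:R ^+ 2 / (2 * s n)) @[n --> \oo] --> (1 : R).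
  apply: (@cvg_skellam_ratio _ (2 * u + 1)) => //; first by lra.
  move=> n; apply: (le_trans (uj n)).
  have w1 : 1 <= Num.sqrt (s n).
    by rewrite -[1 in leLHS]sqrtr1 ler_wsqrtr//; have := s8 n; lra.
  have cw : c n <= 2 * Num.sqrt (s n).
    rewrite -[2 in leRHS]ger0_norm// -sqrtr_sqr -sqrtrM ?sqr_ge0//.
    by rewrite ler_wsqrtr//; have := s8 n; lra.
  have : u * c n <= u * (2 * Num.sqrt (s n)) by rewrite ler_pM2l.
  lra.
have ex : expR (- ((j n)%:R / c n) ^+ 2) @[n --> \oo] --> expR (- u ^+ 2).
  apply: (@cvg_comp _ _ _ (fun n => - ((j n)%:R / c n) ^+ 2) expR _ (nbhs (- u ^+ 2))).
    by apply: cvgN; rewrite expr2; under eq_fun do rewrite expr2; exact: cvgM.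
  exact: continuous_expR.
rewrite -[X in _ --> X]mul1r.
rewrite (_ : (fun n => _) = (fun n => skellam (s n) (j n) / skellam (s n) 0 *
    expR ((j n)%:R ^+ 2 / (2 * s n)) * expR (- ((j n)%:R / c n) ^+ 2))).
  exact: cvgM.
apply/funext => n; rewrite -mulrA -expRD expr_div_n cc subrr expR0 mulr1//.
Qed.

(** Mesh 1/sqrt(2s) makes exp(-j^2/(2s)) equal to exp(-u^2) at the site u. *)
Lemma cvg_skellam_riemann_sum {R : realType} (s : nat -> R) :
  (forall n, 8 <= s n) -> s n @[n --> \oo] --> +oo ->
  (\sum_(j <oo) (skellam (s n) j.+1 / skellam (s n) 0 / Num.sqrt (2 * s n))%:E)%E
    @[n --> \oo] --> (Num.sqrt pi / 2 : R)%:E.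
Proof.
move=> s8 soo; pose W n j := skellam (s n) j / skellam (s n) 0.
have s0 n : 0 < s n by have := s8 n; lra.
have W0 n (j : nat) : 0 <= W n j by rewrite divr_ge0 ?skellam_ge0 ?ltW.
have c0 n : 0 < Num.sqrt (2 * s n) by rewrite sqrtr_gt0 mulr_gt0.
have step n := integral_ceiln (Num.sqrt (2 * s n)) (W n) (c0 n) (W0 n).
rewrite -integral0y_gauss -integral_itv_obnd_cbnd; last first.
  by apply/measurable_EFinP/measurable_funTS; exact: measurable_gauss_fun.
rewrite (_ : (fun n => _) = (fun n => \int[lebesgue_measure]_(u in `]0%R, +oo[)
   (W n (ceiln (u * Num.sqrt (2 * s n))))%:E)%E); last first.
  by apply/funext => n; case: (step n).
have mD : measurable (`]0%R, +oo[%classic : set R) by exact: measurable_itv.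
have := @dominated_convergence _ _ R lebesgue_measure `]0%R, +oo[%classic mD
  (fun n u => (W n (ceiln (u * Num.sqrt (2 * s n))))%:E)
  (fun u => (gauss_fun u)%:E) (fun u => (18 * powR_bump 1 u)%:E).
case.
- by move=> n; apply/measurable_EFinP; case: (step n).
- by apply/measurable_EFinP/measurable_funTS; exact: measurable_gauss_fun.
- apply: aeW => u; rewrite /= in_itv/= andbT => u0.
  apply: cvg_EFin; first exact: nearW.
  exact: cvg_skellam_ceiln.
- exact: integrable_powR_bump.
- apply: aeW => u n; rewrite /= in_itv/= andbT => u0.
  by rewrite lee_fin ger0_norm// skellam_dom.
- by [].
Qed.

(** The same Riemann sum, computed exactly from the total mass. *)
Lemma skellam_riemann_sum {R : realType} (s : R) : 0 < s ->
  (\sum_(j <oo) (skellam s j.+1 / skellam s 0 / Num.sqrt (2 * s))%:E =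
   ((Num.sqrt s * skellam s 0)^-1 / (2 * Num.sqrt 2) - (2 * Num.sqrt (2 * s))^-1)%:E)%E.
Proof.
move=> s0; have q0 := skellam0_gt0 s (ltW s0).
have w0 : 0 < Num.sqrt s by rewrite sqrtr_gt0.
have v0 : 0 < Num.sqrt 2 :> R by rewrite sqrtr_gt0.
have := skellam_sum1 s (ltW s0).
transitivity ((skellam s 0 * Num.sqrt (2 * s))^-1%:E *
    \sum_(j <oo) (skellam s j.+1)%:E)%E.
  rewrite -nneseriesZl; last by move=> j _; rewrite lee_fin skellam_ge0// ltW.
  apply: eq_eseriesr => j _; rewrite -EFinM [(skellam s 0 * _)^-1]invfM; congr EFin; ring.
move: (\sum_(j <oo) (skellam s j.+1)%:E)%E H => [x| |].
- rewrite -!EFinM -EFinD => -[] e; congr EFin; rewrite sqrtrM//.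
  have -> : x = (1 - skellam s 0) / 2 by lra.
  by field; rewrite ?gt_eqF.
- by rewrite gt0_muley ?lte_fin.
- by rewrite gt0_muleNy ?lte_fin.
Qed.

(** The Riemann sum of q_j/q_0 tends to sqrt pi/2, and the total mass expresses it through
    sqrt s q_0. *)
Lemma cvg_skellam0 {R : realType} :
  Num.sqrt s * skellam s 0 @[s --> +oo] --> ((Num.sqrt (2 * pi))^-1 : R).
Proof.
have v0 : 0 < Num.sqrt 2 :> R by rewrite sqrtr_gt0.
have p0 : 0 < Num.sqrt pi :> R by rewrite sqrtr_gt0 pi_gt0.
have H : (Num.sqrt s * skellam s 0)^-1 @[s --> +oo] --> (Num.sqrt (2 * pi) : R).
  have -> : Num.sqrt (2 * pi) = (Num.sqrt pi / 2 + 0) * (2 * Num.sqrt 2) :> R.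
    by rewrite addr0 sqrtrM//; field.
  (* The truncation at 8 makes the domination valid for every n, not only eventually. *)
  apply/cvg_pinftyP => s soo; pose t n := Num.max (s n) 8.
  have too : t n @[n --> \oo] --> +oo.
    by apply: ger_cvgy soo; apply: nearW => n; rewrite le_max lexx.
  have t8 n : 8 <= t n by rewrite le_max lexx orbT.
  have t0 n : 0 < t n by rewrite (lt_le_trans _ (t8 n)).
  have c1 := cvg_skellam_riemann_sum t t8 too.
  have {c1} /fine_cvgP[_ c1] : ((Num.sqrt (t n) * skellam (t n) 0)^-1 / (2 * Num.sqrt 2) -
      (2 * Num.sqrt (2 * t n))^-1)%:E @[n --> \oo] --> (Num.sqrt pi / 2)%:E.
    rewrite (_ : (fun n => _) = (fun n => (\sum_(j <oo)
      (skellam (t n) j.+1 / skellam (t n) 0 / Num.sqrt (2 * t n))%:E)%E))//.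
    by apply/funext => n; rewrite skellam_riemann_sum.
  have c2 : (2 * Num.sqrt (2 * t n))^-1 @[n --> \oo] --> (0 : R).
    apply/gtr0_cvgV0; first by apply: nearW => n; rewrite mulr_gt0// sqrtr_gt0 mulr_gt0.
    apply: cvg_mulry => //.
    apply: (@cvg_comp _ _ _ (fun n => 2 * t n) Num.sqrt _ +oo); last exact: cvg_sqrty.
    exact: cvg_mulry.
  have c3 : (Num.sqrt (t n) * skellam (t n) 0)^-1 @[n --> \oo] -->
      (Num.sqrt pi / 2 + 0) * (2 * Num.sqrt 2).
    rewrite (_ : (fun n => _) = (fun n => ((Num.sqrt (t n) * skellam (t n) 0)^-1 /
      (2 * Num.sqrt 2) - (2 * Num.sqrt (2 * t n))^-1 +
      (2 * Num.sqrt (2 * t n))^-1) * (2 * Num.sqrt 2))).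
      by apply: cvgMl; exact: cvgD.
    by apply/funext => n; rewrite subrK divfK// gt_eqF// mulr_gt0.
  apply: cvg_trans c3; apply: near_eq_cvg; near=> n.
  by rewrite /t max_l//; near: n; exact: (cvgry_ge soo).
have vp : Num.sqrt (2 * pi) != 0 :> R by rewrite gt_eqF// sqrtr_gt0 mulr_gt0// pi_gt0.
have /(_ _) c := cvgV vp H.
apply: cvg_trans c; apply: near_eq_cvg; apply: nearW => s /=.
by rewrite /= invrK.
Unshelve. all: by end_near. Qed.

(** * Uniform bounds on the Skellam law *)

Lemma skellam0_le1 {R : realType} (s : R) : 0 <= s -> skellam s 0 <= 1.
Proof.
move=> s0; rewrite -lee_fin -(skellam_sum1 s s0) leeDl// mule_ge0//.
by apply: nneseries_ge0 => n _ _; rewrite lee_fin skellam_ge0.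
Qed.

(** For large s this is the limit of sqrt s q_0; for the other s it is q_0 <= 1. *)
Lemma skellam0_bound {R : realType} :
  exists2 k : R, 0 < k & forall s : R, 0 < s -> skellam s 0 <= k / Num.sqrt s.
Proof.
have := @cvg_skellam0 R => /(cvgr_le _) /(_ ((Num.sqrt (2 * pi))^-1 + 1)).
rewrite ltrDl ltr01 => /(_ erefl) [M [_ HM]].
set k := _ + 1 in HM.
have k0 : 0 < k by rewrite /k ltr_wpDl// invr_ge0 sqrtr_ge0.
exists (Num.max k (Num.sqrt M)); first by rewrite lt_max k0.
move=> s s0; rewrite ler_pdivlMr ?sqrtr_gt0//.
have [Ms|sM] := ltP M s.
  by rewrite mulrC (le_trans (HM _ Ms))// le_max lexx.
apply: (@le_trans _ _ (1 * Num.sqrt s)).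
  by rewrite ler_wpM2r ?sqrtr_ge0// skellam0_le1// ltW.
by rewrite mul1r le_max ler_wsqrtr ?orbT.
Qed.

(** skellam_decay with n = j: tripling the distance gains a factor s/(2 j^2). *)
Lemma skellam_pow3 {R : realType} (s : R) (k m : nat) : 0 < s -> (0 < m)%N ->
  skellam s (3 ^ k * m)%N <= (s / (2 * m%:R ^+ 2)) ^+ k * skellam s m.
Proof.
move=> s0 m0; elim: k => [|k IH]; first by rewrite expr0 mul1r mul1n.
have m0' : 0 < m%:R :> R by rewrite ltr0n.
set i := (3 ^ k * m)%N in IH *.
have mi : (m <= i)%N by rewrite leq_pmull// expn_gt0.
have -> : (3 ^ k.+1 * m = i + i.*2)%N by rewrite expnS -mulnA -/i; clear; lia.
have d := skellam_decay s i i (ltW s0).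
have i0 : 0 < i%:R :> R by rewrite ltr0n (leq_trans m0).
have h : skellam s (i + i.*2)%N * (2 * m%:R ^+ 2) <= s * skellam s i.
  apply: le_trans d; rewrite ler_wpM2l ?skellam_ge0 ?(ltW s0)//.
  have : m%:R ^+ 2 <= i%:R ^+ 2 :> R by rewrite ler_pXn2r ?nnegrE ?ler_nat.
  by rewrite !expr2; lra.
rewrite exprS -mulrA; apply: (@le_trans _ _ (s / (2 * m%:R ^+ 2) * skellam s i)).
  by rewrite mulrAC ler_pdivlMr// mulr_gt0// exprn_gt0.
by rewrite ler_wpM2l// divr_ge0 ?(ltW s0)// mulr_ge0// exprn_ge0.
Qed.

(** A decay of arbitrary order k in s/j^2, obtained by k triplings starting from about j/3^k. *)
Lemma skellam_poly_decay {R : realType} (s : R) (k j : nat) : 0 < s -> (3 ^ k <= j)%N ->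
  skellam s j <= (2 * 9 ^+ k * s / j%:R ^+ 2) ^+ k * skellam s 0.
Proof.
move=> s0 kj; set m := (j %/ 3 ^ k)%N.
have t0 : (0 < 3 ^ k)%N by rewrite expn_gt0.
have m0 : (0 < m)%N by rewrite divn_gt0.
have mj : (3 ^ k * m <= j)%N by rewrite mulnC leq_trunc_div.
have jm : (j <= 2 * 3 ^ k * m)%N.
  have := ltn_pmod j t0; rewrite {2}(divn_eq j (3 ^ k)) -/m => h.
  by nia.
have m0' : 0 < m%:R :> R by rewrite ltr0n.
have j0 : 0 < j%:R :> R by rewrite ltr0n (leq_trans t0).
have h1 := skellam_antitone s _ _ (ltW s0) mj.
have h2 := skellam_pow3 s k m s0 m0.
have h3 : skellam s m <= skellam s 0 by exact: (skellam_antitone s 0 m (ltW s0)).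
apply: (le_trans h1); apply: (le_trans h2).
apply: ler_pM => //; first by rewrite exprn_ge0// divr_ge0 ?(ltW s0)// mulr_ge0// exprn_ge0.
  by rewrite skellam_ge0// ltW.
apply: lerXn2r; rewrite ?nnegrE.
- by rewrite divr_ge0 ?(ltW s0)// mulr_ge0// exprn_ge0.
- by rewrite divr_ge0 ?exprn_ge0 ?(ltW j0)// mulr_ge0 ?(ltW s0)// mulr_ge0// exprn_ge0.
rewrite ler_pdivrMr ?mulr_gt0 ?exprn_gt0// mulrAC ler_pdivlMr ?exprn_gt0//.
have : j%:R ^+ 2 <= (2 * 3 ^ k * m)%:R ^+ 2 :> R by rewrite ler_pXn2r ?nnegrE ?ler_nat.
rewrite !natrM !exprMn natrX -exprM mulnC exprM => h.
have -> : 9 = 3 ^+ 2 :> R by rewrite -natrX.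
rewrite -[leLHS]mulrC; apply: (le_trans (ler_wpM2r (ltW s0) h)).
by rewrite le_eqVlt; apply/orP; left; apply/eqP; ring.
Qed.

(** * Regular variation and gamma means *)

Definition regularly_varying {R : realType} (r : R) (F : R -> R) : Prop :=
  forall c : R, 0 < c -> F (c * x) / F x @[x --> +oo] --> c `^ r.

(** The bound of Potter, with a constant adapted to monotone functions: F(2y) <= 2^b F(y) for large
    y, since 2^r < 2^b, and this is iterated along powers of 2 up to the first one that exceeds s. *)
Lemma potter {R : realType} (r b : R) (F : R -> R) :
  (forall x : R, 0 < x -> 0 < F x) -> {homo F : x y / x <= y} ->
  regularly_varying r F -> r < b -> 0 <= b ->
  exists2 X : R, 0 < X & forall x s : R, X <= x -> 1 <= s -> F (s * x) <= 2 `^ b * s `^ b * F x.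
Proof.
move=> F0 Fm rv rb b0; set B := 2 `^ b.
have B0 : 0 < B by rewrite powR_gt0.
have : 2 `^ r < B.
  rewrite /B -(subrK r b) powRD; last by rewrite pnatr_eq0 implybT.
  rewrite ltr_pMl ?powR_gt0//.
  have l2 : 0 < ln 2 :> R by rewrite ln_gt0// ltr1n.
  by rewrite /powR pnatr_eq0 /= expR_gt1 mulr_gt0 ?subr_gt0.
move=> /(cvgr_lt _ (rv 2 (ltr0Sn R 1))) [M [_ HM]].
exists (Num.max 1 (M + 1)); first by rewrite lt_max ltr01.
move=> x s; rewrite ge_max => /andP[x1 Mx] s1.
have x0 : 0 < x by rewrite (lt_le_trans _ x1).
have dbl y : x <= y -> F (2 * y) <= B * F y.
  move=> xy; have y0 : 0 < y by exact: lt_le_trans xy.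
  by rewrite -ler_pdivrMr ?F0// ltW// HM//; apply: lt_le_trans xy; lra.
have iter n : F (2 ^+ n * x) <= B ^+ n * F x.
  elim: n => [|n IH]; first by rewrite !expr0 !mul1r.
  rewrite !exprS -!mulrA; apply: (le_trans (dbl _ _)).
    by rewrite ler_peMl ?(ltW x0)// exprn_ege1// ler1n.
  by rewrite ler_pM2l.
have s0 : 0 <= s by lra.
have /andP[t1 t2] := truncn_itv s0.
have tr1 : (0 < Num.truncn s)%N by rewrite truncn_gt_nat.
have /andP[l1 l2] := trunc_log_bounds (isT : (1 < 2)%N) tr1.
set n := trunc_log 2 _ in l1 l2.
have ns : 2 ^+ n <= s by apply: le_trans t1; rewrite -natrX ler_nat.
have sn : s <= 2 ^+ n.+1 by apply: (le_trans (ltW t2)); rewrite -natrX ler_nat.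
have h1 : F (s * x) <= F (2 ^+ n.+1 * x) by apply: Fm; rewrite ler_pM2r.
apply: (le_trans h1); apply: (le_trans (iter _)).
rewrite ler_pM2r ?F0// exprS ler_pM2l// /B -powR_mulrn ?powR_ge0// -powRrM mulrC powRrM.
by rewrite powR_mulrn// ge0_ler_powR// nnegrE exprn_ge0.
Qed.

(** For n = k + 1 this is k! times the density of a/V, where V has the gamma law of parameter
    n. *)
Definition gamma_kernel {R : realType} (n : nat) (a u : R) : R :=
  expR (- (a / u)) * (a / u) ^+ n / u.

Lemma gamma_kernel_ge0 {R : realType} n (a u : R) : 0 < a -> 0 < u ->
  0 <= gamma_kernel n a u.
Proof.
by move=> a0 u0; rewrite divr_ge0 ?(ltW u0)// mulr_ge0 ?expR_ge0// exprn_ge0// divr_ge0 ?ltW.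
Qed.

Lemma measurable_gamma_kernel {R : realType} n (a : R) :
  measurable_fun (`]0%R, +oo[%classic : set R) (gamma_kernel n a).
Proof.
apply: open_continuous_measurable_fun => // u; rewrite inE/= in_itv/= andbT => u0.
have cV : {for u, continuous (fun u : R => u^-1)}.
  by apply: continuousV; [rewrite gt_eqF | exact: cvg_id].
have cD : {for u, continuous (fun u : R => a / u)}.
  by apply: continuousM => //; exact: cst_continuous.
suff : {for u, continuous (gamma_kernel n a)} by [].
rewrite /gamma_kernel; apply: continuousM => //.
apply: continuousM; last exact: continuous_exprn_comp.
by apply: continuous_comp; [exact: continuousN | exact: continuous_expR].
Qed.

Lemma integrable_gamma_kernel {R : realType} n (a : R) : 0 < a ->
  lebesgue_measure.-integrable (`]0%R, +oo[%classic : set R)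
    (fun u => (gamma_kernel n.+1 a u)%:E).
Proof.
move=> a0; apply/integrableP; split.
  by apply/measurable_EFinP; exact: measurable_gamma_kernel.
apply: (@le_lt_trans _ _ (n`!%:R%:E)); last exact: ltry.
rewrite -(integral_gamma_inv a n a0) le_eqVlt; apply/orP; left; apply/eqP.
apply: eq_integral => u; rewrite inE/= in_itv/= andbT => u0.
by rewrite ger0_norm// gamma_kernel_ge0.
Qed.

(** The moments of orders 0 to 3 of the gamma law of parameter n + 1, in the form in which the
    estimates of Chebyshev type below use them. *)
Lemma integral_cubic_gamma_kernel {R : realType} n (a p0 p1 p2 p3 : R) : 0 < a ->
  let f u := (p0 + p1 * (a / u) + p2 * (a / u) ^+ 2 + p3 * (a / u) ^+ 3) * gamma_kernel n.+1 a u in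
  (\int[lebesgue_measure]_(u in `]0%R, +oo[) (f u)%:E =
   (n`!%:R * (p0 + p1 * n.+1%:R + p2 * (n.+1%:R * n.+2%:R) +
              p3 * (n.+1%:R * n.+2%:R * n.+3%:R)))%:E)%E.
Proof.
move=> a0 f.
have mD : measurable (`]0%R, +oo[%classic : set R) by exact: measurable_itv.
pose g (p : R) k u := (p%:E * (gamma_kernel k.+1 a u)%:E)%E.
have gi p k : lebesgue_measure.-integrable (`]0%R, +oo[%classic : set R) (g p k).
  by apply: integrableZl => //; exact: integrable_gamma_kernel.
have gI p k : (\int[lebesgue_measure]_(u in `]0%R, +oo[) g p k u = (p * k`!%:R)%:E)%E.
  by rewrite integralZl ?integrable_gamma_kernel// integral_gamma_inv.
transitivity (\int[lebesgue_measure]_(u in `]0%R, +oo[)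
    (g p0 n u + g p1 n.+1 u + g p2 n.+2 u + g p3 n.+3 u))%E.
  apply: eq_integral => u _; rewrite /g -!EFinM -!EFinD /f; congr EFin.
  by rewrite /gamma_kernel -[n.+4]addn3 -[n.+3]addn2 -[n.+2]addn1 !exprD expr1; ring.
have i1 : lebesgue_measure.-integrable (`]0%R, +oo[%classic : set R)
    (g p0 n \+ g p1 n.+1)%E by exact: integrableD.
have i2 : lebesgue_measure.-integrable (`]0%R, +oo[%classic : set R)
    ((g p0 n \+ g p1 n.+1) \+ g p2 n.+2)%E.
  exact: integrableD.
rewrite integralD; [|exact: measurable_itv|exact: i2|exact: gi].
rewrite integralD; [|exact: measurable_itv|exact: i1|exact: gi].
rewrite integralD; [|exact: measurable_itv|exact: gi|exact: gi].
rewrite !gI -!EFinD; congr EFin.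
by rewrite !factS !natrM; ring.
Qed.

Lemma regularly_varying_near1 {R : realType} (r e : R) (F : R -> R) :
  (forall x : R, 0 < x -> 0 < F x) -> regularly_varying r F -> r <= 1 -> 0 < e -> e < 1 ->
  exists2 X : R, 0 < X & forall x, X <= x ->
    F ((1 + e) * x) <= (1 + 2 * e) * F x /\ (1 - 2 * e) * F x <= F ((1 - e) * x).
Proof.
move=> F0 rv r1 e0 e1.
have h1 : (1 + e) `^ r < 1 + 2 * e.
  by apply: (@le_lt_trans _ _ (1 + e)); [apply: ler1_powR; lra | lra].
have h2 : 1 - 2 * e < (1 - e) `^ r.
  by apply: (@lt_le_trans _ _ (1 - e)); [lra | apply: ger1_powR => //; lra].
have p1 : 0 < 1 + e by lra.
have p2 : 0 < 1 - e by lra.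
have [M1 [_ H1]] := cvgr_lt _ (rv (1 + e) p1) _ h1.
have [M2 [_ H2]] := cvgr_gt _ (rv (1 - e) p2) _ h2.
exists (Num.max 1 (Num.max (M1 + 1) (M2 + 1))); first by rewrite lt_max ltr01.
move=> x; rewrite !ge_max => /and3P[x1 M1x M2x].
have x0 : 0 < x by lra.
by split; [rewrite -ler_pdivrMr ?F0// ltW// H1//; lra
          |rewrite -ler_pdivlMr ?F0// ltW// H2//; lra].
Qed.

Lemma measurable_nondecreasing_inv {R : realType} (F : R -> R) (a : R) :
  {homo F : x y / x <= y} ->
  measurable_fun (`]0%R, +oo[%classic : set R) (fun u => F (a / u)).
Proof.
move=> Fm; apply: measurableT_comp; first exact: nondecreasing_measurable.
apply: open_continuous_measurable_fun => // u; rewrite inE/= in_itv/= andbT => u0.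
suff : {for u, continuous (fun u : R => a / u)} by [].
apply: continuousM; first exact: cst_continuous.
by apply: continuousV; [rewrite gt_eqF | exact: cvg_id].
Qed.

(** Let V = a/u; under the kernel V has the gamma law of parameter k = n + 1, with mean k and
    variance k. Where V is within e k of k, regular variation and monotonicity give F(V) about F(k).
    Elsewhere an upper bound must control large values of F: there F(V) <= 2 (V/k) F(k) by Potter
    with exponent 1, and the loss is paid for by the moment of V (V - k)^2. The lower bound needs
    only the variance. N is uniform in a because the law of V does not depend on a. *)
Lemma gamma_mean {R : realType} (r eta : R) (F : R -> R) :
  (forall x : R, 0 < x -> 0 < F x) -> {homo F : x y / x <= y} ->
  regularly_varying r F -> r < 1 -> 0 < eta -> eta < 1 ->
  exists N : nat, forall n (a : R), (N <= n)%N -> 0 < a ->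
  let I := (\int[lebesgue_measure]_(u in `]0%R, +oo[)
              (F (a / u) * gamma_kernel n.+1 a u)%:E)%E in
  (((1 - eta) * (F n.+1%:R * n`!%:R))%:E <= I /\
   I <= ((1 + eta) * (F n.+1%:R * n`!%:R))%:E)%E.
Proof.
move=> F0 Fm rv r1 eta0 eta1; pose e := eta / 4.
have e0 : 0 < e by rewrite divr_gt0.
have e1 : e < 1 / 4 by rewrite /e; lra.
have e1' : e < 1 by lra.
have [X1 X10 near1] := regularly_varying_near1 r e F F0 rv (ltW r1) e0 e1'.
have [X2 X20 pot] := potter r 1 F F0 Fm rv r1 ler01.
have e20 : 0 < e ^+ 2 by rewrite exprn_gt0.
have e30 : 0 < e ^+ 3 by rewrite exprn_gt0.
exists (Num.truncn (Num.max (3 / e ^+ 3) (Num.max X1 X2))).+1 => n a Nn a0 I.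
set k := n.+1%:R.
have kX : Num.max (3 / e ^+ 3) (Num.max X1 X2) <= k.
  apply: ltW; apply: (lt_le_trans (truncnS_gt _)).
  by rewrite /k ler_nat (leq_trans Nn).
move: kX; rewrite !ge_max => /and3P[ke X1k X2k].
have k0 : 0 < k by rewrite ltr0n.
have k1 : 1 <= k by rewrite ler1n.
have k20 : 0 < k ^+ 2 by rewrite exprn_gt0.
have k2 : n.+2%:R = k + 1 by rewrite /k natr1.
have k3 : n.+3%:R = k + 2 by rewrite /k -[n.+3]addn2 natrD.
have [up lo] := near1 k X1k.
have Fk : 0 < F k by exact: F0.
have f0 : 0 < n`!%:R :> R by rewrite ltr0n fact_gt0.
have ke3 : 3 <= e ^+ 3 * k by rewrite mulrC -ler_pdivrMr.
have mD : measurable (`]0%R, +oo[%classic : set R) by exact: measurable_itv.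
have mF := measurable_nondecreasing_inv F a Fm.
have mk := measurable_gamma_kernel n.+1 a.
have mv p0 p1 p2 p3 : measurable_fun (`]0%R, +oo[%classic : set R)
    (fun u => p0 + p1 * (a / u) + p2 * (a / u) ^+ 2 + p3 * (a / u) ^+ 3).
  have mi : measurable_fun (`]0%R, +oo[%classic : set R) (fun u => a / u).
    exact: (measurable_nondecreasing_inv id a (fun _ _ => id)).
  apply: measurable_funD; last by apply: measurable_funM => //; exact: measurable_funX.
  apply: measurable_funD; last by apply: measurable_funM => //; exact: measurable_funX.
  by apply: measurable_funD => //; exact: measurable_funM.
have G0 u : 0 < u -> 0 <= gamma_kernel n.+1 a u by exact: gamma_kernel_ge0.
have Fa u : 0 < u -> 0 < F (a / u) by move=> u0; rewrite F0// divr_gt0.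
split; last first.
  (* With this c, the term c V (V - k)^2 is at least 2 V/k as soon as |V - k| >= e k. *)
  pose c := 2 / (e ^+ 2 * k ^+ 3).
  have c0 : 0 < c by rewrite divr_gt0// mulr_gt0// exprn_gt0.
  apply: (@le_trans _ _ (\int[lebesgue_measure]_(u in `]0%R, +oo[)
     ((F k * (1 + 2 * e) + F k * (c * k ^+ 2) * (a / u) +
      F k * (- (2 * k * c)) * (a / u) ^+ 2 + F k * c * (a / u) ^+ 3) *
      gamma_kernel n.+1 a u)%:E)%E).
    have bnd u : 0 < u -> F (a / u) <= F k * (1 + 2 * e) + F k * (c * k ^+ 2) * (a / u) +
      F k * (- (2 * k * c)) * (a / u) ^+ 2 + F k * c * (a / u) ^+ 3.
      move=> u0; set v := a / u; have v0 : 0 < v by rewrite divr_gt0.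
      have -> : F k * (1 + 2 * e) + F k * (c * k ^+ 2) * v +
        F k * (- (2 * k * c)) * v ^+ 2 + F k * c * v ^+ 3 =
        F k * ((1 + 2 * e) + c * v * (v - k) ^+ 2) by ring.
      have [vk|kv] := leP v ((1 + e) * k).
        apply: (le_trans (Fm _ _ vk)); apply: (le_trans up).
        rewrite mulrC ler_pM2l// lerDl mulr_ge0 ?sqr_ge0// mulr_ge0 ?ltW//.
      have kv' : k <= v by apply: le_trans (ltW kv); rewrite ler_peMl ?(ltW k0)//; lra.
      have := pot k (v / k) X2k; rewrite ler_pdivlMr// mul1r => /(_ kv').
      have vk0 : 0 < v / k by apply: divr_gt0.
      rewrite divfK ?gt_eqF// powRr1// powRr1 ?(ltW vk0)// => h.
      apply: (le_trans h); rewrite mulrC ler_pM2l//.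
      have : 2 * (v / k) * 1 <= 2 * (v / k) * ((v - k) ^+ 2 / (e * k) ^+ 2).
        rewrite ler_pM2l ?(mulr_gt0 _ vk0)//.
        rewrite ler_pdivlMr ?exprn_gt0 ?mulr_gt0// mul1r ler_pXn2r ?nnegrE//.
        - by lra.
        - by rewrite mulr_ge0 ?ltW.
        - by rewrite subr_ge0.
      have -> : 2 * (v / k) * ((v - k) ^+ 2 / (e * k) ^+ 2) = c * v * (v - k) ^+ 2.
        by rewrite /c; field; rewrite !gt_eqF.
      by rewrite mulr1 => h3; apply: (le_trans h3); rewrite lerDr; lra.
    apply: ge0_le_integral => //.
    - by move=> u; rewrite /= in_itv/= andbT => u0; rewrite lee_fin mulr_ge0 ?G0 ?(ltW (Fa _ u0)).
    - by apply/measurable_EFinP; exact: measurable_funM.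
    - by apply/measurable_EFinP; apply: measurable_funM => //; exact: mv.
    - move=> u; rewrite /= in_itv/= andbT => u0; rewrite lee_fin ler_wpM2r ?G0//.
      exact: bnd.
  rewrite integral_cubic_gamma_kernel// lee_fin -/k.
  rewrite k2 k3.
  (* The mean of V (V - k)^2 is k^2 + 2k, so the correction is of order 1/k. *)
  have -> : n`!%:R * (F k * (1 + 2 * e) + F k * (c * k ^+ 2) * k +
     F k * - (2 * k * c) * (k * (k + 1)) + F k * c * (k * (k + 1) * (k + 2))) =
     (1 + 2 * e + c * (k ^+ 2 + 2 * k)) * (F k * n`!%:R) by ring.
  rewrite ler_pM2r ?mulr_gt0//.
  suff : c * (k ^+ 2 + 2 * k) <= 2 * e by rewrite /e; lra.
  have -> : c * (k ^+ 2 + 2 * k) = 2 * (k + 2) / (e ^+ 2 * k ^+ 2).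
    by rewrite /c; field; rewrite !gt_eqF.
  rewrite ler_pdivrMr ?mulr_gt0//.
  have -> : 2 * e * (e ^+ 2 * k ^+ 2) = 2 * (e ^+ 3 * k * k) by ring.
  have : 3 * k <= e ^+ 3 * k * k by rewrite ler_pM2r.
  by move: (e ^+ 3 * k * k) => z; lra.
(* With this c, the term c (V - k)^2 is at least 1 - 2e as soon as |V - k| >= e k. *)
pose c := (1 - 2 * e) / (e * k) ^+ 2.
have c0 : 0 <= c by rewrite divr_ge0 ?sqr_ge0//; lra.
pose V u := (F k * (c * k ^+ 2) + F k * (- (2 * k * c)) * (a / u) + F k * c * (a / u) ^+ 2 +
  0 * (a / u) ^+ 3) * gamma_kernel n.+1 a u.
have VE u : V u = F k * c * (a / u - k) ^+ 2 * gamma_kernel n.+1 a u by rewrite /V; ring.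
have V0 u : 0 < u -> 0 <= V u.
  by move=> u0; rewrite VE mulr_ge0 ?G0// mulr_ge0 ?sqr_ge0// mulr_ge0// ltW.
have mV : measurable_fun (`]0%R, +oo[%classic : set R) (fun u => (V u)%:E).
  by apply/measurable_EFinP; apply: measurable_funM => //; exact: mv.
have mFk : measurable_fun (`]0%R, +oo[%classic : set R)
    (fun u => (F (a / u) * gamma_kernel n.+1 a u)%:E).
  by apply/measurable_EFinP; exact: measurable_funM.
have IV : (\int[lebesgue_measure]_(u in `]0%R, +oo[) (V u)%:E =
    (F k * n`!%:R * (c * k))%:E)%E.
  by rewrite integral_cubic_gamma_kernel// -/k k2 k3; congr EFin; ring.
have : (((1 - 2 * e) * (F k * n`!%:R))%:E <= I + (F k * n`!%:R * (c * k))%:E)%E.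
  rewrite -IV -ge0_integralD//; last 2 first.
  - by move=> u; rewrite /= in_itv/= andbT => u0; rewrite lee_fin mulr_ge0 ?G0 ?(ltW (Fa _ u0)).
  - by move=> u; rewrite /= in_itv/= andbT => u0; rewrite lee_fin V0.
  apply: (@le_trans _ _ (\int[lebesgue_measure]_(u in `]0%R, +oo[)
     (((1 - 2 * e) * F k + 0 * (a / u) + 0 * (a / u) ^+ 2 + 0 * (a / u) ^+ 3) *
      gamma_kernel n.+1 a u)%:E)%E).
    rewrite integral_cubic_gamma_kernel// lee_fin le_eqVlt; apply/orP; left.
    by apply/eqP; ring.
  apply: ge0_le_integral => //.
  - move=> u; rewrite /= in_itv/= andbT => u0; rewrite lee_fin mulr_ge0 ?G0//.
    by rewrite !mul0r !addr0 mulr_ge0 ?(ltW Fk)//; lra.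
  - by apply/measurable_EFinP; apply: measurable_funM => //; exact: mv.
  - exact: emeasurable_funD.
  move=> u; rewrite /= in_itv/= andbT => u0.
  rewrite -EFinD lee_fin VE -mulrDl ler_wpM2r ?G0//.
  rewrite !mul0r !addr0; set v := a / u.
  have [vk|kv] := leP ((1 - e) * k) v.
    apply: (le_trans lo); apply: (le_trans (Fm _ _ vk)).
    by rewrite lerDl mulr_ge0 ?sqr_ge0// mulr_ge0// ltW.
  have v0 : 0 < F v by exact: Fa.
  apply: (@le_trans _ _ (F k * c * (v - k) ^+ 2)); last by rewrite lerDr ltW.
  have -> : (1 - 2 * e) * F k = F k * c * (e * k) ^+ 2.
    by rewrite /c; field; rewrite !gt_eqF.
  rewrite ler_wpM2l ?(mulr_ge0 (ltW Fk) c0)//.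
  have ek0 : 0 <= e * k by rewrite mulr_ge0// ltW.
  have kv2 : e * k <= k - v.
    have -> : e * k = k - (1 - e) * k by ring.
    by rewrite lerD2l lerN2 ltW.
  rewrite -[leRHS]sqrrN opprB; apply: lerXn2r; rewrite ?nnegrE//.
  exact: le_trans kv2.
have ck : c * k <= 2 * e.
  have -> : c * k = (1 - 2 * e) / (e ^+ 2 * k) by rewrite /c; field; rewrite !gt_eqF.
  rewrite ler_pdivrMr ?mulr_gt0//.
  have -> : 2 * e * (e ^+ 2 * k) = 2 * (e ^+ 3 * k) by ring.
  by move: (e ^+ 3 * k) ke3 => z; lra.
rewrite -leeBlDr// -EFinB; apply: le_trans; rewrite lee_fin.
have -> : (1 - 2 * e) * (F k * n`!%:R) - F k * n`!%:R * (c * k) =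
  (1 - 2 * e - c * k) * (F k * n`!%:R) by ring.
by rewrite ler_pM2r ?mulr_gt0// /e in ck *; lra.
Qed.

(** * The simple random walk at a Poisson time *)

Lemma esum_fin {R : realType} (T : finType) (f : T -> \bar R) :
  (forall i, (0 <= f i)%E) ->
  (\esum_(i in [set: T]) f i = \sum_i f i)%E.
Proof.
move=> f0; rewrite (_ : [set: T] = [set` index_enum T]); last first.
  by apply/seteqP; split => // x _ /=; exact: mem_index_enum.
by rewrite esum_fset// -fsbig_seq// index_enum_uniq.
Qed.

Definition unit_step {d : nat} (i : 'I_d) (b : bool) : 'rV[int]_d :=
  if b then delta_mx 0 i else - delta_mx 0 i.

Lemma unit_step_inj {d : nat} (p q : 'I_d * bool) :
  unit_step p.1 p.2 = unit_step q.1 q.2 -> p = q.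
Proof.
case: p q => [i b] [j c] /= /rowP e.
move: (e i) => {e}; rewrite /unit_step.
by case: b c => [] []; rewrite !mxE !eqxx /=; case: (eqVneq i j) => [->|].
Qed.

Lemma esum_srw_step {R : realType} {d : nat} (f : 'rV[int]_d -> \bar R) :
  (forall y, (0 <= f y)%E) ->
  (\esum_(y in [set: 'rV[int]_d]) (srw_step R y * f y) =
   \sum_(i < d) ((2 * d%:R)^-1%:E * (f (unit_step i true) + f (unit_step i false))))%E.
Proof.
move=> f0; pose e (p : 'I_d * bool) := unit_step p.1 p.2.
have Pe y : [exists i : 'I_d, (y == delta_mx 0 i) || (y == - delta_mx 0 i)] <-> range e y.
  split=> [/existsP[i /orP[] /eqP ->]|[[i b] _ <-]].
  - by exists (i, true).
  - by exists (i, false).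
  - by apply/existsP; exists i; rewrite /e /unit_step/=; case: b; rewrite eqxx ?orbT.
have d0 : (0 <= ((2 * d%:R)^-1 : R)%:E)%E by rewrite lee_fin invr_ge0 mulr_ge0.
transitivity (\esum_(y in range e) ((2 * d%:R)^-1%:E * f y))%E.
  rewrite [RHS]esum_mkcond; apply: eq_esum => y _; rewrite /srw_step.
  case: ifPn => [/Pe ye|ne]; first by rewrite mem_set.
  by rewrite memNset ?mul0e// => /Pe; rewrite (negbTE ne).
rewrite (@reindex_esum _ _ _ [set: 'I_d * bool] _ e); last first.
  by split => // p q _ _; exact: unit_step_inj.
rewrite esum_fin; last by move=> p; exact: mule_ge0.
rewrite (eq_bigr (fun p : 'I_d * bool => ((2 * d%:R)^-1%:E * f (unit_step p.1 p.2))%E))//.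
rewrite -(pair_bigA _ (fun i b => ((2 * d%:R)^-1%:E * f (unit_step i b))%E))/=.
apply: eq_bigr => i _; rewrite big_bool/= -ge0_muleDr//.
Qed.

(** The law of the walk that moves one of the coordinates of I at each step, times the number |I|^n
    of choices of the moved coordinates. Iterated binomial convolution counts the interleavings of
    the moves of the coordinates. *)
Fixpoint walk_seq {R : realType} {d : nat} (I : seq 'I_d) (x : 'rV[int]_d) : nat -> R :=
  if I is i :: J then binconv (walk1^~ (x 0 i)) (walk_seq J x)
  else fun n => (n == 0%N)%:R.

Lemma walk_seq_eq {R : realType} {d : nat} (I : seq 'I_d) (x y : 'rV[int]_d) :
  (forall i, i \in I -> x 0 i = y 0 i) -> walk_seq I x = walk_seq I y :> (nat -> R).
Proof.
elim: I => [//|i J IH] xy /=; rewrite (xy i) ?mem_head// IH// => k kJ.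
by rewrite xy// inE kJ orbT.
Qed.

(** The product rule binconvS says that a step moves exactly one coordinate. *)
Lemma walk_seqS {R : realType} {d : nat} (I : seq 'I_d) (x : 'rV[int]_d) n : uniq I ->
  walk_seq I x n.+1 = \sum_(i <- I)
    (walk_seq I (x - unit_step i true) n + walk_seq I (x - unit_step i false) n) / 2 :> R.
Proof.
elim: I n => [n _|i J IH n /= /andP[iJ uJ]]; first by rewrite big_nil.
rewrite binconvS big_cons; congr (_ + _).
  rewrite /unit_step !mxE !eqxx opprK.
  rewrite (@walk_seq_eq _ _ J (x - _) x) ?(@walk_seq_eq _ _ J (x - - _) x).
  - by rewrite /binconv -big_split/= mulr_suml; apply: eq_bigr => k _; ring.
  - move=> k kJ; rewrite !mxE eqxx; case: (eqVneq k i) => [ki|].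
      by rewrite -ki kJ in iJ.
    by rewrite oppr0 subr0.
  - move=> k kJ; rewrite !mxE eqxx; case: (eqVneq k i) => [ki|].
      by rewrite -ki kJ in iJ.
    by rewrite subr0.
transitivity (binconv (walk1^~ (x 0 i)) (fun k => \sum_(j <- J)
    (walk_seq J (x - unit_step j true) k + walk_seq J (x - unit_step j false) k) / 2) n : R).
  by congr binconv; apply/funext => k; exact: IH.
transitivity (\sum_(j <- J) binconv (walk1^~ (x 0 i)) (fun k =>
    (walk_seq J (x - unit_step j true) k + walk_seq J (x - unit_step j false) k) / 2) n : R).
  rewrite /binconv exchange_big/=; apply: eq_bigr => k _.
  by rewrite !mulr_sumr.
rewrite big_seq [RHS]big_seq; apply: eq_bigr => j jJ.
have ij : i == j = false by apply/eqP => ij; rewrite ij jJ in iJ.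
rewrite /unit_step !mxE eqxx ij /= oppr0 subr0.
by rewrite /binconv -big_split/= mulr_suml; apply: eq_bigr => k _; ring.
Qed.

Lemma walk_seq_ge0 {R : realType} {d : nat} (I : seq 'I_d) (x : 'rV[int]_d) n :
  0 <= walk_seq I x n :> R.
Proof.
elim: I n => [|i J IH] n /=; first by rewrite ler0n.
by apply: sumr_ge0 => k _; rewrite !mulr_ge0 ?walk1_ge0.
Qed.

Lemma walk_seq0 {R : realType} {d : nat} (I : seq 'I_d) (x : 'rV[int]_d) :
  walk_seq I x 0 = (all (fun i => x 0 i == 0) I)%:R :> R.
Proof.
elim: I => [//|i J IH] /=; rewrite /binconv big_ord1 bin0 mul1r IH /=.
by case: (x 0 i == 0); rewrite ?mul1r ?mul0r.
Qed.

Lemma srw_probE {R : realType} {d : nat} (x : 'rV[int]_d) n :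
  srw_prob R n x = (d%:R ^- n * walk_seq (enum 'I_d) x n)%:E.
Proof.
elim: n x => [|n IH] x.
  rewrite /srw_prob /= invr1 mul1r walk_seq0; congr ((_ _)%:R%:E).
  apply/eqP/allP => [-> i _|h]; first by rewrite mxE.
  by apply/rowP => i; rewrite mxE; apply/eqP/h; rewrite mem_enum.
have -> : srw_prob R n.+1 x =
  (\esum_(y in [set: 'rV[int]_d]) srw_step R y * srw_prob R n (x - y))%E by [].
have w0 y : 0 <= d%:R ^- n * walk_seq (enum 'I_d) y n :> R.
  by rewrite mulr_ge0 ?walk_seq_ge0// invr_ge0 exprn_ge0.
rewrite esum_srw_step; last by move=> y; rewrite IH lee_fin.
rewrite walk_seqS ?enum_uniq// big_enum/= mulr_sumr -sumEFin.
apply: eq_bigr => i _; rewrite !IH -EFinD -EFinM; congr EFin.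
by rewrite exprS !invfM; ring.
Qed.

Lemma srw_prob_ge0 {R : realType} {d : nat} (x : 'rV[int]_d) n : (0 <= srw_prob R n x)%E.
Proof. by rewrite srw_probE lee_fin mulr_ge0 ?walk_seq_ge0// invr_ge0 exprn_ge0. Qed.

Lemma walk1_eq0 {R : realType} n (j : int) : (n < `|j|)%N -> walk1 n j = 0 :> R.
Proof.
elim: n j => [|n IH] j nj /=; first by rewrite -absz_eq0; case: `|j|%N nj.
by rewrite !IH ?addr0 ?mul0r//; lia.
Qed.

Lemma walk_seq_eq0 {R : realType} {d : nat} (I : seq 'I_d) (x : 'rV[int]_d) n (i : 'I_d) :
  i \in I -> (n < `|x 0%R i|)%N -> walk_seq I x n = 0 :> R.
Proof.
elim: I n => [//|k J IH] n; rewrite inE => /predU1P[<-|iJ] nx /=;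
    rewrite /binconv big1// => m _.
  by rewrite walk1_eq0 ?mul0r ?mulr0//; apply: leq_ltn_trans nx; rewrite -ltnS.
by rewrite IH ?mulr0//; apply: leq_ltn_trans nx; rewrite leq_subr.
Qed.

(** Independence of the coordinates at a Poisson time. *)
Lemma egf_walk_seq {R : realType} {d : nat} (I : seq 'I_d) (x : 'rV[int]_d) (t : R) :
  0 <= t -> egf t (walk_seq I x) = (\prod_(i <- I) (expR t * skellam t (x 0 i)))%:E.
Proof.
move=> t0; elim: I => [|i J IH] /=.
  rewrite big_nil /egf nneseries_recl//; last first.
    by move=> n _; rewrite lee_fin mulr_ge0// divr_ge0// exprn_ge0.
  rewrite eseries0 ?adde0 ?mul1r ?fact0 ?invr1//.
  by move=> [//|n] _ _; rewrite mul0r.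
rewrite egf_binconv ?IH ?egf_walk1 ?big_cons//.
- by move=> n; exact: walk1_ge0.
- by move=> n; exact: walk_seq_ge0.
Qed.

Lemma poisson_srw {R : realType} {d : nat} (x : 'rV[int]_d) (t : R) : (0 < d)%N -> 0 <= t ->
  (\sum_(n <oo) (expR (- t) * t ^+ n / n`!%:R)%:E * srw_prob R n x =
   (\prod_(i < d) skellam (t / d%:R) (x 0 i))%:E)%E.
Proof.
move=> d0 t0; have dn : d%:R != 0 :> R by rewrite pnatr_eq0 -lt0n.
have td : 0 <= t / d%:R by rewrite divr_ge0.
transitivity ((expR (- t))%:E * egf (t / d%:R) (walk_seq (enum 'I_d) x))%E.
  rewrite /egf -nneseriesZl; last first.
    by move=> n _; rewrite lee_fin mulr_ge0 ?walk_seq_ge0// divr_ge0// exprn_ge0.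
  apply: eq_eseriesr => n _; rewrite srw_probE -!EFinM; congr EFin.
  by rewrite expr_div_n; ring.
rewrite egf_walk_seq// big_enum/= big_split/= prodr_const card_ord -expRM_natl.
rewrite mulrCA divff// mulr1 -EFinM mulrA [_ * expR t]mulrC expRxMexpNx_1 mul1r//.
Qed.

(** * The Green function as a renewal series *)

Lemma esum_muleZl {R : realType} {T : choiceType} (D : set T) (c : \bar R) (f : T -> \bar R) :
  (0 <= c)%E -> (forall i, (0 <= f i)%E) ->
  (\esum_(i in D) (c * f i) = c * \esum_(i in D) f i)%E.
Proof.
move=> c0 f0; case: c c0 => [r| |]//; first by rewrite lee_fin => r0; exact: esumZl.
move=> _; have [h|] := pselect (forall i, D i -> f i = 0%E).
  by rewrite !esum1 ?mule0// => i Di; rewrite h// mule0.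
move=> /existsNP[i /not_implyP[Di /eqP fi]].
have fi0 : (0 < f i)%E by rewrite lt0e fi f0.
have ge (g : T -> \bar R) : (forall j, (0 <= g j)%E) -> (g i <= \esum_(j in D) g j)%E.
  move=> g0; apply: esum_ge; exists [set i]; last by rewrite fsbig_set1.
  by split; [exact: finite_set1 | move=> j ->].
have y0 : (0 <= +oo :> \bar R)%E by [].
rewrite [RHS]gt0_mulye; last exact: lt_le_trans (ge f f0).
apply/eqP; rewrite eq_le leey/= (le_trans _ (ge (fun j => +oo * f j)%E _))//.
  by rewrite gt0_mulye.
by move=> j; exact: mule_ge0.
Qed.

Lemma esum_muleZr {R : realType} {T : choiceType} (D : set T) (c : \bar R) (f : T -> \bar R) :
  (0 <= c)%E -> (forall i, (0 <= f i)%E) ->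
  (\esum_(i in D) (f i * c) = (\esum_(i in D) f i) * c)%E.
Proof.
move=> c0 f0; rewrite [RHS]muleC -esum_muleZl//.
by apply: eq_esum => i _; rewrite muleC.
Qed.

Lemma srw_step_ge0 {R : realType} {d : nat} (y : 'rV[int]_d) : (0 <= srw_step R y)%E.
Proof. by rewrite /srw_step lee_fin; case: ifP => // _; rewrite invr_ge0 mulr_ge0. Qed.

(** The Chapman-Kolmogorov equation. *)
Lemma srw_prob_add {R : realType} {d : nat} (x : 'rV[int]_d) (n k : nat) :
  (\esum_(y in [set: 'rV[int]_d]) (srw_prob R n y * srw_prob R k (x - y)%R) =
   srw_prob R (n + k) x)%E.
Proof.
elim: n x => [|n IH] x.
  transitivity (\esum_(y in [set (0%R : 'rV[int]_d)]) srw_prob R k x)%E; last first.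
    by rewrite esum_set1// srw_prob_ge0.
  rewrite [RHS]esum_mkcond; apply: eq_esum => y _.
  rewrite {1}/srw_prob /=; case: (eqVneq y 0) => [->|/eqP y0].
    by rewrite mem_set// mul1e subr0.
  by rewrite memNset// mul0e.
have S m z : srw_prob R m.+1 z =
  (\esum_(y in [set: 'rV[int]_d]) srw_step R y * srw_prob R m (z - y)%R)%E by [].
have P0 := @srw_prob_ge0 R d; have s0 := @srw_step_ge0 R d.
under eq_esum => y _.
  rewrite S -esum_muleZr//; last by move=> z; exact: mule_ge0.
  over.
rewrite esum_exchange; last by move=> y z; rewrite !mule_ge0.
rewrite addSn S; apply: eq_esum => z _.
under eq_esum => y _ do rewrite -muleA.
rewrite esum_muleZl//; last by move=> y; exact: mule_ge0.
congr (_ * _)%E; rewrite -IH.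
rewrite (reindex_esumT (fun y => y + z) (fun y => y - z)); last 2 first.
- by move=> y; rewrite addrK.
- by move=> y; rewrite subrK.
by apply: eq_esum => y _; rewrite addrK opprD addrA addrAC.
Qed.

Fixpoint conv_pow {R : realType} (c : nat -> R) (m k : nat) : R :=
  if m is m'.+1 then \sum_(j < k.+1) c j * conv_pow c m' (k - j) else (k == 0%N)%:R.

Lemma conv_pow_ge0 {R : realType} (c : nat -> R) m k :
  (forall n, 0 <= c n) -> 0 <= conv_pow c m k.
Proof.
move=> c0; elim: m k => [|m IH] k /=; first by rewrite ler0n.
by apply: sumr_ge0 => j _; exact: mulr_ge0.
Qed.

Lemma conv_pow_eq0 {R : realType} (c : nat -> R) m k :
  c 0%N = 0 -> (k < m)%N -> conv_pow c m k = 0.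
Proof.
move=> c0; elim: m k => [//|m IH] k km /=; apply: big1 => -[[|j] jk] _ /=.
  by rewrite c0 mul0r.
by rewrite IH ?mulr0//; lia.
Qed.

(** The renewal sequence is the geometric series of convolution powers of c. It is finite because
    c 0 = 0 puts the first nonzero entry of the m-th power at index m or later. *)
Lemma renewal_conv_pow {R : realType} (c C : nat -> R) k :
  c 0%N = 0 -> renewal_sequence c C -> C k = \sum_(m < k.+1) conv_pow c m k.
Proof.
move=> c0 [C0 CS]; elim/ltn_ind: k => -[|k] IH.
  by rewrite C0 big_ord1.
rewrite CS// big_ord_recl /= add0r.
transitivity (\sum_(1 <= j < k.+2) \sum_(m < k.+1) c j * conv_pow c m (k.+1 - j)).
  rewrite big_nat [RHS]big_nat; apply: eq_bigr => j /andP[j1 jk].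
  rewrite IH; last by lia.
  rewrite mulr_sumr.
  rewrite -(big_mkord xpredT (fun m => c j * conv_pow c m (k.+1 - j)%N)).
  rewrite -(big_mkord xpredT (fun m => c j * conv_pow c m (k.+1 - j)%N)).
  rewrite [RHS](@big_cat_nat _ _ _ (k.+1 - j).+1)//=; last by lia.
  rewrite -[LHS]addr0; congr (_ + _); symmetry.
  rewrite big_nat big1// => m /andP[jm _].
  by rewrite conv_pow_eq0 ?mulr0.
rewrite exchange_big/=; apply: eq_bigr => m _;
rewrite -(big_mkord xpredT (fun j => c j * conv_pow c m (k.+1 - j)%N)).
by rewrite [RHS]big_nat_recl// c0 mul0r add0r big_add1.
Qed.

(** Valid for whichever triple represents psi, and also for the zero measure. *)
Lemma bernstein_weight_ge0 {R : realType} (psi : R -> R) n : 0 <= bernstein_weight psi n.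
Proof.
have b0 : 0 <= levy_drift psi.
  rewrite /levy_drift /levy_triple; case: pselect => //= h.
  by case: (cid h) => t [].
have I0 k : 0 <= \int[levy_measure psi]_(t in `]0, +oo[) (t ^+ k * expR (- t)).
  apply: fine_ge0; apply: integral_ge0 => t; rewrite /= in_itv/= andbT => t0.
  by rewrite lee_fin mulr_ge0 ?expR_ge0// exprn_ge0// ltW.
case: n => [|[|n]] //=; last by rewrite mulr_ge0// invr_ge0.
by rewrite addr_ge0//; exact: (I0 1%N).
Qed.

Section green.
Variables (R : realType) (d : nat) (psi : R -> R).
Let c := bernstein_weight psi.
Let c0 : forall n, 0 <= c n := bernstein_weight_ge0 psi.

Lemma subordinated_stepE (y : 'rV[int]_d) :
  (subordinated_step psi y = \esum_(n in [set: nat]) ((c n)%:E * srw_prob R n y))%E.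
Proof.
rewrite -nneseries_esumT; last by move=> n; rewrite mule_ge0 ?lee_fin ?srw_prob_ge0.
rewrite nneseries_recl//; last by move=> n _; rewrite mule_ge0 ?lee_fin ?srw_prob_ge0.
by rewrite mul0e add0e.
Qed.

Lemma subordinated_probE (m : nat) (x : 'rV[int]_d) :
  (subordinated_prob psi m x =
   \esum_(k in [set: nat]) ((conv_pow c m k)%:E * srw_prob R k x))%E.
Proof.
have P0 := @srw_prob_ge0 R d.
have cp0 j k : (0 <= (conv_pow c j k)%:E)%E by rewrite lee_fin conv_pow_ge0.
have ce0 n : (0 <= (c n)%:E)%E by rewrite lee_fin.
elim: m x => [|m IH] x.
  rewrite -nneseries_esumT; last by move=> k; exact: mule_ge0.
  rewrite nneseries_recl//; last by move=> k _; exact: mule_ge0.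
  by rewrite mul1e eseries0 ?adde0// => -[//|k] _ _; rewrite mul0e.
have -> : subordinated_prob psi m.+1 x = (\esum_(y in [set: 'rV[int]_d])
  subordinated_step psi y * subordinated_prob psi m (x - y)%R)%E by [].
under eq_esum => y _.
  rewrite subordinated_stepE [X in (_ * X)%E](IH (x - y)%R) -esum_muleZr; last 2 first.
  - by apply: esum_ge0 => k _; exact: mule_ge0.
  - by move=> n; exact: mule_ge0.
  under eq_esum => n _.
    rewrite -esum_muleZl; last 2 first.
    - exact: mule_ge0.
    - by move=> k; exact: mule_ge0.
    over.
  over.
rewrite esum_exchange; last first.
  by move=> y n; apply: esum_ge0 => k _; rewrite !mule_ge0.
transitivity (\esum_(n in [set: nat]) \esum_(k in [set: nat])
   ((c n * conv_pow c m k)%:E * srw_prob R (n + k) x))%E.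
  apply: eq_esum => n _; rewrite esum_exchange; last first.
    by move=> y k; rewrite !mule_ge0.
  apply: eq_esum => k _; rewrite -srw_prob_add -esum_muleZl; last 2 first.
  - by rewrite lee_fin mulr_ge0// conv_pow_ge0.
  - by move=> y; exact: mule_ge0.
  by apply: eq_esum => y _; rewrite EFinM muleACA.
under eq_esum => n _.
  rewrite -nneseries_esumT; last first.
    by move=> k; rewrite mule_ge0// lee_fin mulr_ge0// conv_pow_ge0.
  over.
rewrite -nneseries_esumT; last first.
  move=> n; apply: nneseries_ge0 => k _ _.
  by rewrite mule_ge0// lee_fin mulr_ge0// conv_pow_ge0.
rewrite nneseries_cauchy; last first.
  by move=> n k; rewrite mule_ge0// lee_fin mulr_ge0// conv_pow_ge0.
rewrite -nneseries_esumT; last by move=> k; exact: mule_ge0.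
apply: eq_eseriesr => N _ /=; rewrite -sumEFin ge0_sume_distrl; last first.
  by move=> i _; rewrite lee_fin mulr_ge0// conv_pow_ge0.
by apply: eq_bigr => i _; rewrite subnKC// -ltnS.
Qed.

(** In m steps of the subordinated walk, k steps of the simple walk are taken with weight
    conv_pow c m k; summing over m first gives the renewal sequence. *)
Lemma green_functionE (C : nat -> R) (x : 'rV[int]_d) : renewal_sequence c C ->
  (green_function psi x = \sum_(1 <= k <oo) ((C k)%:E * srw_prob R k x))%E.
Proof.
move=> CR; have P0 := @srw_prob_ge0 R d.
have cp0 j k : (0 <= (conv_pow c j k)%:E)%E by rewrite lee_fin conv_pow_ge0.
have Ck k : C k = \sum_(m < k.+1) conv_pow c m k by exact: renewal_conv_pow.
have C0 k : 0 <= C k by rewrite Ck sumr_ge0// => m _; exact: conv_pow_ge0.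
transitivity (\sum_(m <oo) \sum_(k <oo) ((conv_pow c m.+1 k)%:E * srw_prob R k x))%E.
  rewrite /green_function -nneseries_addn; last first.
    by move=> m; rewrite subordinated_probE; apply: esum_ge0 => k _; exact: mule_ge0.
  apply: eq_eseriesr => m _; rewrite addn1 subordinated_probE.
  by rewrite nneseries_esumT// => k; exact: mule_ge0.
rewrite nneseries_interchange; last by move=> m k; exact: mule_ge0.
rewrite nneseries_recl//; last by move=> k _; apply: nneseries_ge0 => m _ _; exact: mule_ge0.
rewrite eseries0 ?add0e; last by move=> m _ _; rewrite conv_pow_eq0// mul0e.
rewrite -[LHS]nneseries_addn; last first.
  by move=> k; apply: nneseries_ge0 => m _ _; exact: mule_ge0.
rewrite -[RHS]nneseries_addn; last by move=> k; rewrite mule_ge0 ?lee_fin.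
apply: eq_eseriesr => k _; rewrite addn1 Ck big_ord_recl.
rewrite (_ : conv_pow c _ k.+1 = 0)// add0r.
rewrite (nneseries_split 0 k.+1); last by move=> m _; exact: mule_ge0.
rewrite [X in (_ + X)%E]eseries0 ?adde0; last first.
  by move=> m km _; rewrite conv_pow_eq0 ?mul0e//; lia.
rewrite add0n big_mkord -sumEFin ge0_sume_distrl//.
Qed.
End green.

(** * Comparison of the Green function with an integral *)

(** The integrand of F(t)/t times the law of the walk at a Poisson(t) time, after the substitution
    t = a/u, for which dt/t = du/u up to orientation. *)
Definition mixed_kernel {R : realType} {d : nat} (F : R -> R) (a : R) (x : 'rV[int]_d)
    (u : R) : R :=
  F (a / u) / u * \prod_(i < d) skellam (a / u / d%:R) (x 0 i).

(** The contribution to mixed_kernel of the event that the Poisson variable is n. *)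
Definition kernel_term {R : realType} {d : nat} (F : R -> R) (a : R) (x : 'rV[int]_d)
    (n : nat) (u : R) : \bar R :=
  ((n`!%:R)^-1%:E * srw_prob R n x * (F (a / u) * gamma_kernel n a u)%:E)%E.

Lemma mixed_kernel_series {R : realType} {d : nat} (F : R -> R) (a : R) (x : 'rV[int]_d) (u : R) :
  (0 < d)%N -> (forall y : R, 0 < y -> 0 < F y) -> 0 < a -> 0 < u ->
  ((mixed_kernel F a x u)%:E = \sum_(n <oo) kernel_term F a x n u)%E.
Proof.
move=> d0 F0 a0 u0; have t0 : 0 < a / u by rewrite divr_gt0.
rewrite /mixed_kernel EFinM -poisson_srw ?(ltW t0)// -nneseriesZl; last first.
  move=> n _; rewrite mule_ge0 ?srw_prob_ge0// lee_fin divr_ge0//.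
  by rewrite mulr_ge0 ?expR_ge0// exprn_ge0// ltW.
apply: eq_eseriesr => n _; rewrite muleA -EFinM /kernel_term [RHS]muleAC -EFinM; congr (_%:E * _)%E.
by rewrite /gamma_kernel; ring.
Qed.

Lemma kernel_term_ge0 {R : realType} {d : nat} (F : R -> R) (a : R) (x : 'rV[int]_d) n (u : R) :
  (forall y : R, 0 < y -> 0 < F y) -> 0 < a -> 0 < u -> (0 <= kernel_term F a x n u)%E.
Proof.
move=> F0 a0 u0; rewrite /kernel_term mule_ge0 ?mule_ge0 ?srw_prob_ge0 ?lee_fin ?invr_ge0//.
by rewrite mulr_ge0 ?gamma_kernel_ge0// ltW// F0// divr_gt0.
Qed.

Lemma measurable_kernel_term {R : realType} {d : nat} (F : R -> R) (a : R) (x : 'rV[int]_d) n :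
  {homo F : x y / x <= y} ->
  measurable_fun (`]0%R, +oo[%classic : set R) (kernel_term F a x n).
Proof.
move=> Fm; apply: emeasurable_funM; first exact: measurable_cst.
apply/measurable_EFinP; apply: measurable_funM; last exact: measurable_gamma_kernel.
exact: measurable_nondecreasing_inv.
Qed.

Lemma measurable_mixed_kernel {R : realType} {d : nat} (F : R -> R) (a : R) (x : 'rV[int]_d) :
  (0 < d)%N -> (forall y : R, 0 < y -> 0 < F y) -> {homo F : x y / x <= y} -> 0 < a ->
  measurable_fun (`]0%R, +oo[%classic : set R) (fun u => (mixed_kernel F a x u)%:E).
Proof.
move=> d0 F0 Fm a0.
apply: (@eq_measurable_fun _ _ _ _ _ (fun u => \sum_(n <oo) kernel_term F a x n u)%E).
  by move=> u; rewrite inE/= in_itv/= andbT => u0; rewrite -mixed_kernel_series.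
apply: ge0_emeasurable_sum.
  by move=> n u; rewrite /= in_itv/= andbT => u0 _; exact: kernel_term_ge0.
by move=> n _; exact: measurable_kernel_term.
Qed.

Lemma integral_mixed_kernel {R : realType} {d : nat} (F : R -> R) (a : R) (x : 'rV[int]_d) :
  (0 < d)%N -> (forall y : R, 0 < y -> 0 < F y) -> {homo F : x y / x <= y} -> 0 < a ->
  (\int[lebesgue_measure]_(u in `]0%R, +oo[) (mixed_kernel F a x u)%:E =
   \sum_(n <oo) \int[lebesgue_measure]_(u in `]0%R, +oo[) kernel_term F a x n u)%E.
Proof.
move=> d0 F0 Fm a0; rewrite -integral_nneseries//.
- by apply: eq_integral => u; rewrite inE/= in_itv/= andbT => u0; exact: mixed_kernel_series.
- by move=> n; exact: measurable_kernel_term.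
- by move=> n u; rewrite /= in_itv/= andbT => u0; exact: kernel_term_ge0.
Qed.

Lemma integral_kernel_term {R : realType} {d : nat} (F : R -> R) (a : R) (x : 'rV[int]_d) n :
  (forall y : R, 0 < y -> 0 < F y) -> {homo F : x y / x <= y} -> 0 < a ->
  (\int[lebesgue_measure]_(u in `]0%R, +oo[) kernel_term F a x n u =
   (n`!%:R)^-1%:E * srw_prob R n x *
   \int[lebesgue_measure]_(u in `]0%R, +oo[) (F (a / u) * gamma_kernel n a u)%:E)%E.
Proof.
move=> F0 Fm a0; rewrite /kernel_term srw_probE -EFinM ge0_integralZl//.
- apply/measurable_EFinP; apply: measurable_funM; last exact: measurable_gamma_kernel.
  exact: measurable_nondecreasing_inv.
- move=> u; rewrite /= in_itv/= andbT => u0.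
  by rewrite lee_fin mulr_ge0 ?gamma_kernel_ge0// ltW// F0// divr_gt0.
- by rewrite lee_fin !mulr_ge0 ?invr_ge0 ?walk_seq_ge0// exprn_ge0.
Qed.

Lemma exists_large_coord {R : realType} {d : nat} (x : 'rV[int]_d) : (0 < d)%N ->
  exists i : 'I_d, euclidean_norm R x ^+ 2 <= d%:R * (x 0 i)%:~R ^+ 2.
Proof.
move=> d0; rewrite sqr_sqrtr; last by apply: sumr_ge0 => i _; exact: sqr_ge0.
pose i0 := Ordinal d0.
have [i _ imax] := @Order.TotalTheory.arg_maxP _ _ _ i0 xpredT
  (fun i : 'I_d => ((x 0 i)%:~R ^+ 2 : R)) isT.
exists i; rewrite mulr_natl -[d in _ *+ d]card_ord -sumr_const.
by apply: ler_sum => j _; exact: imax.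
Qed.

(** Some coordinate of x is at least |x|/sqrt d, and each step moves a coordinate by at most 1. *)
Lemma srw_prob_far {R : realType} {d : nat} (N : nat) (x : 'rV[int]_d) n : (0 < d)%N ->
  d%:R * N%:R < euclidean_norm R x -> (n <= N)%N -> srw_prob R n x = 0%E.
Proof.
move=> d0 xN nN; have [i xi] := @exists_large_coord R d x d0.
rewrite srw_probE (@walk_seq_eq0 _ _ _ _ _ i) ?mulr0 ?mem_enum//.
apply: (leq_ltn_trans nN); rewrite -(ltr_nat R).
have d1 : 1 <= d%:R :> R by rewrite ler1n.
have N0 : 0 <= N%:R :> R by [].
have h : (d%:R * N%:R) ^+ 2 < d%:R * (x 0 i)%:~R ^+ 2 :> R.
  apply: lt_le_trans xi; rewrite ltr_pXn2r// ?nnegrE ?sqrtr_ge0// mulr_ge0//.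
have xa : (x 0 i)%:~R ^+ 2 = (`|x 0%R i|%N)%:R ^+ 2 :> R.
  by rewrite -[LHS]ger0_norm ?sqr_ge0// normrX -intr_norm pmulrn abszE.
rewrite xa exprMn expr2 -mulrA ltr_pM2l in h; last by lra.
have h2 : N%:R ^+ 2 < (`|x 0%R i|%N)%:R ^+ 2 :> R.
  apply: le_lt_trans h; rewrite ler_peMl// sqr_ge0//.
by rewrite -(@ltr_pXn2r _ 2)// ?nnegrE.
Qed.

(** Both series have terms p(n,x) times a weight close to F(n)/n when n is large: for G this is the
    hypothesis on C, for H it is gamma_mean. The terms of small n vanish once x is far away. The
    comparison is uniform in a, which is free to depend on x. *)
Lemma green_compare {R : realType} {d : nat} (r eta g : R) (F : R -> R) (C : nat -> R) :
  (0 < d)%N -> (forall y : R, 0 < y -> 0 < F y) -> {homo F : x y / x <= y} ->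
  regularly_varying r F -> r < 1 -> 0 < eta -> eta < 1 ->
  (forall n, 0 <= C n) -> 0 < g ->
  g * C n * n%:R / F n%:R @[n --> \oo] --> (1 : R) ->
  exists M : R, forall (x : 'rV[int]_d) (a : R), M < euclidean_norm R x -> 0 < a ->
  let H := (\int[lebesgue_measure]_(u in `]0%R, +oo[) (mixed_kernel F a x u)%:E)%E in
  let G := (\sum_(1 <= k <oo) ((C k)%:E * srw_prob R k x))%E in
  ((1 - eta)%:E * H <= (1 + eta)%:E * (g%:E * G) /\
   (1 - eta)%:E * (g%:E * G) <= (1 + eta)%:E * H)%E.
Proof.
move=> d0 F0 Fm rv r1 eta0 eta1 C0 g0 CF.
have [N HN] := gamma_mean r eta F F0 Fm rv r1 eta0 eta1.
have : 1 - eta < 1 by lra.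
move=> /(cvgr_gt _ CF) [N1 _ HN1].
have : 1 < 1 + eta by lra.
move=> /(cvgr_lt _ CF) [N2 _ HN2].
pose K := (maxn N (maxn N1 N2)).+1.
exists (d%:R * K%:R) => x a xM a0 H G.
have pfar n : (n <= K)%N -> srw_prob R n x = 0%E by exact: srw_prob_far.
have P0 := @srw_prob_ge0 R d.
pose T n : \bar R := (\int[lebesgue_measure]_(u in `]0%R, +oo[) kernel_term F a x n u)%E.
have T0 n : (0 <= T n)%E.
  by apply: integral_ge0 => u; rewrite /= in_itv/= andbT => u0; exact: kernel_term_ge0.
have TE n := integral_kernel_term F a x n F0 Fm a0.
have HE : H = (\sum_(1 <= n <oo) T n)%E.
  rewrite /H integral_mixed_kernel// nneseries_recl//; last by move=> n _; exact: T0.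
  by rewrite TE pfar// mule0 mul0e add0e.
have GE : (g%:E * G = \sum_(1 <= n <oo) ((g * C n)%:E * srw_prob R n x))%E.
  rewrite /G -nneseriesZl; last by move=> n _; rewrite mule_ge0 ?lee_fin.
  by apply: eq_eseriesr => n _; rewrite muleA -EFinM.
have gC0 n : (0 <= (g * C n)%:E * srw_prob R n x)%E.
  by rewrite mule_ge0// lee_fin mulr_ge0// ltW.
have Tb n : (K < n)%N ->
    (((1 - eta) * (F n%:R / n%:R))%:E * srw_prob R n x <= T n)%E /\
    (T n <= ((1 + eta) * (F n%:R / n%:R))%:E * srw_prob R n x)%E.
  case: n => // m; rewrite ltnS => Km.
  have Nm : (N <= m)%N by rewrite (leq_trans _ Km)// ltnW// ltnS leq_maxl.
  have [lo hi] := HN m a Nm a0.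
  have f0 : m`!%:R != 0 :> R by rewrite pnatr_eq0 -lt0n fact_gt0.
  have m0 : m.+1%:R != 0 :> R by rewrite pnatr_eq0.
  have E1 c : c * (F m.+1%:R / m.+1%:R) = (m.+1`!%:R)^-1 * (c * (F m.+1%:R * m`!%:R)).
    by rewrite factS natrM; field; rewrite f0 addrC natr1 m0.
  have w0 : (0 <= ((m.+1`!%:R)^-1 : R)%:E)%E by rewrite lee_fin invr_ge0.
  rewrite /T TE !E1 !(EFinM (m.+1`!%:R)^-1) -!muleA ![(srw_prob R m.+1 x * _)%E]muleC.
  split; apply: lee_wpmul2l => //; exact: lee_wpmul2r.
have Cb n : (K < n)%N -> (1 - eta) * (F n%:R / n%:R) <= g * C n /\
    g * C n <= (1 + eta) * (F n%:R / n%:R).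
  move=> Kn; have n0 : 0 < n%:R :> R by rewrite ltr0n (leq_trans _ Kn).
  have Fn : 0 < F n%:R by exact: F0.
  have n1 : (N1 <= n)%N.
    rewrite (leq_trans _ (ltnW Kn))// /K ltnW// ltnS; apply: leq_trans (leq_maxr _ _).
    exact: leq_maxl.
  have n2 : (N2 <= n)%N.
    rewrite (leq_trans _ (ltnW Kn))// /K ltnW// ltnS; apply: leq_trans (leq_maxr _ _).
    exact: leq_maxr.
  have := HN1 n n1; have := HN2 n n2 => /=.
  rewrite ltr_pdivrMr// ltr_pdivlMr// => h2 h1.
  by rewrite !mulrA ler_pdivrMr// ler_pdivlMr// !ltW.
have e1 : 0 <= 1 - eta by lra.
have e2 : 0 <= 1 + eta by lra.
rewrite GE HE; split.
  rewrite -!nneseriesZl//.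
  apply: lee_nneseries => n *; first by rewrite mule_ge0 ?lee_fin.
  have [nK|Kn] := leqP n K; first by rewrite /T TE !pfar// !(mule0, mul0e).
  have [_ hi] := Tb n Kn; have [lo _] := Cb n Kn.
  apply: (@le_trans _ _ ((1 - eta)%:E * (((1 + eta) * (F n%:R / n%:R))%:E * srw_prob R n x)))%E.
    by apply: lee_wpmul2l => //; rewrite lee_fin.
  rewrite !muleA -!EFinM; apply: lee_wpmul2r => //; rewrite lee_fin.
  by rewrite mulrCA ler_wpM2l.
rewrite -!nneseriesZl//.
apply: lee_nneseries => n *; first by rewrite mule_ge0 ?lee_fin.
have [nK|Kn] := leqP n K; first by rewrite /T TE !pfar// !(mule0, mul0e).
have [lo _] := Tb n Kn; have [_ hi] := Cb n Kn.
apply: (@le_trans _ _ ((1 + eta)%:E * (((1 - eta) * (F n%:R / n%:R))%:E * srw_prob R n x)))%E.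
  rewrite !muleA -!EFinM; apply: lee_wpmul2r => //; rewrite lee_fin.
  by rewrite [leRHS]mulrCA ler_wpM2l.
by apply: lee_wpmul2l => //; rewrite lee_fin.
Qed.

(** * Limit of the integral *)

Lemma powR_bump_ge_small {R : realType} (g u : R) : 0 < g -> 0 < u -> u <= 1 ->
  u `^ (g - 1) <= 4 / g * powR_bump g u.
Proof.
move=> g0 u0 u1; have ug : u `^ g <= 1.
  have h1 : 1 = 1 `^ g :> R by rewrite powR1.
  by rewrite [leRHS]h1 ge0_ler_powR ?nnegrE// ltW.
have -> : 4 / g * powR_bump g u = u `^ (g - 1) * (4 / (1 + u `^ g) ^+ 2).
  by rewrite /powR_bump; field; rewrite !gt_eqF// ltr_wpDr// powR_ge0.
have p := powR_ge0 u g.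
rewrite ler_peMr ?powR_ge0// ler_pdivlMr ?exprn_gt0 ?ltr_wpDr// mul1r.
have : (1 + u `^ g) ^+ 2 <= 2 ^+ 2 by apply: lerXn2r; rewrite ?nnegrE; lra.
by have -> : (2 : R) ^+ 2 = 4 by rewrite -natrX.
Qed.

Lemma powR_bump_ge_large {R : realType} (g u : R) : 0 < g -> 1 <= u ->
  u `^ (- g - 1) <= 4 / g * powR_bump g u.
Proof.
move=> g0 u1; have u0 : 0 < u by lra.
have ug : 1 <= u `^ g by rewrite -(powRr0 u) ler_powR// ltW.
have p := powR_gt0 g u0.
have -> : 4 / g * powR_bump g u = u `^ (g - 1) * (4 / (1 + u `^ g) ^+ 2).
  by rewrite /powR_bump; field; rewrite !gt_eqF// ltr_wpDr// powR_ge0.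
have -> : u `^ (- g - 1) = u `^ (g - 1) * (u `^ g) ^- 2.
  rewrite -powR_invn ?powR_ge0// -powRrM -powRD; last by rewrite (gt_eqF u0) implybT.
  by congr (_ `^ _); lra.
rewrite ler_pM2l ?powR_gt0// ler_pdivlMr ?exprn_gt0 ?ltr_wpDr ?powR_ge0//.
rewrite mulrC ler_pdivrMr ?exprn_gt0//.
have : (1 + u `^ g) ^+ 2 <= (2 * u `^ g) ^+ 2 by apply: lerXn2r; rewrite ?nnegrE; lra.
by rewrite exprMn -natrX.
Qed.

Lemma sqrt_expn {R : realType} (u : R) n : 0 <= u -> Num.sqrt u ^+ n = u `^ (n%:R / 2).
Proof.
by move=> u0; rewrite -powR12_sqrt// -powR_mulrn ?powR_ge0// -powRrM mulrC.
Qed.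

Lemma skellam_le0 {R : realType} (s : R) (j : int) : 0 <= s -> skellam s j <= skellam s 0.
Proof. by move=> s0; rewrite skellam_abs; exact: (skellam_antitone s 0 _ s0). Qed.

Lemma sqrt_skellam_le {R : realType} (k0 a u : R) (d : nat) (j : int) :
  (forall s : R, 0 < s -> skellam s 0 <= k0 / Num.sqrt s) -> (0 < d)%N -> 0 < a -> 0 < u ->
  Num.sqrt a * skellam (a / u / d%:R) j <= k0 * Num.sqrt d%:R * Num.sqrt u.
Proof.
move=> hk d0 a0 u0; have dn : 0 < d%:R :> R by rewrite ltr0n.
set s := a / u / d%:R; have s0 : 0 < s by rewrite !divr_gt0.
have ra : Num.sqrt a = Num.sqrt d%:R * Num.sqrt u * Num.sqrt s.
  rewrite -!sqrtrM ?mulr_ge0// ?ltW//; congr Num.sqrt.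
  by rewrite /s; field; rewrite !gt_eqF.
apply: (@le_trans _ _ (Num.sqrt a * (k0 / Num.sqrt s))).
  by rewrite ler_wpM2l ?sqrtr_ge0// (le_trans (skellam_le0 _ _ (ltW s0)))// hk.
have w0 : 0 < Num.sqrt s by rewrite sqrtr_gt0.
rewrite ra le_eqVlt; apply/orP; left; apply/eqP.
by field; rewrite gt_eqF.
Qed.

(** With s = a/(ud) one has sqrt a = sqrt(ud) sqrt s, and sqrt s q(s, 0) is bounded. *)
Lemma prod_sqrt_skellam_le {R : realType} (k0 a u : R) (d : nat) (x : 'rV[int]_d) :
  (forall s : R, 0 < s -> skellam s 0 <= k0 / Num.sqrt s) -> (0 < d)%N -> 0 < a -> 0 < u ->
  \prod_(i < d) (Num.sqrt a * skellam (a / u / d%:R) (x 0 i)) <=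
  (k0 * Num.sqrt d%:R) ^+ d * u `^ (d%:R / 2).
Proof.
move=> hk d0 a0 u0; rewrite -sqrt_expn ?(ltW u0)// -exprMn.
have -> : (k0 * Num.sqrt d%:R * Num.sqrt u) ^+ d =
    \prod_(i < d) (k0 * Num.sqrt d%:R * Num.sqrt u) by rewrite prodr_const card_ord.
apply: ler_prod => i _; rewrite sqrt_skellam_le// andbT mulr_ge0 ?sqrtr_ge0// skellam_ge0//.
by rewrite !divr_ge0 ?(ltW a0) ?(ltW u0).
Qed.

(** With the given a one has s = |x|^2/(2u), and some coordinate satisfies x_i^2 >= |x|^2/d; the
    polynomial decay of order d in this coordinate turns u^(d/2) into u^(-d/2). *)
Lemma prod_sqrt_skellam_le_far {R : realType} (k0 a u : R) (d : nat) (x : 'rV[int]_d) :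
  (forall s : R, 0 < s -> skellam s 0 <= k0 / Num.sqrt s) -> (0 < d)%N -> 0 < a -> 0 < u ->
  d%:R * 3 ^+ d <= euclidean_norm R x -> a = d%:R / 2 * euclidean_norm R x ^+ 2 ->
  \prod_(i < d) (Num.sqrt a * skellam (a / u / d%:R) (x 0 i)) <=
  (9 ^+ d * d%:R) ^+ d * (k0 * Num.sqrt d%:R) ^+ d * u `^ (- (d%:R / 2)).
Proof.
move=> hk d0 a0 u0 xd aE; have dn : 0 < d%:R :> R by rewrite ltr0n.
have d1 : 1 <= d%:R :> R by rewrite ler1n.
have [i xi] := @exists_large_coord R d x d0.
set s := a / u / d%:R; have s0 : 0 < s by rewrite !divr_gt0.
set j := `|x 0%R i|%N.
have xa : (x 0 i)%:~R ^+ 2 = j%:R ^+ 2 :> R.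
  by rewrite -[LHS]ger0_norm ?sqr_ge0// normrX -intr_norm /j pmulrn abszE.
rewrite xa in xi.
have t0 : 0 < 3 ^+ d :> R by rewrite exprn_gt0.
have jd : (3 ^ d <= j)%N.
  rewrite -(ler_nat R) natrX -(@ler_pXn2r _ 2)// ?nnegrE ?(ltW t0)//.
  rewrite -(ler_pM2l dn); apply: le_trans xi.
  apply: (@le_trans _ _ ((d%:R * 3 ^+ d) ^+ 2)).
    by rewrite exprMn ler_wpM2r ?sqr_ge0// expr2 ler_peMl// ltW.
  by apply: lerXn2r; rewrite ?nnegrE ?sqrtr_ge0// mulr_ge0// ltW.
have j0 : 0 < j%:R :> R by rewrite ltr0n (leq_trans _ jd)// expn_gt0.
have sj : s / j%:R ^+ 2 <= d%:R / (2 * u).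
  rewrite ler_pdivrMr ?exprn_gt0// mulrAC ler_pdivlMr ?mulr_gt0//.
  have -> : s * (2 * u) = euclidean_norm R x ^+ 2.
    by rewrite /s aE; field; rewrite !gt_eqF.
  by [].
have q1 : 0 <= 2 * 9 ^+ d * s / j%:R ^+ 2.
  apply: divr_ge0; last exact: sqr_ge0.
  by apply: mulr_ge0; [rewrite mulr_ge0// exprn_ge0 | exact: ltW].
have fi : Num.sqrt a * skellam s (x 0 i) <=
    (9 ^+ d * d%:R / u) ^+ d * (k0 * Num.sqrt d%:R * Num.sqrt u).
  have h := skellam_poly_decay s d j s0 jd.
  rewrite skellam_abs -/j.
  apply: (@le_trans _ _ (Num.sqrt a * ((2 * 9 ^+ d * s / j%:R ^+ 2) ^+ d * skellam s 0))).
    by rewrite ler_wpM2l ?sqrtr_ge0.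
  rewrite mulrCA; apply: ler_pM.
  - exact: exprn_ge0.
  - by rewrite mulr_ge0 ?sqrtr_ge0// skellam_ge0// ltW.
  - apply: lerXn2r; rewrite ?nnegrE.
    + exact: q1.
    + by rewrite divr_ge0 ?(ltW u0)// mulr_ge0 ?exprn_ge0.
    have -> : 9 ^+ d * d%:R / u = 2 * 9 ^+ d * (d%:R / (2 * u)).
      by field; rewrite gt_eqF.
    by rewrite -mulrA ler_wpM2l// mulr_ge0// exprn_ge0.
  - exact: (sqrt_skellam_le k0 a u d 0).
have others : \prod_(k < d | k != i) (Num.sqrt a * skellam s (x 0 k)) <=
    (k0 * Num.sqrt d%:R * Num.sqrt u) ^+ d.-1.
  have -> : (k0 * Num.sqrt d%:R * Num.sqrt u) ^+ d.-1 =
      \prod_(k < d | k != i) (k0 * Num.sqrt d%:R * Num.sqrt u).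
    by rewrite prodr_const cardC1 card_ord.
  apply: ler_prod => k _; rewrite sqrt_skellam_le// andbT.
  by rewrite mulr_ge0 ?sqrtr_ge0// skellam_ge0// ltW.
rewrite (bigD1 i)//=.
apply: (@le_trans _ _ ((9 ^+ d * d%:R / u) ^+ d * (k0 * Num.sqrt d%:R * Num.sqrt u) *
  (k0 * Num.sqrt d%:R * Num.sqrt u) ^+ d.-1)).
  apply: ler_pM => //; first by rewrite mulr_ge0 ?sqrtr_ge0// skellam_ge0// ltW.
  by apply: prodr_ge0 => k _; rewrite mulr_ge0 ?sqrtr_ge0// skellam_ge0// ltW.
rewrite -mulrA -exprS prednK// !exprMn (@sqrt_expn _ u) ?(ltW u0)// exprVn.
rewrite le_eqVlt; apply/orP; left; apply/eqP.
have -> : u `^ (- (d%:R / 2)) = u `^ (d%:R / 2) / u ^+ d.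
  rewrite -powR_mulrn ?(ltW u0)// -powRB; last by rewrite (gt_eqF u0) implybT.
  by congr (_ `^ _); lra.
by ring.
Qed.

(** For u <= 1 Potter gives u^(-b), and u^(d/2 - b - 1) is integrable at 0 since b < d/2. For
    u >= 1 monotonicity bounds the quotient of the values of F by 1, and the decay of the kernel
    gives u^(-d/2 - 1). A single explicit density dominates both. *)
Lemma mixed_kernel_dom {R : realType} {d : nat} (F : R -> R) (X b k0 a u g c1 : R)
    (x : 'rV[int]_d) :
  g = d%:R / 2 - b -> c1 = (k0 * Num.sqrt d%:R) ^+ d ->
  (forall s : R, 0 < s -> skellam s 0 <= k0 / Num.sqrt s) -> 0 < k0 -> (0 < d)%N ->
  (forall y : R, 0 < y -> 0 < F y) -> {homo F : x y / x <= y} ->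
  (forall x s : R, X <= x -> 1 <= s -> F (s * x) <= 2 `^ b * s `^ b * F x) ->
  0 <= b -> b < d%:R / 2 -> X <= a -> 0 < a -> 0 < u ->
  d%:R * 3 ^+ d <= euclidean_norm R x -> a = d%:R / 2 * euclidean_norm R x ^+ 2 ->
  Num.sqrt a ^+ d / F a * mixed_kernel F a x u <=
    (2 `^ b * c1 + (9 ^+ d * d%:R) ^+ d * c1) * (4 / g) * powR_bump g u.
Proof.
move=> gE c1E hk k00 d0 F0 Fm pot b0 bd Xa a0 u0 xd aE.
have g0 : 0 < g by rewrite gE subr_gt0.
have Fa : 0 < F a by exact: F0.
have Fau : 0 < F (a / u) by rewrite F0// divr_gt0.
have c10 : 0 <= c1 by rewrite c1E exprn_ge0// mulr_ge0 ?sqrtr_ge0// ltW.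
pose P := \prod_(i < d) (Num.sqrt a * skellam (a / u / d%:R) (x 0 i)).
have P0 : 0 <= P.
  apply: prodr_ge0 => i _; rewrite mulr_ge0 ?sqrtr_ge0// skellam_ge0//.
  by rewrite !divr_ge0 ?(ltW a0) ?(ltW u0).
have -> : Num.sqrt a ^+ d / F a * mixed_kernel F a x u = F (a / u) / F a / u * P.
  have -> : P = Num.sqrt a ^+ d * \prod_(i < d) skellam (a / u / d%:R) (x 0 i).
    by rewrite /P big_split/= prodr_const card_ord.
  by rewrite /mixed_kernel; move: (F _) (F _) => f1 f2; ring.
have c20 : 0 <= (9 ^+ d * d%:R) ^+ d * c1 by rewrite mulr_ge0// exprn_ge0// mulr_ge0// exprn_ge0.
have bump0 : 0 <= 4 / g * powR_bump g u.
  by rewrite mulr_ge0 ?powR_bump_ge0// divr_ge0// ltW.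
have q0 : 0 <= 2 `^ b * c1 by rewrite mulr_ge0 ?powR_ge0.
rewrite -[leRHS]mulrA [leRHS]mulrDl; have [u1|u1] := leP u 1.
  apply: (@le_trans _ _ (2 `^ b * c1 * (4 / g * powR_bump g u))); last first.
    by rewrite lerDl mulr_ge0.
  apply: (@le_trans _ _ (2 `^ b * c1 * u `^ (g - 1))); last first.
    by rewrite ler_wpM2l// powR_bump_ge_small.
  have h1 : F (a / u) / F a <= 2 `^ b * u `^ (- b).
    have e : u^-1 `^ b = u `^ (- b).
      by rewrite -powR_inv1 ?(ltW u0)// -powRrM mulN1r.
    rewrite ler_pdivrMr// -e; have := pot a u^-1 Xa.
    by rewrite invf_ge1// => /(_ u1); rewrite [u^-1 * a]mulrC.
  have h2 := prod_sqrt_skellam_le k0 a u d x hk d0 a0 u0.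
  rewrite -/P -c1E in h2.
  apply: (@le_trans _ _ (2 `^ b * u `^ (- b) / u * (c1 * u `^ (d%:R / 2)))).
    apply: ler_pM => //; first by rewrite !divr_ge0 ?ltW.
    by rewrite ler_wpM2r// invr_ge0 ltW.
  rewrite le_eqVlt; apply/orP; left; apply/eqP.
  have -> : u `^ (g - 1) = u `^ (d%:R / 2) * u `^ (- b) / u.
    by rewrite -[u^-1](powR_inv1 (ltW u0)) -!powRD ?(gt_eqF u0) ?implybT// gE.
  by ring.
apply: (@le_trans _ _ ((9 ^+ d * d%:R) ^+ d * c1 * (4 / g * powR_bump g u))); last first.
  by rewrite lerDr mulr_ge0.
apply: (@le_trans _ _ ((9 ^+ d * d%:R) ^+ d * c1 * u `^ (- g - 1))); last first.
  by rewrite ler_wpM2l// powR_bump_ge_large// ltW.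
have h1 : F (a / u) / F a <= 1.
  rewrite ler_pdivrMr// mul1r; apply: Fm.
  by rewrite ler_pdivrMr// ler_peMr// ltW.
have h2 := prod_sqrt_skellam_le_far k0 a u d x hk d0 a0 u0 xd aE.
rewrite -/P -c1E in h2.
apply: (@le_trans _ _ (1 / u * ((9 ^+ d * d%:R) ^+ d * c1 * u `^ (- (d%:R / 2))))).
  apply: ler_pM => //; first by rewrite !divr_ge0 ?ltW.
  by rewrite ler_wpM2r// invr_ge0 ltW.
rewrite mul1r mulrCA ler_wpM2l// -[u^-1]powR_inv1 ?(ltW u0)//.
rewrite -powRD ?(gt_eqF u0) ?implybT//; apply: ler_powR; first exact: ltW.
by rewrite gE; lra.
Qed.

Lemma cvg_prod_seq {R : realType} (I : Type) (s : seq I) (f : I -> nat -> R) (l : I -> R) :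
  (forall i, f i n @[n --> \oo] --> l i) ->
  \prod_(i <- s) f i n @[n --> \oo] --> \prod_(i <- s) l i.
Proof.
move=> fl; elim: s => [|i s IH].
  by rewrite big_nil; under eq_fun do rewrite big_nil; exact: cvg_cst.
by rewrite big_cons; under eq_fun do rewrite big_cons; exact: cvgM.
Qed.

Lemma coord_le_norm {R : realType} {d : nat} (x : 'rV[int]_d) (i : 'I_d) :
  (`|x 0%R i|%N)%:R <= euclidean_norm R x.
Proof.
rewrite -[leLHS]ger0_norm// -sqrtr_sqr ler_wsqrtr//.
have -> : (`|x 0%R i|%N)%:R ^+ 2 = (x 0 i)%:~R ^+ 2 :> R.
  by rewrite -[RHS]ger0_norm ?sqr_ge0// normrX -intr_norm pmulrn abszE.
by rewrite (bigD1 i)//= lerDl sumr_ge0// => k _; exact: sqr_ge0.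
Qed.

(** With s = a/(ud) the squares of the coordinates sum to 2us, so the product of the Gaussian factors
    exp(-x_i^2/(2s)) is e^(-u) exactly, and each coordinate is at most sqrt(2u) sqrt s, as
    cvg_skellam_ratio requires. This is why the limit does not depend on the direction of x. *)
Lemma cvg_prod_skellam {R : realType} {d : nat} (x : nat -> 'rV[int]_d) (u : R) : (0 < d)%N ->
  0 < u -> (forall n, 0 < euclidean_norm R (x n)) ->
  euclidean_norm R (x n) @[n --> \oo] --> +oo ->
  let a n := d%:R / 2 * euclidean_norm R (x n) ^+ 2 in
  \prod_(i < d) (Num.sqrt (a n) * skellam (a n / u / d%:R) (x n 0 i)) @[n --> \oo] -->
  Num.sqrt (d%:R / (2 * pi)) ^+ d * (u `^ (d%:R / 2) * expR (- u)).
Proof.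
move=> d0 u0 r0 roo a; have dn : 0 < d%:R :> R by rewrite ltr0n.
have a0 n : 0 < a n by rewrite mulr_gt0 ?divr_gt0 ?exprn_gt0.
pose s n := a n / u / d%:R.
have s0 n : 0 < s n by rewrite !divr_gt0.
have p20 : 0 < 2 * pi :> R by rewrite mulr_gt0 ?pi_gt0.
have soo : s n @[n --> \oo] --> +oo.
  have -> : s = fun n => (2 * u)^-1 * euclidean_norm R (x n) * euclidean_norm R (x n).
    by apply/funext => n; rewrite /s /a; field; rewrite !gt_eqF.
  apply: ger_cvgy (cvg_mulry _ _ (_ : 0 < (2 * u)^-1) roo); last by rewrite invr_gt0 mulr_gt0.
  near=> n; rewrite ler_peMr ?mulr_ge0 ?invr_ge0 ?mulr_ge0 ?(ltW u0) ?sqrtr_ge0//.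
  by near: n; exact: (cvgry_ge roo).
have sa n : Num.sqrt (a n) = Num.sqrt (u * d%:R) * Num.sqrt (s n).
  rewrite -sqrtrM ?mulr_ge0 ?ltW//; congr Num.sqrt.
  by rewrite /s; field; rewrite !gt_eqF.
have rs n : euclidean_norm R (x n) = Num.sqrt (2 * u) * Num.sqrt (s n).
  rewrite -sqrtrM ?mulr_ge0 ?ltW// -[LHS]ger0_norm ?ltW// -sqrtr_sqr; congr Num.sqrt.
  by rewrite /s /a; field; rewrite !gt_eqF.
pose rho i n := skellam (s n) (x n 0 i) / skellam (s n) 0 *
  expR ((x n 0 i)%:~R ^+ 2 / (2 * s n)).
have crho i : rho i n @[n --> \oo] --> (1 : R).
  rewrite (_ : rho i = fun n => skellam (s n) (`|x n 0%R i|%N) / skellam (s n) 0 *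
      expR ((`|x n 0%R i|%N)%:R ^+ 2 / (2 * s n))); last first.
    apply/funext => n; have xa : (x n 0 i)%:~R ^+ 2 = (`|x n 0%R i|%N)%:R ^+ 2 :> R.
      by rewrite -[LHS]ger0_norm ?sqr_ge0// normrX -intr_norm pmulrn abszE.
    by rewrite /rho xa [skellam (s n) (x n 0 i)]skellam_abs.
  have bnd n : (`|x n 0%R i|%N)%:R <= Num.sqrt (2 * u) * Num.sqrt (s n).
    by rewrite -rs; exact: coord_le_norm.
  exact: (cvg_skellam_ratio (Num.sqrt (2 * u)) s (fun n => `|x n 0%R i|%N)
    (sqrtr_ge0 _) soo bnd).
have cs0 : Num.sqrt (s n) * skellam (s n) 0 @[n --> \oo] --> (Num.sqrt (2 * pi))^-1.
  exact: ((cvg_pinftyP _ _).1 cvg_skellam0).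
have cprod : \prod_(i < d) (Num.sqrt (u * d%:R) * (Num.sqrt (s n) * skellam (s n) 0) * rho i n)
    * expR (- u) @[n --> \oo] -->
    \prod_(i < d) (Num.sqrt (u * d%:R) * (Num.sqrt (2 * pi))^-1 * 1) * expR (- u).
  apply: cvgMl; apply: cvg_prod_seq => i; apply: cvgM; last exact: crho.
  exact: cvgMr.
have -> : Num.sqrt (d%:R / (2 * pi)) ^+ d * (u `^ (d%:R / 2) * expR (- u)) =
    \prod_(i < d) (Num.sqrt (u * d%:R) * (Num.sqrt (2 * pi))^-1 * 1) * expR (- u).
  rewrite prodr_const card_ord mulr1 mulrA -sqrt_expn ?(ltW u0)// -exprMn; congr (_ ^+ _ * _).
  rewrite [Num.sqrt (d%:R / _)]sqrtrM// sqrtrV ?(ltW p20)//.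
  by rewrite [Num.sqrt (u * _)]sqrtrM ?(ltW u0)//; ring.
apply: cvg_trans cprod; apply: near_eq_cvg; apply: nearW => n.
have -> : expR (- u) = \prod_(i < d) expR (- ((x n 0 i)%:~R ^+ 2 / (2 * s n))).
  rewrite -expR_sum; congr expR; rewrite sumrN -mulr_suml; congr (- _).
  rewrite -[X in _ = X / _]sqr_sqrtr; last by apply: sumr_ge0 => i _; exact: sqr_ge0.
  rewrite -/(euclidean_norm R (x n)) /s /a; field; rewrite !gt_eqF//.
rewrite -big_split/=; apply: eq_bigr => i _; rewrite sa -/(s n).
have q0 := skellam0_gt0 (s n) (ltW (s0 n)).
rewrite /rho expRN; have e0 := expR_gt0 ((x n 0 i)%:~R ^+ 2 / (2 * s n) : R).
by move: (expR _) e0 => e e0; field; rewrite !gt_eqF.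
Unshelve. all: by end_near. Qed.

(** Dominated convergence; the exponent b of the Potter bound is taken halfway between r and d/2. *)
Lemma cvg_integral_mixed_kernel {R : realType} {d : nat} (r : R) (F : R -> R) :
  (0 < d)%N -> (forall y : R, 0 < y -> 0 < F y) -> {homo F : x y / x <= y} ->
  regularly_varying r F -> 0 < r -> r < d%:R / 2 ->
  exists2 M : R, 0 < M & forall x : nat -> 'rV[int]_d,
    (forall n, M < euclidean_norm R (x n)) -> euclidean_norm R (x n) @[n --> \oo] --> +oo ->
    let a n := d%:R / 2 * euclidean_norm R (x n) ^+ 2 in
    let L u := Num.sqrt (d%:R / (2 * pi)) ^+ d * (u `^ (d%:R / 2 - r - 1) * expR (- u)) in
    lebesgue_measure.-integrable (`]0%R, +oo[%classic : set R) (fun u => (L u)%:E) /\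
    (\int[lebesgue_measure]_(u in `]0%R, +oo[)
       (Num.sqrt (a n) ^+ d / F (a n) * mixed_kernel F (a n) (x n) u)%:E)%E @[n --> \oo] -->
    (\int[lebesgue_measure]_(u in `]0%R, +oo[) (L u)%:E)%E.
Proof.
move=> d0 F0 Fm rv r0 rd; have dn : 0 < d%:R :> R by rewrite ltr0n.
pose b := (r + d%:R / 2) / 2.
have rb : r < b by rewrite /b; lra.
have bd : b < d%:R / 2 by rewrite /b; lra.
have b0 : 0 <= b by rewrite /b; lra.
have [X X0 pot] := potter r b F F0 Fm rv rb b0.
have [k0 k00 hk] := @skellam0_bound R.
exists (Num.max (d%:R * 3 ^+ d) (Num.max 1 (2 * X))).
  by rewrite !lt_max ltr01 orbT.
move=> x xM roo a L.
have r1 n : 1 <= euclidean_norm R (x n).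
  by have := xM n; rewrite !gt_max => /and3P[_ /ltW].
have r00 n : 0 < euclidean_norm R (x n) by exact: lt_le_trans (r1 n).
have far n : d%:R * 3 ^+ d <= euclidean_norm R (x n).
  by have := xM n; rewrite !gt_max => /and3P[/ltW].
have a0 n : 0 < a n by rewrite mulr_gt0 ?divr_gt0 ?exprn_gt0.
have d1 : 1 <= d%:R :> R by rewrite ler1n.
have Xa n : X <= a n.
  have := xM n; rewrite !gt_max => /and3P[_ _ /ltW Xr].
  rewrite /a; have : euclidean_norm R (x n) <= euclidean_norm R (x n) ^+ 2.
    by rewrite expr2 ler_peMr// ltW.
  set z := _ ^+ 2 => rz; have z0 : 0 <= z by rewrite sqr_ge0.
  by have : 1 / 2 * z <= d%:R / 2 * z; [rewrite ler_wpM2r//; lra | lra].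
have aoo : a n @[n --> \oo] --> +oo.
  apply: ger_cvgy (cvg_mulry _ _ (_ : 0 < d%:R / 2) roo); last by rewrite divr_gt0.
  apply: nearW => n; rewrite /a ler_pM2l ?divr_gt0//.
  by rewrite expr2 ler_peMr// ltW.
have mD : measurable (`]0%R, +oo[%classic : set R) by exact: measurable_itv.
pose g := d%:R / 2 - b; have g0 : 0 < g by rewrite subr_gt0.
pose c1 := (k0 * Num.sqrt d%:R) ^+ d.
have := @dominated_convergence _ _ R lebesgue_measure `]0%R, +oo[%classic mD
  (fun n u => (Num.sqrt (a n) ^+ d / F (a n) * mixed_kernel F (a n) (x n) u)%:E)
  (fun u => (L u)%:E)
  (fun u => ((2 `^ b * c1 + (9 ^+ d * d%:R) ^+ d * c1) * (4 / g) * powR_bump g u)%:E).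
case.
- move=> n; apply: (@eq_measurable_fun _ _ _ _ _
    (fun u => (Num.sqrt (a n) ^+ d / F (a n))%:E * (mixed_kernel F (a n) (x n) u)%:E)%E).
    by move=> u _; rewrite EFinM.
  by apply: measurable_funeM; exact: measurable_mixed_kernel.
- apply/measurable_EFinP; apply: measurable_funM => //; apply: measurable_funM.
    by apply: measurable_funTS; exact: measurable_powR.
  by apply: measurableT_comp => //; exact: measurable_expR.
- apply: aeW => u; rewrite /= in_itv/= andbT => u0.
  apply: cvg_EFin; first exact: nearW.
  have c1' : F (u^-1 * a n) / F (a n) @[n --> \oo] --> u^-1 `^ r.
    have ui : 0 < u^-1 by rewrite invr_gt0.
    exact: ((cvg_pinftyP _ _).1 (rv _ ui)).
  have c2 := cvg_prod_skellam x u d0 u0 r00 roo.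
  rewrite (_ : L u = u^-1 `^ r * u^-1 * (Num.sqrt (d%:R / (2 * pi)) ^+ d *
     (u `^ (d%:R / 2) * expR (- u)))); last first.
    rewrite /L !powRB ?(gt_eqF u0) ?implybT// powRr1 ?(ltW u0)//.
    have -> : u^-1 `^ r = (u `^ r)^-1.
      by rewrite -powR_inv1 ?(ltW u0)// -powRrM mulN1r powRN.
    by ring.
  have c3 : F (u^-1 * a n) / F (a n) * u^-1 *
     \prod_(i < d) (Num.sqrt (a n) * skellam (a n / u / d%:R) (x n 0 i)) @[n --> \oo] -->
     u^-1 `^ r * u^-1 * (Num.sqrt (d%:R / (2 * pi)) ^+ d * (u `^ (d%:R / 2) * expR (- u))).
    by apply: cvgM => //; exact: cvgMl.
  apply: cvg_trans c3; apply: near_eq_cvg; apply: nearW => n /=.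
  have -> : \prod_(i < d) (Num.sqrt (a n) * skellam (a n / u / d%:R) (x n 0 i)) =
      Num.sqrt (a n) ^+ d * \prod_(i < d) skellam (a n / u / d%:R) (x n 0 i).
    by rewrite big_split/= prodr_const card_ord.
  by rewrite /mixed_kernel [u^-1 * _]mulrC; move: (F _) (F _) => f1 f2; ring.
- exact: integrable_powR_bump.
- apply: aeW => u n; rewrite /= in_itv/= andbT => u0.
  rewrite lee_fin ger0_norm; last first.
    rewrite mulr_ge0 ?divr_ge0 ?exprn_ge0 ?sqrtr_ge0 ?(ltW (F0 _ _))//.
    rewrite /mixed_kernel mulr_ge0 ?divr_ge0 ?(ltW u0)//; first by rewrite ltW// F0// divr_gt0.
    by apply: prodr_ge0 => i _; rewrite skellam_ge0// !divr_ge0 ?(ltW (a0 n)) ?(ltW u0).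
  exact: (mixed_kernel_dom F X b k0 (a n) u g c1 (x n)).
- by move=> i1 _ i3; split.
Qed.

(** * Auxiliary facts on filters, Bernstein functions and the Gamma function *)

Lemma bernstein_nondecreasing {R : realType} (psi : R -> R) (x y : R) :
  bernstein psi -> 0 < x -> x <= y -> psi x <= psi y.
Proof.
move=> [_ dpsi spsi _] x0; rewrite le_eqVlt => /predU1P[->//|xy].
have dv z : 0 < z -> derivable psi z 1 by move=> z0; have := dpsi 0%N z z0; rewrite derive1n0.
apply: (@ger0_derive1_le_cc _ psi x y); rewrite ?in_itv/= ?lexx ?(ltW xy)//.
- by move=> z; rewrite in_itv/= => /andP[xz _]; apply: dv; exact: lt_trans xz.
- move=> z; rewrite in_itv/= => /andP[xz _].
  have := spsi 1%N z isT (lt_trans x0 xz).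
  by rewrite expr0 mul1r derive1n1.
- apply: derivable_within_continuous => z; rewrite in_itv/= => /andP[xz _].
  by apply: dv; exact: lt_le_trans xz.
Qed.

(** If the limit failed, a point outside the neighbourhood could be chosen at distance at least n
    for each n. This reduces the theorem to sequences, to which dominated convergence applies. *)
Lemma norm_infty_seq {R : realType} {d : nat} {T : topologicalType} (M : R)
    (f : 'rV[int]_d -> T) (l : T) :
  (forall x : nat -> 'rV[int]_d, (forall n, M < euclidean_norm R (x n)) ->
     euclidean_norm R (x n) @[n --> \oo] --> +oo -> f (x n) @[n --> \oo] --> l) ->
  f x @[x --> @norm_infty R d] --> l.
Proof.
move=> H U Ul; apply: contrapT => nU.
have ex n : exists x : 'rV[int]_d, Num.max M n%:R < euclidean_norm R x /\ ~ U (f x).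
  apply: contrapT => /forallNP h; apply: nU; exists (Num.max M n%:R) => // x /= Mx.
  by apply: contrapT => Ufx; apply: (h x).
pose x n := projT1 (cid (ex n)).
have xP n : Num.max M n%:R < euclidean_norm R (x n) /\ ~ U (f (x n)) := projT2 (cid (ex n)).
have xM n : M < euclidean_norm R (x n) by have [+ _] := xP n; rewrite gt_max => /andP[].
have xoo : euclidean_norm R (x n) @[n --> \oo] --> +oo.
  apply: ger_cvgy (@cvgr_idn R); apply: nearW => n.
  by have [+ _] := xP n; rewrite gt_max => /andP[_ /ltW].
have [N _ HN] := H x xM xoo U Ul.
by have [_] := xP N; apply; apply: (HN N); exact: leqnn.
Qed.

Lemma Gamma_ge0 {R : realType} (s : R) : 0 <= Gamma s.
Proof.
apply: fine_ge0; apply: integral_ge0 => t _.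
by rewrite lee_fin mulr_ge0 ?powR_ge0 ?expR_ge0.
Qed.

Lemma measurable_gamma_integrand {R : realType} (p : R) :
  measurable_fun [set: R] (fun t : R => t `^ p * expR (- t)).
Proof.
apply: measurable_funM; first exact: measurable_powR.
apply: continuous_measurable_fun => z.
by apply: continuous_comp; [exact: continuousN | exact: continuous_expR].
Qed.

(** On (1, 2] the integrand is at least e^(-2)/2. *)
Lemma integral_gamma_gt0 {R : realType} (s : R) : 0 < s ->
  (0 < \int[lebesgue_measure]_(t in `]0%R, +oo[) (t `^ (s - 1) * expR (- t))%:E)%E.
Proof.
move=> s0.
have f0 (t : R) : (0 <= (t `^ (s - 1) * expR (- t))%:E)%E.
  by rewrite lee_fin mulr_ge0 ?powR_ge0 ?expR_ge0.
apply: (@lt_le_trans _ _ (\int[lebesgue_measure]_(t in `]1%R, 2%R])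
  (t `^ (s - 1) * expR (- t))%:E)%E); last first.
  apply: ge0_subset_integral => //.
  - by apply/measurable_EFinP/measurable_funTS; exact: measurable_gamma_integrand.
  - by move=> t; rewrite /= !in_itv/= andbT => /andP[t1 _]; lra.
apply: (@lt_le_trans _ _ (\int[lebesgue_measure]_(t in `]1%R, 2%R])
  (cst (2^-1 * expR (- 2))%:E t))%E).
  rewrite integral_cst; last exact: measurable_itv.
  rewrite /= lebesgue_measure_itv/= lte_fin ltr1n/= -EFinB -EFinM lte_fin.
  by rewrite !mulr_gt0 ?invr_gt0 ?expR_gt0 ?subr_gt0 ?ltr1n.
apply: ge0_le_integral => //.
- by move=> t _; rewrite lee_fin mulr_ge0 ?expR_ge0 ?invr_ge0.
- by apply/measurable_EFinP/measurable_funTS; exact: measurable_gamma_integrand.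
- move=> t; rewrite /= in_itv/= => /andP[t1 t2]; rewrite lee_fin; apply: ler_pM.
  + by rewrite invr_ge0.
  + exact: expR_ge0.
  + apply: (@le_trans _ _ (t `^ (-1))).
      by rewrite powR_inv1; [rewrite lef_pV2 ?posrE; lra | lra].
    by apply: ler_powR; [exact: ltW | lra].
  + by rewrite ler_expR lerN2.
Qed.

(** * Asymptotics of the Green function *)

(** If q lies within a factor (1 + t)/(1 - t) of p, then p - q is of order t z, because p is at most
    2 z and q at most 3 p. *)
Lemma dist_le_of_ratio {R : realType} (p q t z e : R) :
  0 < t -> t <= 2^-1 -> t * (16 * z) <= e -> 0 <= p -> 0 <= q ->
  `|z - p| <= e / 2 -> `|z - p| <= z ->
  (1 - t) * p <= (1 + t) * q -> (1 - t) * q <= (1 + t) * p -> `|z - q| <= e.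
Proof.
move=> t0 t2 te p0 q0; rewrite !ler_norml => /andP[a1 a2] /andP[a3 a4] b1 b2.
have t4 : 2^-1 * q <= (1 - t) * q by rewrite ler_wpM2r//; lra.
have t5 : (1 + t) * p <= 3 / 2 * p by rewrite ler_wpM2r//; lra.
have t1 : q <= 3 * p by move: t4 t5 b2; move: ((1 - t) * q) ((1 + t) * p) => v w; lra.
have t3 : t * (p + q) <= t * (8 * z) by rewrite ler_wpM2l//; lra.
by apply/andP; split; lra.
Qed.

(** green_compare holds for every eta, so Gamma(r) G and the integral have the same limit after
    normalization; finiteness of G for large x follows in the same way. *)
Lemma green_asymptotic {R : realType} {d : nat} (r g : R) (F : R -> R) (C : nat -> R) :
  (0 < d)%N -> (forall y : R, 0 < y -> 0 < F y) -> {homo F : x y / x <= y} ->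
  regularly_varying r F -> 0 < r -> r < 1 -> r < d%:R / 2 ->
  (forall n, 0 <= C n) -> 0 < g ->
  g * C n * n%:R / F n%:R @[n --> \oo] --> (1 : R) ->
  let G (x : 'rV[int]_d) := (\sum_(1 <= k <oo) ((C k)%:E * srw_prob R k x))%E in
  exists2 M : R, 0 < M & forall x : nat -> 'rV[int]_d,
    (forall n, M < euclidean_norm R (x n)) -> euclidean_norm R (x n) @[n --> \oo] --> +oo ->
    let a n := d%:R / 2 * euclidean_norm R (x n) ^+ 2 in
    let lim := Num.sqrt (d%:R / (2 * pi)) ^+ d * Gamma (d%:R / 2 - r) in
    [/\ 0 < lim, (\forall n \near \oo, G (x n) \is a fin_num) &
      Num.sqrt (a n) ^+ d / F (a n) * (g * fine (G (x n))) @[n --> \oo] --> lim].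
Proof.
move=> d0 F0 Fm rv r0 r1 rd C0 g0 CF G.
have [M M0 HM] := cvg_integral_mixed_kernel r F d0 F0 Fm rv r0 rd.
exists M => // x xM roo a lim; have [Li Hc] := HM x xM roo.
have dn : 0 < d%:R :> R by rewrite ltr0n.
have r00 n : 0 < euclidean_norm R (x n) by exact: lt_trans (xM n).
have a0 n : 0 < a n by rewrite mulr_gt0 ?divr_gt0 ?exprn_gt0.
pose k n := Num.sqrt (a n) ^+ d / F (a n).
have k0 n : 0 < k n by rewrite divr_gt0 ?F0// exprn_gt0// sqrtr_gt0.
pose H n := (\int[lebesgue_measure]_(u in `]0%R, +oo[) (mixed_kernel F (a n) (x n) u)%:E)%E.
have mk0 n (u : R) : 0 < u -> (0 <= (mixed_kernel F (a n) (x n) u)%:E)%E.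
  move=> u0; rewrite mixed_kernel_series//; apply: nneseries_ge0 => m _ _.
  exact: kernel_term_ge0.
have H0 n : (0 <= H n)%E.
  by apply: integral_ge0 => u; rewrite /= in_itv/= andbT => /mk0.
have G0 n : (0 <= G (x n))%E.
  by apply: nneseries_ge0 => m _ _; rewrite mule_ge0 ?srw_prob_ge0 ?lee_fin.
have kH n : (\int[lebesgue_measure]_(u in `]0%R, +oo[)
    (k n * mixed_kernel F (a n) (x n) u)%:E = (k n)%:E * H n)%E.
  rewrite -ge0_integralZl//.
  - exact: measurable_mixed_kernel.
  - by move=> u; rewrite /= in_itv/= andbT => /mk0.
  - by rewrite lee_fin ltW.
pose s := Num.sqrt (d%:R / (2 * pi) : R) ^+ d.
have p20 : 0 < 2 * pi :> R by rewrite mulr_gt0 ?pi_gt0.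
have s0 : 0 < s by rewrite exprn_gt0// sqrtr_gt0 divr_gt0.
have g20 : 0 < d%:R / 2 - r by rewrite subr_gt0.
pose I := (\int[lebesgue_measure]_(t in `]0%R, +oo[)
  (t `^ (d%:R / 2 - r - 1) * expR (- t))%:E)%E.
have sI : (\int[lebesgue_measure]_(u in `]0%R, +oo[)
    (s * (u `^ (d%:R / 2 - r - 1) * expR (- u)))%:E = s%:E * I)%E.
  rewrite -ge0_integralZl//.
  - by apply/measurable_EFinP/measurable_funTS; exact: measurable_gamma_integrand.
  - by move=> u _; rewrite lee_fin mulr_ge0 ?powR_ge0 ?expR_ge0.
  - by rewrite lee_fin ltW.
have I0 : (0 < I)%E by exact: integral_gamma_gt0.
have Ifin : I \is a fin_num.
  have : (s%:E * I)%E \is a fin_num.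
    by rewrite -sI; apply: integrable_fin_num => //; exact: Li.
  by move: (I) I0 => [i| |]//=; rewrite gt0_muley ?lte_fin.
have IG : I = (Gamma (d%:R / 2 - r))%:E by rewrite -[LHS]fineK.
have limE : (s%:E * I = lim%:E)%E by rewrite IG -EFinM.
have lim0 : 0 < lim by rewrite -lte_fin -limE mule_gt0// lte_fin.
rewrite -/s sI limE in Hc.
have {Hc} Hc : ((k n)%:E * H n)%E @[n --> \oo] --> lim%:E.
  by rewrite (_ : (fun n => _) = (fun n => \int[lebesgue_measure]_(u in `]0%R, +oo[)
    (k n * mixed_kernel F (a n) (x n) u)%:E)%E)//; apply/funext => n; rewrite kH.
have /fine_cvgP[kHfin kHc] := Hc.
have Hfin : \forall n \near \oo, H n \is a fin_num.
  near=> n; have : ((k n)%:E * H n)%E \is a fin_num by near: n.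
  by case: (H n) (H0 n) => [h| |]//= _; rewrite gt0_muley ?lte_fin.
have cmp eta : 0 < eta -> eta < 1 -> \forall n \near \oo,
    ((1 - eta)%:E * H n <= (1 + eta)%:E * (g%:E * G (x n)) /\
    (1 - eta)%:E * (g%:E * G (x n)) <= (1 + eta)%:E * H n)%E.
  move=> e0 e1; have [N HN] := green_compare r eta g F C d0 F0 Fm rv r1 e0 e1 C0 g0 CF.
  near=> n; apply: HN => //; near: n; exact: (cvgry_gt roo).
have Gfin : \forall n \near \oo, G (x n) \is a fin_num.
  have h2 := cmp 2^-1 ltac:(lra) ltac:(lra).
  near=> n; have [_ hi] : ((1 - 2^-1)%:E * H n <= (1 + 2^-1)%:E * (g%:E * G (x n)) /\
    (1 - 2^-1)%:E * (g%:E * G (x n)) <= (1 + 2^-1)%:E * H n)%E by near: n.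
  have : H n \is a fin_num by near: n.
  move: hi; case: (G (x n)) (G0 n) => [y| |]//= _.
  have h : 0 < 1 - 2^-1 :> R by lra.
  by rewrite !gt0_muley ?lte_fin//; case: (H n).
split=> //.
have cr eta : 0 < eta -> eta < 1 -> \forall n \near \oo,
    (1 - eta) * (k n * fine (H n)) <= (1 + eta) * (k n * (g * fine (G (x n)))) /\
    (1 - eta) * (k n * (g * fine (G (x n)))) <= (1 + eta) * (k n * fine (H n)).
  move=> e0 e1; have h2 := cmp eta e0 e1; near=> n.
  have [h3 h4] : ((1 - eta)%:E * H n <= (1 + eta)%:E * (g%:E * G (x n)) /\
    (1 - eta)%:E * (g%:E * G (x n)) <= (1 + eta)%:E * H n)%E by near: n.
  have f1 : H n \is a fin_num by near: n.
  have f2 : G (x n) \is a fin_num by near: n.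
  move: h3 h4; rewrite -{1 2}(fineK f1) -{1 2}(fineK f2) -!EFinM !lee_fin => h3 h4.
  by rewrite !(mulrCA _ (k n)) !ler_pM2l.
have kHc' : k n * fine (H n) @[n --> \oo] --> lim.
  apply: cvg_trans kHc; apply: near_eq_cvg; near=> n => /=.
  by have f1 : H n \is a fin_num; [near: n | rewrite -{1}(fineK f1)].
apply/cvgrPdist_le => e e0.
pose eta := Num.min 2^-1 (e / (16 * lim)).
have l16 : 0 < 16 * lim by rewrite mulr_gt0.
have eta0 : 0 < eta by rewrite lt_min invr_gt0 ltr0n divr_gt0.
have eta2 : eta <= 2^-1 by rewrite ge_min lexx.
have etae : eta * (16 * lim) <= e by rewrite -ler_pdivlMr// ge_min lexx orbT.
have eta1 : eta < 1 by lra.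
have h2 := cr eta eta0 eta1.
have e20 : 0 < e / 2 by rewrite divr_gt0.
have h3 : \forall n \near \oo, `|lim - k n * fine (H n)| <= e / 2.
  by have /cvgrPdist_le := kHc'; apply.
have h4 : \forall n \near \oo, `|lim - k n * fine (H n)| <= lim.
  by have /cvgrPdist_le := kHc'; apply.
near=> n.
have h5 : `|lim - k n * fine (H n)| <= e / 2 by near: n.
have h6 : `|lim - k n * fine (H n)| <= lim by near: n.
have [] : (1 - eta) * (k n * fine (H n)) <= (1 + eta) * (k n * (g * fine (G (x n)))) /\
    (1 - eta) * (k n * (g * fine (G (x n)))) <= (1 + eta) * (k n * fine (H n)) by near: n.
have p0 : 0 <= k n * fine (H n) by rewrite mulr_ge0 ?(ltW (k0 n))// fine_ge0.
have q0 : 0 <= k n * (g * fine (G (x n))).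
  by rewrite mulr_ge0 ?(ltW (k0 n))// mulr_ge0 ?(ltW g0)// fine_ge0.
exact: (dist_le_of_ratio _ _ eta lim).
Unshelve. all: by end_near.
Qed.

(** Matches the constant of the integral with the stated one; the factors in d/2 come from
    a = d |x|^2/2. *)
Lemma green_constE {R : realType} {d : nat} (alpha : R) : (0 < d)%N -> Gamma (alpha / 2) != 0 ->
  Num.sqrt (d%:R / (2 * pi)) ^+ d * Gamma (d%:R / 2 - alpha / 2) =
  Gamma (alpha / 2) * green_const d alpha * Num.sqrt (d%:R / 2) ^+ d /
    (d%:R / 2) `^ (alpha / 2) :> R.
Proof.
move=> d0 g0; have pp : 0 < pi :> R by exact: pi_gt0.
have d20 : 0 < d%:R / 2 :> R by rewrite divr_gt0// ltr0n.
have -> : d%:R / (2 * pi) = d%:R / 2 / pi :> R by rewrite invfM mulrA.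
have -> : Num.sqrt (d%:R / 2 / pi) ^+ d =
    Num.sqrt (d%:R / 2) ^+ d * pi `^ (- (d%:R / 2)) :> R.
  rewrite powRN -sqrt_expn ?(ltW pp)// -exprVn -exprMn; congr (_ ^+ _).
  by rewrite -sqrtrV ?(ltW pp)// -sqrtrM ?(ltW d20).
rewrite /green_const; have -> : (d%:R - alpha) / 2 = d%:R / 2 - alpha / 2 by lra.
have := powR_gt0 (alpha / 2) d20; move: g0.
move: (Gamma (alpha / 2)) (_ `^ (alpha / 2)) (Gamma _) (_ ^+ _) (pi `^ _) => g u v w p g0 u0.
by field; rewrite g0 gt_eqF.
Qed.

(** Regular variation replaces F(c rho^2) by c^r F(rho^2). *)
Lemma cvg_rescale_green {R : realType} (d : nat) (r g c k : R) (F : R -> R) (rho G : nat -> R) :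
  (forall y, 0 < y -> 0 < F y) -> regularly_varying r F -> 0 < c -> g != 0 -> k != 0 ->
  (forall n, 0 < rho n) -> rho n @[n --> \oo] --> +oo ->
  Num.sqrt (c * rho n ^+ 2) ^+ d / F (c * rho n ^+ 2) * (g * G n) @[n --> \oo] -->
    g * k * Num.sqrt c ^+ d / c `^ r ->
  G n / (k * F (rho n ^+ 2) / rho n ^+ d) @[n --> \oo] --> (1 : R).
Proof.
move=> F0 rv c0 g0 k0 rho0 xoo h1.
have h2 : F (c * rho n ^+ 2) / F (rho n ^+ 2) @[n --> \oo] --> c `^ r.
  apply: (@cvg_comp _ _ _ (fun n => rho n ^+ 2) (fun y => F (c * y) / F y) _ +oo); last exact: rv.
  apply: (ger_cvgy _ xoo); near=> n; rewrite expr2 ler_peMr ?(ltW (rho0 n))//.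
  by near: n; exact: (cvgry_ge xoo).
have s0 : Num.sqrt c ^+ d != 0 by rewrite gt_eqF// exprn_gt0// sqrtr_gt0.
have p0 : c `^ r != 0 by rewrite gt_eqF// powR_gt0.
have := cvgM (cvgM h1 h2) (cvg_cst (g * k * Num.sqrt c ^+ d)^-1).
rewrite divfK// divff ?mulf_neq0// => /(_ _ _ _) h3.
apply: cvg_trans h3; apply: near_eq_cvg; apply: nearW => n /=.
have rn : rho n ^+ d != 0 by rewrite gt_eqF// exprn_gt0.
have -> : Num.sqrt (c * rho n ^+ 2) ^+ d = Num.sqrt c ^+ d * rho n ^+ d.
  by rewrite sqrtrM ?(ltW c0)// sqrtr_sqr ger0_norm ?exprMn// ltW.
have r20 : 0 < rho n ^+ 2 by rewrite exprn_gt0.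
have := lt0r_neq0 (F0 _ r20); have := lt0r_neq0 (F0 _ (mulr_gt0 c0 r20)).
rewrite /=; move: (F _) (F _) (_ ^+ d) (rho n ^+ d) s0 rn => f1 f2 z w s0 rn f10 f20.
by field; rewrite f10 f20 s0 rn k0 g0.
Unshelve. all: by end_near. Qed.

Theorem theorem2p4 (R : realType) (d : nat) (alpha : R) (psi l : R -> R)
    (C : nat -> R)
    (d_ge1 : (1 <= d)%N)
    (alpha_gt0 : 0 < alpha) (alpha_lt2 : alpha < 2) (alpha_ltd : alpha < d%:R)
    (psi_bernstein : bernstein psi) (psi0 : psi 0 = 0) (psi1 : psi 1 = 1)
    (l_slow : slowly_varying l)
    (psiE : forall lam : R, 0 < lam -> psi lam = lam `^ (alpha / 2) / l (1 / lam))
    (C_renewal : renewal_sequence (bernstein_weight psi) C)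
    (C_asymp : C n / ((Gamma (alpha / 2))^-1 *
                      n%:R `^ (alpha / 2 - 1) * l n%:R)
                 @[n --> \oo] --> (1 : R)) :
  (green_function psi x /
     (green_const d alpha /
        (euclidean_norm R x ^+ d * psi (1 / euclidean_norm R x ^+ 2)))%:E)%E
    @[x --> @norm_infty R d] --> (1%:E : \bar R).
Proof.
have [l0 lsv] := l_slow.
pose r := alpha / 2.
have r0 : 0 < r by rewrite divr_gt0.
have r1 : r < 1 by rewrite /r; lra.
have rd : r < d%:R / 2 by rewrite /r; lra.
pose F y := if 0 < y then y `^ r * l y else 0.
have FE y : 0 < y -> F y = y `^ r * l y by rewrite /F => ->.
have F0 y : 0 < y -> 0 < F y by move=> y0; rewrite FE// mulr_gt0 ?powR_gt0 ?l0.
have Fpsi y : 0 < y -> psi (1 / y) = (F y)^-1.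
  move=> y0; rewrite psiE ?divr_gt0// !div1r invrK FE// invfM; congr (_ / _).
  by rewrite -(powR_inv1 (ltW y0)) -powRrM mulN1r powRN.
have Fm : {homo F : x y / x <= y}.
  move=> x y xy; have [x0|x0] := ltP 0 x; last first.
    by rewrite {1}/F ltNge x0/= /F; case: ifP => // y0; rewrite mulr_ge0 ?powR_ge0// ltW// l0.
  have y0 : 0 < y by exact: lt_le_trans xy.
  have : psi (1 / y) <= psi (1 / x).
    apply: bernstein_nondecreasing => //; first by rewrite divr_gt0.
    by rewrite !div1r lef_pV2.
  by rewrite !Fpsi// lef_pV2 ?posrE ?F0.
have rv : regularly_varying r F.
  move=> c c0; have h : c `^ r * (l (c * x) / l x) @[x --> +oo] --> c `^ r * 1.
    by apply: cvgMr; exact: lsv.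
  rewrite mulr1 in h; apply: cvg_trans h; apply: near_eq_cvg; near=> x.
  have x0 : 0 < x by near: x; apply: nbhs_pinfty_gt; rewrite num_real.
  have := l0 x x0; have := powR_gt0 r x0.
  rewrite !FE ?mulr_gt0// powRM ?(ltW c0) ?(ltW x0)//.
  by move: (x `^ r) (l x) (l (c * x)) => u v w u0 v0; field; rewrite !gt_eqF.
pose g := Gamma r.
have CF : g * C n * n%:R / F n%:R @[n --> \oo] --> (1 : R).
  apply: cvg_trans C_asymp; apply: near_eq_cvg; near=> n.
  have n0 : 0 < n%:R :> R by rewrite ltr0n; near: n; exact: nbhs_infty_gt.
  rewrite FE// -/r -/g powRB ?(gt_eqF n0) ?implybT// powRr1 ?(ltW n0)//.
  rewrite !invfM !invrK; ring.
have g0 : 0 < g.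
  (* If Gamma r were 0, the sequence that tends to 1 by hypothesis would vanish identically. *)
  rewrite lt_neqAle Gamma_ge0 andbT eq_sym; apply/eqP => gz.
  have z : (fun n => g * C n * n%:R / F n%:R) = cst 0.
    by apply/funext => n; rewrite gz !mul0r.
  rewrite z in CF; have e : (1 : R) = 0 by apply: (norm_cvg_unique CF); exact: cvg_cst.
  by have := oner_eq0 R; rewrite e eqxx.
have C0 n : 0 <= C n.
  rewrite (renewal_conv_pow (bernstein_weight psi) C n erefl C_renewal).
  by apply: sumr_ge0 => m _; apply: conv_pow_ge0 => k; exact: bernstein_weight_ge0.
have [M M0 HM] := green_asymptotic r g F C d_ge1 F0 Fm rv r0 r1 rd C0 g0 CF.
apply: (norm_infty_seq M) => x xM xoo.
have [lim0 Gfin Glim] := HM x xM xoo.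
have {}gE := green_constE alpha d_ge1 (lt0r_neq0 g0).
rewrite gE -/g in lim0 Glim.
have k0 : green_const d alpha != 0 :> R.
  by apply: contraTneq lim0 => ->; rewrite mulr0 !mul0r ltxx.
pose rho n := euclidean_norm R (x n); pose k : R := green_const d alpha.
have rho0 n : 0 < rho n by exact: lt_trans (xM n).
have d20 : 0 < d%:R / 2 :> R by rewrite divr_gt0// ltr0n.
have key := cvg_rescale_green d _ _ _ _ F _ _ F0 rv d20 (lt0r_neq0 g0) k0 rho0 xoo Glim.
have kE n : k * F (rho n ^+ 2) / rho n ^+ d =
    k / (rho n ^+ d * psi (1 / rho n ^+ 2)).
  by rewrite Fpsi ?exprn_gt0// invfM invrK [_^-1 * _]mulrC mulrA.
apply: (@cvg_trans _ ((fine (\sum_(1 <= j <oo) ((C j)%:E * srw_prob R j (x n))%E) /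
    (k * F (rho n ^+ 2) / rho n ^+ d))%:E @[n --> \oo])); last first.
  by apply: cvg_EFin; [exact: nearW | exact: key].
apply: near_eq_cvg; near=> n.
rewrite -/(rho n) -/k kE EFinM fineK; last by near: n.
have D0 : k / (rho n ^+ d * psi (1 / rho n ^+ 2)) != 0.
  have h := lt0r_neq0 (rho0 n); have h2 : 0 < rho n ^+ 2 by rewrite exprn_gt0.
  rewrite -kE; apply: mulf_neq0; last by rewrite invr_neq0// expf_neq0.
  by apply: mulf_neq0 => //; exact: lt0r_neq0 (F0 _ h2).
by rewrite (green_functionE _ _ _ _ _ C_renewal) inver (negbTE D0).
Unshelve. all: by end_near. Qed.
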